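(* Let $S$ be a closed orientable surface of genus at least $2$. There are constants $C_1(S),C_2(S),C_3(S)$, depending only on $S$, such that for any non-negative integers $n,m$ and any $a \in \pi_1(S)$ with $\operatorname{cr}(a) > 0$ there is an inequality $$w_n(a^m) \ge \frac{C_1 m}{\sqrt{n} + C_2} - C_3 .$$
   Context: Fix a hyperbolic structure on $S$. Every nontrivial conjugacy class $[a]$ in $\pi_1(S)$ determines a unique closed geodesic $\gamma(a)$ in the corresponding free homotopy class. If $a$ is primitive, a self-intersection of $\gamma(a)$ is an unordered pair of distinct geodesics $\tilde\gamma_1,\tilde\gamma_2$ in the universal cover $\mathbb{H}^2$ which cover $\gamma(a)$ and have linked endpoints on the circle at infinity, taken up to the action of the deck group $\pi_1(S)$ on such pairs. The crossing number $\operatorname{cr}(a)$ of a primitive $a$ is the number of self-intersections of $\gamma(a)$; if $a = b^k$ with $b$ primitive, set $\operatorname{cr}(a) = k^2 \operatorname{cr}(b)$. (This does not depend on the chosen hyperbolic structure.) For each non-negative integer $n$, let $S_n \subset \pi_1(S)$ be the set of all elements with crossing number at most $n$; it is a symmetric generating set of $\pi_1(S)$. For $a \in \pi_1(S)$, $w_n(a)$ denotes the word length of $a$ with respect to the generating set $S_n$. *)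

(* Defs.v *)
(* concrete reals R.
   A closed orientable hyperbolic surface S of genus >= 2 is modelled by its
   Fuchsian group: pi_1(S) = Gamma / {+-I}, where Gamma is a torsion-free (mod +-I),
   discrete, cocompact subgroup of SL(2,R) containing -I, acting on the upper
   half plane H^2 by Moebius transformations. *)
From Stdlib Require Import Reals Lra List.
Open Scope R_scope.

Record Mat2 := mk2 { m11 : R; m12 : R; m21 : R; m22 : R }.

Definition mmul (A B : Mat2) : Mat2 :=
  mk2 (m11 A * m11 B + m12 A * m21 B) (m11 A * m12 B + m12 A * m22 B)
      (m21 A * m11 B + m22 A * m21 B) (m21 A * m12 B + m22 A * m22 B).
Definition mI : Mat2 := mk2 1 0 0 1.
Definition mneg (A : Mat2) : Mat2 := mk2 (- m11 A) (- m12 A) (- m21 A) (- m22 A).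
Definition mdet (A : Mat2) : R := m11 A * m22 A - m12 A * m21 A.
(* inverse of a determinant-one matrix *)
Definition minv (A : Mat2) : Mat2 := mk2 (m22 A) (- m12 A) (- m21 A) (m11 A).
Fixpoint mpow (A : Mat2) (k : nat) : Mat2 :=
  match k with O => mI | S k' => mmul A (mpow A k') end.
Definition mprod (l : list Mat2) : Mat2 := fold_right mmul mI l.
Definition conj (g b : Mat2) : Mat2 := mmul g (mmul b (minv g)).

(* equality in PSL(2,R) *)
Definition eqpm (A B : Mat2) : Prop := A = B \/ A = mneg B.

Definition surface_group (G : Mat2 -> Prop) : Prop :=
  (forall A, G A -> mdet A = 1) /\
  G mI /\ G (mneg mI) /\
  (forall A B, G A -> G B -> G (mmul A B)) /\
  (forall A, G A -> G (minv A)) /\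
  (* discrete: cosh d(i, A i) = (p^2+q^2+r^2+s^2)/2, finitely many in each ball *)
  (forall K, exists L : list Mat2, forall A, G A ->
      m11 A ^ 2 + m12 A ^ 2 + m21 A ^ 2 + m22 A ^ 2 <= K -> In A L) /\
  (forall A k, G A -> (k >= 1)%nat -> eqpm (mpow A k) mI -> eqpm A mI) /\
  (* cocompact: the orbit of i is K-dense for the hyperbolic metric,
     cosh d(z,w) = 1 + |z-w|^2/(2 Im z Im w); here A i = u + i v *)
  (exists K, forall x y, 0 < y -> exists A, G A /\
      let n := m21 A ^ 2 + m22 A ^ 2 in
      let u := (m11 A * m21 A + m12 A * m22 A) / n in
      let v := 1 / n in
      ((x - u) ^ 2 + (y - v) ^ 2) / (y * v) <= K).

(* Points of the circle at infinity R u {oo}: None = oo. *)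
Definition bdry := option R.

(* A fixes a boundary point under z |-> (pz+q)/(rz+s). *)
Definition fixes (A : Mat2) (z : bdry) : Prop :=
  match z with
  | None => m21 A = 0
  | Some x => m21 A * x ^ 2 + (m22 A - m11 A) * x - m12 A = 0
  end.

Definition side (x y z : bdry) : Prop :=
  match x, y, z with
  | Some a, Some b, Some c => Rmin a b < c < Rmax a b
  | Some a, None, Some c => a < c
  | None, Some b, Some c => b < c
  | _, _, _ => False
  end.

Definition linked4 (x1 y1 x2 y2 : bdry) : Prop :=
  x1 <> y1 /\ x1 <> x2 /\ x1 <> y2 /\ y1 <> x2 /\ y1 <> y2 /\ x2 <> y2 /\
  ~ (side x1 y1 x2 <-> side x1 y1 y2).

Definition axes_linked (A B : Mat2) : Prop :=
  exists x1 y1 x2 y2, fixes A x1 /\ fixes A y1 /\ fixes B x2 /\ fixes B y2 /\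
    linked4 x1 y1 x2 y2.

Definition same_axis (A B : Mat2) : Prop := forall z, fixes A z <-> fixes B z.

(* The lifts of gamma(b) are the axes of the conjugates g b g^-1, g in G.
   A pair (g1,g2) represents the pair of lifts axis(g1 b g1^-1), axis(g2 b g2^-1).
   Equivalence: unordered pairs of geodesics up to the deck action. *)
Definition pair_equiv (G : Mat2 -> Prop) (b : Mat2) (p q : Mat2 * Mat2) : Prop :=
  exists t, G t /\
    ((same_axis (conj (mmul t (fst p)) b) (conj (fst q) b) /\
      same_axis (conj (mmul t (snd p)) b) (conj (snd q) b)) \/
     (same_axis (conj (mmul t (fst p)) b) (conj (snd q) b) /\
      same_axis (conj (mmul t (snd p)) b) (conj (fst q) b))).

Definition lpair (G : Mat2 -> Prop) (b : Mat2) (p : Mat2 * Mat2) : Prop :=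
  G (fst p) /\ G (snd p) /\ axes_linked (conj (fst p) b) (conj (snd p) b).

Definition primitive (G : Mat2 -> Prop) (b : Mat2) : Prop :=
  G b /\ ~ eqpm b mI /\
  ~ (exists c k, G c /\ (k >= 2)%nat /\ eqpm b (mpow c k)).

(* number of self-intersections of gamma(b), b primitive, equals c:
   there are exactly c equivalence classes of linked pairs of lifts *)
Definition self_int (G : Mat2 -> Prop) (b : Mat2) (c : nat) : Prop :=
  exists L : list (Mat2 * Mat2), length L = c /\
    (forall p, In p L -> lpair G b p) /\
    (forall i j, (i < c)%nat -> (j < c)%nat -> i <> j ->
        ~ pair_equiv G b (nth i L (mI, mI)) (nth j L (mI, mI))) /\
    (forall p, lpair G b p -> exists q, In q L /\ pair_equiv G b p q).

Definition cr (G : Mat2 -> Prop) (a : Mat2) (c : nat) : Prop :=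
  exists b k c0, primitive G b /\ (k >= 1)%nat /\ eqpm a (mpow b k) /\
    self_int G b c0 /\ c = (k * k * c0)%nat.

Definition in_Sn (G : Mat2 -> Prop) (n : nat) (a : Mat2) : Prop :=
  G a /\ (eqpm a mI \/ exists c, cr G a c /\ (c <= n)%nat).

(* Main.v *)
Require Import Defs.
From Stdlib Require Import Reals List.
From Stdlib Require Import Lra Lia Classical ClassicalEpsilon.
Open Scope R_scope.

(* Let a be primitive and non-simple.  A gate is a translate of a pair of geodesics
   perpendicular to the axis of a, N periods of a apart, N depending only on the group.
   Let c(p,q) be the largest number of disjoint gates crossed in a row on the way from p
   to q, and f(p,q) = c(p,q) - c(q,p).  Two wide strips cannot cross, hence f is additive
   on triangles up to a universal error, and g |-> f(o, g o) is a quasimorphism.  It grows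
   at least like m/(N+1) along a^m: no gate of the axis of a is crossed backwards, because
   an almost-flip of that axis would have a short nontrivial commutator with a.  If the axis
   of a primitive b crosses r gates per period, then r distinct translates of it run along
   the same gate; a translate of the axis of a crosses the middle of that gate, and carries
   r further lifts linked with the first r.  A bounded number of these r^2 linked pairs are
   equivalent, so r^2 is at most a constant times the self-intersection number of b. *)

(* The obstacle is that [S_n] contains all powers of all simple elements, so whatever bounds word
   length from below must stay bounded along these powers; hyperbolic length does not. The gate
   count does: as [a] is not simple, some t in G moves its axis across the middle of the gate, and
   with it every geodesic running through the gate. An axis running through a gate is therefore
   crossed by its own translate, so the axis of a simple element crosses no gate at all, and no
   error accumulates along its powers. A generator b^j with cr(b) > 0 satisfies j^2 cr(b) <= n. Then
   j r and the j accumulated triangle errors are both of order sqrt(n); this is where the square in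
   cr(b^k) = k^2 cr(b) is used. The constants must not depend on [a]. With L = l^2 the multiplier of
   [a], the gate has ratio T = L^N, and everything asked of T is that it exceed a fixed power of L
   divided by a power of the trace gap e. Since L >= 1 + e, one N serves all [a]. *)
Infix "**" := mmul (at level 40, left associativity).

(** * Two-by-two matrices *)

Lemma mat_eq (A B : Mat2) :
  m11 A = m11 B -> m12 A = m12 B -> m21 A = m21 B -> m22 A = m22 B -> A = B.
Proof. destruct A, B; simpl; intros; subst; reflexivity. Qed.

Ltac mat := intros; apply mat_eq; simpl; try ring.

Lemma mmulA (A B C : Mat2) : A ** (B ** C) = A ** B ** C.
Proof. mat. Qed.

Lemma mmul1l (A : Mat2) : mI ** A = A.
Proof. mat. Qed.

Lemma mmul1r (A : Mat2) : A ** mI = A.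
Proof. mat. Qed.

Lemma mmulVl (A : Mat2) : mdet A = 1 -> minv A ** A = mI.
Proof. unfold mdet; intros; apply mat_eq; simpl; lra. Qed.

Lemma mmulVr (A : Mat2) : mdet A = 1 -> A ** minv A = mI.
Proof. unfold mdet; intros; apply mat_eq; simpl; lra. Qed.

Lemma mmulKV (A B : Mat2) : mdet B = 1 -> A ** B ** minv B = A.
Proof. intros; rewrite <- mmulA, mmulVr, mmul1r; auto. Qed.

Lemma mmulVK (A B : Mat2) : mdet B = 1 -> A ** minv B ** B = A.
Proof. intros; rewrite <- mmulA, mmulVl, mmul1r; auto. Qed.

Lemma minv_mul (A B : Mat2) : minv (A ** B) = minv B ** minv A.
Proof. mat. Qed.

Lemma minvK (A : Mat2) : minv (minv A) = A.
Proof. mat. Qed.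

Lemma mdet_mul (A B : Mat2) : mdet (A ** B) = mdet A * mdet B.
Proof. unfold mdet; simpl; ring. Qed.

Lemma mdet_mul1 (A B : Mat2) : mdet A = 1 -> mdet B = 1 -> mdet (A ** B) = 1.
Proof. intros HA HB; rewrite mdet_mul, HA, HB; ring. Qed.

Lemma mdet_inv (A : Mat2) : mdet (minv A) = mdet A.
Proof. unfold mdet; simpl; ring. Qed.

Lemma mdet_I : mdet mI = 1.
Proof. unfold mdet; simpl; ring. Qed.

Lemma mdet_pow (A : Mat2) (k : nat) : mdet A = 1 -> mdet (mpow A k) = 1.
Proof.
intros HA; induction k as [|k IH]; simpl; [exact mdet_I | now apply mdet_mul1].
Qed.

Lemma mnegK (A : Mat2) : mneg (mneg A) = A.
Proof. mat. Qed.

Lemma mneg_mull (A B : Mat2) : mneg A ** B = mneg (A ** B).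
Proof. mat. Qed.

Lemma mneg_mulr (A B : Mat2) : A ** mneg B = mneg (A ** B).
Proof. mat. Qed.

Lemma mneg_inv (A : Mat2) : minv (mneg A) = mneg (minv A).
Proof. mat. Qed.

Lemma mulIl (C A B : Mat2) : mdet C = 1 -> C ** A = C ** B -> A = B.
Proof.
intros HC E; rewrite <- (mmul1l A), <- (mmul1l B), <- (mmulVl C HC).
now rewrite <- !mmulA, E.
Qed.

Lemma mulIr (C A B : Mat2) : mdet C = 1 -> A ** C = B ** C -> A = B.
Proof.
intros HC E; rewrite <- (mmulKV A C HC), <- (mmulKV B C HC); now rewrite E.
Qed.

Lemma mpow_add (A : Mat2) (i j : nat) : mpow A (i + j) = mpow A i ** mpow A j.
Proof.
induction i as [|i IH]; simpl; [now rewrite mmul1l | now rewrite IH, mmulA].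
Qed.

Lemma mpow_mul (A : Mat2) (i j : nat) : mpow A (i * j) = mpow (mpow A i) j.
Proof.
induction j as [|j IH]; [now rewrite Nat.mul_0_r|].
now rewrite Nat.mul_succ_r, Nat.add_comm, mpow_add, IH.
Qed.

Lemma eqpm_refl (A : Mat2) : eqpm A A.
Proof. now left. Qed.

Lemma eqpm_sym (A B : Mat2) : eqpm A B -> eqpm B A.
Proof. intros [->| ->]; [left | right]; now rewrite ?mnegK. Qed.

Lemma eqpm_trans (A B C : Mat2) : eqpm A B -> eqpm B C -> eqpm A C.
Proof.
intros [->| ->] [->| ->]; rewrite ?mnegK; (now left) || now right.
Qed.

Lemma eqpm_mul (A A' B B' : Mat2) :
  eqpm A A' -> eqpm B B' -> eqpm (A ** B) (A' ** B').
Proof.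
intros [->| ->] [->| ->]; rewrite ?mneg_mull, ?mneg_mulr, ?mnegK;
 (now left) || now right.
Qed.

Lemma eqpm_inv (A B : Mat2) : eqpm A B -> eqpm (minv A) (minv B).
Proof. intros [->| ->]; rewrite ?mneg_inv; (now left) || now right. Qed.

Lemma eqpm_pow (A B : Mat2) (k : nat) : eqpm A B -> eqpm (mpow A k) (mpow B k).
Proof.
intros E; induction k as [|k IH]; simpl; [now left | now apply eqpm_mul].
Qed.

(** * Trace, norm and diagonal form *)

Definition mtr (A : Mat2) : R := m11 A + m22 A.

Lemma mtr_conj (A B : Mat2) : mdet A = 1 -> mtr (A ** B ** minv A) = mtr B.
Proof.
unfold mdet, mtr; simpl; intros H.
transitivity ((m11 A * m22 A - m12 A * m21 A) * (m11 B + m22 B)); [ring|].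
rewrite H; ring.
Qed.

Lemma mtr_conjV (A B : Mat2) : mdet A = 1 -> mtr (minv A ** B ** A) = mtr B.
Proof.
intros H; rewrite <- (minvK A) at 2; apply mtr_conj; now rewrite mdet_inv.
Qed.

Definition nrm (A : Mat2) : R := m11 A ^ 2 + m12 A ^ 2 + m21 A ^ 2 + m22 A ^ 2.

Lemma nrm_ge0 (A : Mat2) : 0 <= nrm A.
Proof. unfold nrm; nra. Qed.

Lemma nrm_inv (A : Mat2) : nrm (minv A) = nrm A.
Proof. unfold nrm; simpl; ring. Qed.

Lemma nrm_mul (A B : Mat2) : nrm (A ** B) <= nrm A * nrm B.
Proof.
assert (CS : forall a b c d, (a * c + b * d) ^ 2 <= (a ^ 2 + b ^ 2) * (c ^ 2 + d ^ 2)).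
{ intros; pose proof (pow2_ge_0 (a * d - b * c)); lra. }
destruct A as [a b c d], B as [e f g h]; unfold nrm; simpl m11; simpl m12; simpl m21; simpl m22.
pose proof (CS a b e g); pose proof (CS a b f h).
pose proof (CS c d e g); pose proof (CS c d f h).
nra.
Qed.

Lemma nrm_sub2 (A : Mat2) :
  mdet A = 1 -> nrm A = 2 + (m11 A - m22 A) ^ 2 + (m12 A + m21 A) ^ 2.
Proof. unfold mdet, nrm; intros; nra. Qed.

(** As a Moebius map this is z -> l^2 z, the translation along the geodesic (0, oo). Negative [l]
    occur because the sign of a matrix is kept. *)
Definition dg (l : R) : Mat2 := mk2 l 0 0 (/ l).

Lemma dg_mul (l k : R) : dg l ** dg k = dg (l * k).
Proof. mat. rewrite Rinv_mult; ring. Qed.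

Lemma dg_inv (l : R) : minv (dg l) = dg (/ l).
Proof. mat. now rewrite Rinv_inv. Qed.

Lemma dg_opp (l : R) : dg (- l) = mneg (dg l).
Proof. mat. now rewrite Rinv_opp. Qed.

Lemma dg_pow (l : R) (k : nat) : mpow (dg l) k = dg (l ^ k).
Proof.
induction k as [|k IH]; simpl; [|now rewrite IH, dg_mul].
unfold dg; now rewrite Rinv_1.
Qed.

Lemma mpow_conj (V A : Mat2) (k : nat) :
  mdet V = 1 -> mpow (V ** A ** minv V) k = V ** mpow A k ** minv V.
Proof.
intros HV; induction k as [|k IH]; simpl; [now rewrite mmul1r, mmulVr|].
rewrite IH, !mmulA; now rewrite mmulVK.
Qed.

(** The eigenvalue of larger modulus comes first, so the first column of [V] is the attracting end
    of the axis of [g] and the second column the repelling end. *)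
Lemma diagonalize (g : Mat2) :
  mdet g = 1 -> mtr g ^ 2 > 4 ->
  exists V l, mdet V = 1 /\ l ^ 2 > 1 /\ g = V ** dg l ** minv V.
Proof.
intros Hd Ht.
assert (exists l, l ^ 2 > 1 /\ l + / l = mtr g) as [l [Hl El]].
{ set (d := sqrt (mtr g ^ 2 - 4)).
  assert (Hdd : d * d = mtr g ^ 2 - 4) by (apply sqrt_sqrt; lra).
  assert (Hd0 : 0 <= d) by apply sqrt_pos.
  assert (0 < d) by nra.
  (* Of the two roots of the characteristic polynomial, the one with the sign of the trace has the
     larger modulus. *)
  destruct (Rlt_le_dec 0 (mtr g)) as [Hp|Hn].
  - exists ((mtr g + d) / 2); split; [nra|].
    assert (mtr g + d <> 0) by lra.
    field_simplify_eq; nra.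
  - exists ((mtr g - d) / 2); split; [nra|].
    assert (mtr g - d <> 0) by nra.
    field_simplify_eq; nra. }
assert (l <> 0) by nra.
assert (Hk : l - / l <> 0).
{ intros E; assert (l * (l - / l) = l ^ 2 - 1) by (field; auto). rewrite E in *; nra. }
destruct g as [p q r s]; unfold mdet, mtr in *; simpl in *.
destruct (Req_dec r 0) as [Hr|Hr].
- subst r.
  assert (Hps : p * s = 1) by lra.
  assert (Hlp : (l - p) * (l - s) = 0).
  { replace ((l - p) * (l - s)) with (l * l - l * (p + s) + p * s) by ring.
    rewrite <- El, Hps; field; auto. }
  assert (Hs : s - p <> 0).
  { intros E. assert (s = p) by lra. subst s. nra. }
  apply Rmult_integral in Hlp as [E|E].
  + assert (p = l) by lra. subst p. assert (s = / l) by lra. subst s.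
    exists (mk2 1 (q / (/ l - l)) 0 1), l; split; [|split; [lra|]].
    * unfold mdet; simpl; ring.
    * apply mat_eq; simpl; try ring. field. split; auto. nra.
  + assert (s = l) by lra. subst s. assert (p = / l) by lra. subst p.
    exists (mk2 (q / (l - / l)) (- 1) 1 0), l; split; [|split; [lra|]].
    * unfold mdet; simpl; ring.
    * apply mat_eq; simpl; try ring. field. split; auto. nra.
- set (k := r * (l - / l)).
  assert (k <> 0) by (unfold k; apply Rmult_integral_contrapositive; auto).
  exists (mk2 (l - s) ((/ l - s) / k) r (r / k)), l; split; [|split; [lra|]].
  + unfold mdet; simpl; unfold k; field; repeat split; auto. nra.
  + assert (p = l + / l - s) by lra. subst p.
    assert (q = ((l + / l - s) * s - 1) / r) by
      (replace ((l + / l - s) * s - 1) with (q * r) by lra; field; auto).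
    subst q. apply mat_eq; simpl; unfold k; field; repeat split; auto; nra.
Qed.

Lemma conj_eqpm_I (A g : Mat2) :
  mdet A = 1 -> eqpm (minv A ** g ** A) mI -> eqpm g mI.
Proof.
intros HA E.
assert (E2 : g = A ** (minv A ** g ** A) ** minv A).
{ rewrite !mmulA, mmulVr, mmul1l, mmulKV; auto. }
rewrite E2; destruct E as [->| ->].
- left; rewrite mmul1r; now apply mmulVr.
- right; rewrite mneg_mulr, mneg_mull, mmul1r; now rewrite mmulVr.
Qed.

(** * Trace gap *)

Section Group.
Context (G : Mat2 -> Prop) (HG : surface_group G).

Lemma sg_det A : G A -> mdet A = 1.
Proof. apply HG. Qed.

Lemma sg_1 : G mI.
Proof. apply HG. Qed.

Lemma sg_mul A B : G A -> G B -> G (A ** B).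
Proof. apply HG. Qed.

Lemma sg_inv A : G A -> G (minv A).
Proof. apply HG. Qed.

Lemma sg_neg A : G A -> G (mneg A).
Proof.
intros H; replace (mneg A) with (mneg mI ** A) by mat.
apply sg_mul; [apply HG | exact H].
Qed.

Lemma sg_pow A k : G A -> G (mpow A k).
Proof. intros H; induction k; simpl; [apply sg_1 | now apply sg_mul]. Qed.

Lemma sg_conj A B : G A -> G B -> G (minv A ** B ** A).
Proof. auto using sg_mul, sg_inv. Qed.

Lemma sg_discrete K :
  exists L : list Mat2, forall A, G A -> nrm A <= K -> In A L.
Proof. apply HG. Qed.

Lemma sg_torsion A k : G A -> (k >= 1)%nat -> eqpm (mpow A k) mI -> eqpm A mI.
Proof. apply HG. Qed.

(* [nrm] is twice the cosh of the displacement of the base point [i]. *)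
Lemma sg_cocompact :
  exists K, 2 <= K /\ forall M, mdet M = 1 -> exists A, G A /\ nrm (minv A ** M) <= K.
Proof.
destruct HG as (_ & _ & _ & _ & _ & _ & _ & K & HK).
exists (Rmax 2 (K + 2)); split; [apply Rmax_l|].
intros M HM.
set (n := m21 M ^ 2 + m22 M ^ 2).
assert (Hn : 0 < n).
{ unfold n; unfold mdet in HM.
  destruct (Req_dec (m21 M) 0) as [E|E]; [|nra].
  destruct (Req_dec (m22 M) 0) as [E'|E']; [|nra].
  rewrite E, E' in HM; lra. }
destruct (HK ((m11 M * m21 M + m12 M * m22 M) / n) (1 / n)) as (A & GA & HA).
{ apply Rdiv_lt_0_compat; lra. }
exists A; split; auto.
apply Rle_trans with (K + 2); [|apply Rmax_r].
pose proof (sg_det A GA) as HA1.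
set (na := m21 A ^ 2 + m22 A ^ 2) in *.
assert (Hna : 0 < na).
{ unfold na; unfold mdet in HA1.
  destruct (Req_dec (m21 A) 0) as [E|E]; [|nra].
  destruct (Req_dec (m22 A) 0) as [E'|E']; [|nra].
  rewrite E, E' in HA1; lra. }
simpl in HA.
match type of HA with ?e <= K => replace (nrm (minv A ** M)) with (e + 2); [lra|] end.
symmetry.
set (um := m11 M * m21 M + m12 M * m22 M).
set (ua := m11 A * m21 A + m12 A * m22 A).
set (pm := m11 M ^ 2 + m12 M ^ 2).
set (pa := m11 A ^ 2 + m12 A ^ 2).
assert (E1 : pm * n = 1 + um ^ 2).
{ unfold pm, n, um; unfold mdet in HM.
  transitivity ((m11 M * m22 M - m12 M * m21 M) ^ 2 + (m11 M * m21 M + m12 M * m22 M) ^ 2);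
   [ring | rewrite HM; ring]. }
assert (E2 : pa * na = 1 + ua ^ 2).
{ unfold pa, na, ua; unfold mdet in HA1.
  transitivity ((m11 A * m22 A - m12 A * m21 A) ^ 2 + (m11 A * m21 A + m12 A * m22 A) ^ 2);
   [ring | rewrite HA1; ring]. }
transitivity (pm * na + pa * n - 2 * um * ua).
{ unfold nrm, pm, na, pa, n, um, ua; simpl; ring. }
replace pm with ((1 + um ^ 2) / n) by (rewrite <- E1; field; lra).
replace pa with ((1 + ua ^ 2) / na) by (rewrite <- E2; field; lra).
field; lra.
Qed.

(** The squared norm of the traceless part [tlm]. It measures the distance to +-I and, being a
    quadratic form in a part on which conjugation acts linearly, changes under conjugation by a
    bounded factor only. *)
Definition tlf (A : Mat2) : R := (m11 A - m22 A) ^ 2 / 2 + m12 A ^ 2 + m21 A ^ 2.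

Lemma tlf_ge0 A : 0 <= tlf A.
Proof.
unfold tlf; pose proof (pow2_ge_0 (m11 A - m22 A)).
pose proof (pow2_ge_0 (m12 A)); pose proof (pow2_ge_0 (m21 A)); lra.
Qed.

Lemma tlf_0 A : mdet A = 1 -> tlf A = 0 -> eqpm A mI.
Proof.
destruct A as [p q r s]; unfold mdet, tlf; simpl m11; simpl m12; simpl m21; simpl m22.
intros Hd H.
pose proof (pow2_ge_0 (p - s)); pose proof (pow2_ge_0 q); pose proof (pow2_ge_0 r).
assert (q = 0) by nra. assert (r = 0) by nra.
assert (p - s = 0) by nra. assert (s = p) by lra. subst.
assert ((p - 1) * (p + 1) = 0) by lra.
apply Rmult_integral in H3 as [E|E]; [left | right]; apply mat_eq; simpl; lra.
Qed.

Definition tlm (A : Mat2) : Mat2 :=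
  mk2 ((m11 A - m22 A) / 2) (m12 A) (m21 A) ((m22 A - m11 A) / 2).

Lemma nrm_tlm A : nrm (tlm A) = tlf A.
Proof. unfold nrm, tlf; simpl; field. Qed.

Lemma tlm_conj B X : mdet B = 1 -> tlm (B ** X ** minv B) = B ** tlm X ** minv B.
Proof.
unfold mdet; intros H.
apply mat_eq; simpl; field.
Qed.

Lemma tlf_conj B X : mdet B = 1 -> tlf (B ** X ** minv B) <= nrm B ^ 2 * tlf X.
Proof.
intros H; rewrite <- !nrm_tlm, tlm_conj by auto.
pose proof (nrm_mul (B ** tlm X) (minv B)) as H1; rewrite nrm_inv in H1.
pose proof (nrm_mul B (tlm X)) as H2.
pose proof (nrm_ge0 B); pose proof (nrm_ge0 (tlm X)).
apply Rle_trans with (1 := H1).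
replace (nrm B ^ 2 * nrm (tlm X)) with (nrm B * nrm (tlm X) * nrm B) by ring.
now apply Rmult_le_compat_r.
Qed.

Lemma list_pos_min (F : Mat2 -> R) (L : list Mat2) :
  exists mu, 0 < mu /\ forall A, In A L -> 0 < F A -> mu <= F A.
Proof.
induction L as [|B L (mu & Hmu & IH)]; [exists 1; split; [lra | intros A []]|].
destruct (Rlt_le_dec 0 (F B)) as [HB|HB].
- exists (Rmin mu (F B)); split; [now apply Rmin_glb_lt|].
  intros A [->|HA] H; [apply Rmin_r|].
  apply Rle_trans with mu; [apply Rmin_l | auto].
- exists mu; split; auto. intros A [->|HA] H; [lra | auto].
Qed.

(* Cocompactness moves the point into a compact set, where discreteness leaves
   finitely many elements. *)
Lemma displacement_gap :
  exists eta, 0 < eta /\ eta <= 1 /\ forall g M, G g -> ~ eqpm g mI -> mtr g ^ 2 >= 4 ->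
    mdet M = 1 -> nrm (minv M ** g ** M) >= 2 + eta.
Proof.
destruct sg_cocompact as (K & HK2 & HK).
(* Only displacements with [nrm] at most 3 matter, since eta <= 1; after conjugation by [B], of norm
   at most [K], they come from group elements of norm at most 3 K^2. *)
destruct (sg_discrete (3 * K ^ 2)) as (L & HL).
destruct (list_pos_min tlf L) as (mu & Hmu & Hmin).
assert (HKK : 0 < K ^ 2) by nra.
assert (Hq : 0 < mu / K ^ 2) by now apply Rdiv_lt_0_compat.
exists (Rmin 1 (mu / K ^ 2)).
split; [apply Rmin_glb_lt; lra|]; split; [apply Rmin_l|].
intros g M Gg Hg Ht HM.
destruct (HK M HM) as (A & GA & HA).
pose proof (sg_det A GA) as HA1. pose proof (sg_det g Gg) as Hg1.
set (B := minv A ** M) in *.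
assert (HB : mdet B = 1) by (apply mdet_mul1; [now rewrite mdet_inv | auto]).
set (g' := minv A ** g ** A).
assert (Gg' : G g') by now apply sg_conj.
set (X := minv M ** g ** M).
assert (EX : B ** X ** minv B = g').
{ unfold B, X, g'. rewrite minv_mul, minvK, !mmulA.
  rewrite <- (mmulA (minv A) M (minv M)), mmulVr, mmul1r by auto.
  rewrite <- (mmulA _ M (minv M)), mmulVr, mmul1r by auto. reflexivity. }
assert (HX1 : mdet X = 1).
{ unfold X; apply mdet_mul1; auto. apply mdet_mul1; auto. now rewrite mdet_inv. }
assert (HtX : mtr X = mtr g) by now apply mtr_conjV.
destruct (Rle_lt_dec (nrm X) 3) as [HX3|HX3];
 [|pose proof (Rmin_l 1 (mu / K ^ 2)); lra].
assert (HBK : nrm B ^ 2 <= K ^ 2).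
{ pose proof (nrm_ge0 B). nra. }
assert (Hin : In g' L).
{ apply HL; auto. rewrite <- EX.
  pose proof (nrm_mul (B ** X) (minv B)) as H1; rewrite nrm_inv in H1.
  pose proof (nrm_mul B X) as H2.
  pose proof (nrm_ge0 B); pose proof (nrm_ge0 X).
  apply Rle_trans with (1 := H1).
  apply Rle_trans with (nrm B * nrm X * nrm B); [now apply Rmult_le_compat_r|].
  replace (nrm B * nrm X * nrm B) with (nrm X * nrm B ^ 2) by ring.
  apply Rmult_le_compat; try lra. apply pow2_ge_0. }
assert (Htg : 0 < tlf g').
{ destruct (Rle_lt_or_eq_dec 0 (tlf g') (tlf_ge0 g')) as [H|H]; auto.
  exfalso; apply Hg. apply (conj_eqpm_I A); auto.
  apply tlf_0; [|now symmetry in H]. now apply sg_det. }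
pose proof (Hmin g' Hin Htg) as Hm.
pose proof (tlf_conj B X HB) as Hc; rewrite EX in Hc.
(* [nrm] is [tlf] plus half the squared trace, and the squared trace is at least 4. *)
assert (HtX0 : tlf X <= nrm X - 2).
{ rewrite <- HtX in Ht. unfold mtr, nrm, tlf in *; lra. }
assert (mu / K ^ 2 <= nrm X - 2).
{ apply Rle_trans with (tlf X); auto.
  apply Rmult_le_reg_l with (K ^ 2); auto.
  replace (K ^ 2 * (mu / K ^ 2)) with mu by (field; lra).
  apply Rle_trans with (1 := Hm), Rle_trans with (1 := Hc).
  apply Rmult_le_compat_r; auto. apply tlf_ge0. }
pose proof (Rmin_r 1 (mu / K ^ 2)); lra.
Qed.

(** A parabolic moves points close to its fixed point by arbitrarily little, against
    [displacement_gap]. The test point is very high if the fixed point is oo, and very low above it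
    otherwise. *)
Lemma no_parabolic g : G g -> mtr g ^ 2 = 4 -> eqpm g mI.
Proof.
intros Gg Ht. destruct (classic (eqpm g mI)) as [|Hg]; auto. exfalso.
destruct displacement_gap as (eta & He & He1 & H).
assert (Hw : forall M, mdet M = 1 -> nrm (minv M ** g ** M) >= 2 + eta)
  by (intros; apply H; auto; lra).
pose proof (sg_det g Gg) as Hd.
destruct g as [p q r s]; unfold mdet, mtr in *; simpl in Ht, Hd.
destruct (Req_dec r 0) as [Hr|Hr].
- subst r. assert (H0 : p - s = 0) by (apply Rsqr_0_uniq; unfold Rsqr; lra).
  assert (s = p) by lra. subst s. clear H0.
  set (y := (1 + q ^ 2) / eta).
  assert (Hy : 0 < y) by (apply Rdiv_lt_0_compat; [pose proof (pow2_ge_0 q); lra | auto]).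
  assert (Hq : q ^ 2 < eta * y).
  { unfold y. replace (eta * ((1 + q ^ 2) / eta)) with (1 + q ^ 2) by (field; lra). lra. }
  set (w := sqrt (1 + y)).
  assert (Hww : w * w = 1 + y) by (apply sqrt_sqrt; lra).
  assert (Hw0 : 0 < w) by (apply sqrt_lt_R0; lra).
  specialize (Hw (mk2 w 0 0 (/ w))).
  unfold mdet, nrm in Hw; simpl in Hw.
  assert (H0 : w * / w = 1) by (field; lra).
  set (v := / w) in *.
  assert (Hv : v * v * (1 + y) = 1) by nra.
  assert (q ^ 2 * (v * v * (v * v)) < eta).
  { assert (Hv0 : 0 < v) by (apply Rinv_0_lt_compat; auto).
    assert (Hv2 : 0 < v * v) by now apply Rmult_lt_0_compat.
    set (t := v * v) in *. assert (t < 1) by nra. assert (y * t < 1) by nra.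
    apply Rlt_le_trans with (eta * y * (t * t)).
    - apply Rmult_lt_compat_r; nra.
    - replace (eta * y * (t * t)) with (eta * ((y * t) * t)) by ring.
      assert (0 < y * t) by now apply Rmult_lt_0_compat.
      assert ((y * t) * t < 1) by nra. nra. }
  assert (E : (v * p + - 0 * 0) * w + (v * q + - 0 * p) * 0 = p)
    by (transitivity (p * (w * v)); [ring | rewrite H0; ring]).
  assert (E' : (- 0 * p + w * 0) * 0 + (- 0 * q + w * p) * v = p)
    by (transitivity (p * (w * v)); [ring | rewrite H0; ring]).
  assert (E2 : (v * p + - 0 * 0) * 0 + (v * q + - 0 * p) * v = q * (v * v)) by ring.
  assert (E3 : (- 0 * p + w * 0) * w + (- 0 * q + w * p) * 0 = 0) by ring.
  rewrite E, E', E2, E3 in Hw.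
  specialize (Hw ltac:(lra)). nra.
- set (x0 := (p - s) / (2 * r)).
  assert (Hx : 2 * r * x0 = p - s) by (unfold x0; field; auto).
  clearbody x0.
  assert (Hrp : 0 < r ^ 2) by nra.
  set (y := Rmin 1 (eta / (1 + r ^ 2))).
  assert (Hq0 : 0 < eta / (1 + r ^ 2)) by (apply Rdiv_lt_0_compat; lra).
  assert (Hy : 0 < y) by (apply Rmin_glb_lt; lra).
  assert (Hy1 : y <= 1) by apply Rmin_l.
  assert (Hy2 : y * (1 + r ^ 2) <= eta).
  { apply Rle_trans with (eta / (1 + r ^ 2) * (1 + r ^ 2)).
    - apply Rmult_le_compat_r; [lra | apply Rmin_r].
    - right; field; lra. }
  set (w := sqrt y).
  assert (Hww : w * w = y) by (apply sqrt_sqrt; lra).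
  assert (Hw0 : 0 < w) by (apply sqrt_lt_R0; lra).
  specialize (Hw (mk2 w (x0 / w) 0 (/ w))).
  assert (Hone : mdet (mk2 w (x0 / w) 0 (/ w)) = 1) by (unfold mdet; simpl; field; lra).
  specialize (Hw Hone).
  assert (Hq : q = - r * x0 ^ 2).
  { apply Rmult_eq_reg_l with (4 * r); [|lra].
    transitivity (- (2 * r * x0) ^ 2); [|ring]. rewrite Hx. nra. }
  assert (Hps : p - r * x0 = r * x0 + s) by lra.
  assert (Hm : (p - r * x0) ^ 2 = 1).
  { assert (p + s = 2 * (p - r * x0)) by lra. rewrite H0 in Ht. nra. }
  assert (EX : minv (mk2 w (x0 / w) 0 (/ w)) ** mk2 p q r s ** mk2 w (x0 / w) 0 (/ w) =
     mk2 (p - r * x0) 0 (r * y) (r * x0 + s)).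
  { rewrite <- Hww; apply mat_eq; simpl; try (field; lra).
    rewrite Hq. assert (s = p - 2 * r * x0) by lra. subst s. field; lra. }
  rewrite EX in Hw; unfold nrm in Hw; simpl m11 in Hw; simpl m12 in Hw;
  simpl m21 in Hw; simpl m22 in Hw.
  rewrite <- Hps, Hm in Hw. assert ((r * y) ^ 2 < eta) by nra. lra.
Qed.

(** By [nrm_sub2] such a matrix is a rotation, that is, it fixes i. *)
Lemma rot_pow X k : mdet X = 1 -> nrm X = 2 -> nrm (mpow X k) = 2.
Proof.
intros Hd Hn.
pose proof (nrm_sub2 X Hd) as Hs; rewrite Hn in Hs.
pose proof (pow2_ge_0 (m11 X - m22 X)); pose proof (pow2_ge_0 (m12 X + m21 X)).
assert (E1 : m22 X = m11 X) by nra. assert (E2 : m21 X = - m12 X) by nra.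
induction k as [|k IH]; [unfold nrm; simpl; ring|].
simpl mpow. unfold mdet in Hd; rewrite E1, E2 in Hd.
transitivity ((m11 X * m11 X - m12 X * - m12 X) * nrm (mpow X k)).
- unfold nrm; simpl; rewrite E1, E2; ring.
- rewrite IH, Hd; ring.
Qed.

Lemma pigeonhole {T} (F : nat -> T) (L : list T) :
  (forall k, In (F k) L) -> exists i j, (i < j)%nat /\ F i = F j.
Proof.
intros H. apply NNPP; intros Hn.
assert (Hnd : forall n, NoDup (map F (seq 0 n))).
{ intros n. apply NoDup_map_NoDup_ForallPairs; [|apply seq_NoDup].
  intros i j _ _ E. destruct (Nat.lt_trichotomy i j) as [|[]]; auto.
  - exfalso; apply Hn; eauto.
  - exfalso; apply Hn; exists j, i; auto. }
pose proof (@NoDup_incl_length _ _ L (Hnd (S (length L)))) as Hl.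
rewrite length_map, length_seq in Hl. assert (S (length L) <= length L)%nat; [|lia].
apply Hl. intros x Hx. apply in_map_iff in Hx as (k & <- & _). apply H.
Qed.

(** An elliptic element fixes a point [M] i, so its powers have bounded norm. By discreteness two of
    them agree, and torsion-freeness leaves only +-I, whose squared trace is 4. *)
Lemma no_elliptic g : G g -> mtr g ^ 2 >= 4.
Proof.
intros Gg. apply Rnot_lt_ge; intros Ht.
pose proof (sg_det g Gg) as Hd.
assert (HM : exists M, mdet M = 1 /\ nrm (minv M ** g ** M) = 2).
{ destruct g as [p q r s]; unfold mdet, mtr in *; simpl in Ht, Hd.
  assert (Hr : r <> 0) by (intros ->; pose proof (pow2_ge_0 (p - s)); lra).
  set (D := 4 - (p + s) ^ 2).
  set (y := sqrt D / (2 * Rabs r)).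
  assert (HD : 0 < D) by (unfold D; lra).
  assert (Hra : 0 < Rabs r) by now apply Rabs_pos_lt.
  assert (Hy : 0 < y) by (apply Rdiv_lt_0_compat; [now apply sqrt_lt_R0 | lra]).
  assert (Hy2 : 4 * r ^ 2 * y ^ 2 = D).
  { unfold y. rewrite <- (pow2_abs r).
    transitivity (sqrt D * sqrt D); [field; lra | apply sqrt_sqrt; lra]. }
  set (w := sqrt y).
  assert (Hww : w * w = y) by (apply sqrt_sqrt; lra).
  assert (Hw0 : 0 < w) by (apply sqrt_lt_R0; lra).
  set (x0 := (p - s) / (2 * r)).
  assert (Hx : 2 * r * x0 = p - s) by (unfold x0; field; auto).
  clearbody x0.
  exists (mk2 w (x0 / w) 0 (/ w)).
  split; [unfold mdet; simpl; field; lra|].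
  set (c := (p + s) / 2).
  assert (Hq : q = - r * (x0 ^ 2 + y ^ 2)).
  { apply Rmult_eq_reg_l with (4 * r); [|lra].
    transitivity (- (2 * r * x0) ^ 2 - 4 * r ^ 2 * y ^ 2); [|ring].
    rewrite Hx, Hy2; unfold D; nra. }
  assert (EX : minv (mk2 w (x0 / w) 0 (/ w)) ** mk2 p q r s ** mk2 w (x0 / w) 0 (/ w) =
     mk2 c (- r * y) (r * y) c).
  { assert (Es : s = c - r * x0) by (unfold c; lra).
    assert (Ep : p = c + r * x0) by (unfold c; lra).
    apply mat_eq; simpl; rewrite ?Es, ?Ep, ?Hq, <- ?Hww; field; lra. }
  rewrite EX. unfold nrm; simpl m11; simpl m12; simpl m21; simpl m22.
  replace (c ^ 2 + (- r * y) ^ 2 + (r * y) ^ 2 + c ^ 2) with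
    (2 * c ^ 2 + (4 * r ^ 2 * y ^ 2) / 2) by field.
  rewrite Hy2; unfold c, D; field. }
destruct HM as (M & HM & HX).
set (X := minv M ** g ** M) in *.
assert (HX1 : mdet X = 1).
{ unfold X; apply mdet_mul1; auto. apply mdet_mul1; auto. now rewrite mdet_inv. }
assert (Eg : g = M ** X ** minv M).
{ unfold X. rewrite !mmulA, mmulVr, mmul1l, mmulKV; auto. }
destruct (sg_discrete (nrm M * 2 * nrm M)) as (L & HL).
assert (Hin : forall k, In (mpow g k) L).
{ intros k; apply HL; [now apply sg_pow|].
  rewrite Eg, mpow_conj by auto.
  pose proof (nrm_mul (M ** mpow X k) (minv M)) as H1; rewrite nrm_inv in H1.
  pose proof (nrm_mul M (mpow X k)) as H2. rewrite rot_pow in H2 by auto.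
  pose proof (nrm_ge0 M). nra. }
destruct (pigeonhole (mpow g) L Hin) as (i & j & Hij & E).
assert (Ej : mpow g (j - i) = mI).
{ apply (mulIl (mpow g i)); [now apply mdet_pow|].
  rewrite <- mpow_add, mmul1r, E. f_equal; lia. }
assert (eqpm g mI) as [->| ->].
{ apply sg_torsion with (j - i)%nat; [auto | lia | left; auto]. }
- unfold mtr in Ht; simpl in Ht; lra.
- unfold mtr in Ht; simpl in Ht; lra.
Qed.

(** At a point of the axis of [g] the squared displacement norm is the squared trace minus 2, so
    [displacement_gap] there is a bound on the trace: a positive lower bound for the lengths of
    closed geodesics. *)
Lemma trace_gap :
  exists e, 0 < e /\ e <= 1 /\ forall g, G g -> ~ eqpm g mI -> mtr g ^ 2 >= 4 + e.
Proof.
destruct displacement_gap as (eta & He & He1 & H).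
exists eta; repeat split; auto. intros g Gg Hg.
pose proof (no_elliptic g Gg) as Ht.
destruct (Req_dec (mtr g ^ 2) 4) as [E|E].
{ exfalso; apply Hg; now apply no_parabolic. }
destruct (diagonalize g) as (V & l & HV & Hl & Eg); [now apply sg_det | lra |].
specialize (H g V Gg Hg Ht HV).
assert (l <> 0) by nra.
rewrite Eg, !mmulA, mmulVl, mmul1l, mmulVK in H by auto.
rewrite Eg, mtr_conj by auto.
unfold mtr, nrm in *; simpl in *.
assert (l * / l = 1) by (field; auto). nra.
Qed.

End Group.

(* A point of H^2 is a positive definite form up to scaling, [M i] being [M M^T]; then
   [fx / fz] is |z|^2 and [fpair] is twice cosh of the distance for determinant one. *)
Record Frm := fr { fx : R; fy : R; fz : R }.

(** * Strips in the hyperbolic plane *)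

Lemma sq_pos (x : R) : x <> 0 -> 0 < x ^ 2.
Proof. intros H; rewrite <- Rsqr_pow2; now apply Rsqr_pos_lt. Qed.

(** The congruence X -> A X A^T of the symmetric matrix with entries [fx], [fy], [fz]. *)
Definition act (A : Mat2) (X : Frm) : Frm :=
  fr (m11 A ^ 2 * fx X + 2 * m11 A * m12 A * fy X + m12 A ^ 2 * fz X)
     (m11 A * m21 A * fx X + (m11 A * m22 A + m12 A * m21 A) * fy X
      + m12 A * m22 A * fz X)
     (m21 A ^ 2 * fx X + 2 * m21 A * m22 A * fy X + m22 A ^ 2 * fz X).

Definition fpos (X : Frm) : Prop :=
  0 < fx X /\ 0 < fz X /\ fy X ^ 2 < fx X * fz X.

Definition fdet (X : Frm) : R := fx X * fz X - fy X ^ 2.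

Definition fpair (X Y : Frm) : R := fx X * fz Y + fz X * fx Y - 2 * fy X * fy Y.

Definition fbase : Frm := fr 1 0 1.

Lemma frm_eq (X Y : Frm) : fx X = fx Y -> fy X = fy Y -> fz X = fz Y -> X = Y.
Proof. destruct X, Y; simpl; intros; subst; reflexivity. Qed.

Lemma act_mul (A B : Mat2) (X : Frm) : act (A ** B) X = act A (act B X).
Proof. apply frm_eq; simpl; ring. Qed.

Lemma act_I (X : Frm) : act mI X = X.
Proof. apply frm_eq; simpl; ring. Qed.

Lemma act_neg (A : Mat2) (X : Frm) : act (mneg A) X = act A X.
Proof. apply frm_eq; simpl; ring. Qed.

Lemma act_eqpm (A B : Mat2) (X : Frm) : eqpm A B -> act A X = act B X.
Proof. intros [->| ->]; auto using act_neg. Qed.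

Lemma act_V (A : Mat2) (X : Frm) : mdet A = 1 -> act (minv A) (act A X) = X.
Proof. intros H; rewrite <- act_mul, mmulVl, act_I; auto. Qed.

Lemma act_KV (A : Mat2) (X : Frm) : mdet A = 1 -> act A (act (minv A) X) = X.
Proof. intros H; rewrite <- act_mul, mmulVr, act_I; auto. Qed.

Lemma fdet_act (A : Mat2) (X : Frm) : mdet A = 1 -> fdet (act A X) = fdet X.
Proof.
unfold mdet, fdet; simpl; intros H.
transitivity ((m11 A * m22 A - m12 A * m21 A) ^ 2 * (fx X * fz X - fy X ^ 2)); [ring|].
rewrite H; ring.
Qed.

Lemma fpair_act (A : Mat2) (X Y : Frm) :
  mdet A = 1 -> fpair (act A X) (act A Y) = fpair X Y.
Proof.
unfold mdet, fpair; simpl; intros H.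
transitivity ((m11 A * m22 A - m12 A * m21 A) ^ 2 *
  (fx X * fz Y + fz X * fx Y - 2 * fy X * fy Y)); [ring|].
rewrite H; ring.
Qed.

Lemma fpos_base : fpos fbase.
Proof. unfold fpos; simpl; lra. Qed.

Lemma fpos_quad (X : Frm) (u v : R) : fpos X -> u <> 0 \/ v <> 0 ->
  0 < u ^ 2 * fx X + 2 * u * v * fy X + v ^ 2 * fz X.
Proof.
intros (H1 & H2 & H3) H.
apply Rmult_lt_reg_l with (fx X); auto. rewrite Rmult_0_r.
replace (fx X * (u ^ 2 * fx X + 2 * u * v * fy X + v ^ 2 * fz X)) with
  ((u * fx X + v * fy X) ^ 2 + v ^ 2 * (fx X * fz X - fy X ^ 2)) by ring.
pose proof (pow2_ge_0 (u * fx X + v * fy X)).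
destruct (Req_dec v 0) as [->|Hv].
- destruct H as [H|]; [|lra].
  assert (0 < (u * fx X) ^ 2).
  { apply sq_pos. apply Rmult_integral_contrapositive; split; lra. }
  replace ((u * fx X + 0 * fy X) ^ 2) with ((u * fx X) ^ 2) by ring. lra.
- pose proof (sq_pos v Hv).
  assert (0 < v ^ 2 * (fx X * fz X - fy X ^ 2)) by (apply Rmult_lt_0_compat; lra).
  lra.
Qed.

Lemma fpos_act (A : Mat2) (X : Frm) : mdet A = 1 -> fpos X -> fpos (act A X).
Proof.
intros HA HX. split; [|split].
- simpl; apply fpos_quad; auto. unfold mdet in HA.
  destruct (Req_dec (m11 A) 0) as [E|]; auto. right; intros E'.
  rewrite E, E' in HA; lra.
- simpl; apply fpos_quad; auto. unfold mdet in HA.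
  destruct (Req_dec (m21 A) 0) as [E|]; auto. right; intros E'.
  rewrite E, E' in HA; lra.
- pose proof (fdet_act A X HA) as E; unfold fdet in E. destruct HX as (_ & _ & HX). lra.
Qed.

(* The gate [H] is the pair of geodesics |H z| = 1 and |H z| = T. *)
Definition lo (H : Mat2) (X : Frm) : Prop := fx (act H X) < fz (act H X).
Definition hi (T : R) (H : Mat2) (X : Frm) : Prop :=
  fx (act H X) > T ^ 2 * fz (act H X).

(** The strips are disjoint and are met in this order. Phrasing this by half-planes keeps paths out
    of the development. *)
Definition prec (T : R) (H H' : Mat2) : Prop :=
  forall X, fpos X -> ~ hi T H X -> lo H' X.

(** Put a^2 = [fz X * fx Y] and b^2 = [fx X * fz Y]. Positivity of the forms gives [fpair X Y] >= (a
    - b)^2, and lying on opposite sides of the strip gives T b < a. *)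
Lemma pair_far (T : R) (X Y : Frm) : 1 < T -> fpos X -> fpos Y ->
  fx X < fz X -> fx Y > T ^ 2 * fz Y ->
  fz X * fx Y * (1 - / T) ^ 2 < fpair X Y.
Proof.
intros HT (X1 & X2 & X3) (Y1 & Y2 & Y3) HX HY.
unfold fpair.
set (a := sqrt (fz X * fx Y)). set (b := sqrt (fx X * fz Y)).
assert (Ha : a ^ 2 = fz X * fx Y).
{ unfold a; rewrite <- Rsqr_pow2; apply Rsqr_sqrt; nra. }
assert (Hb : b ^ 2 = fx X * fz Y).
{ unfold b; rewrite <- Rsqr_pow2; apply Rsqr_sqrt; nra. }
assert (Ha0 : 0 < a) by (apply sqrt_lt_R0; nra).
assert (Hb0 : 0 < b) by (apply sqrt_lt_R0; nra).
assert (Hy : fy X * fy Y <= a * b).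
{ apply Rsqr_incr_0_var; [|nra]. unfold Rsqr.
  replace (a * b * (a * b)) with (a ^ 2 * b ^ 2) by ring. rewrite Ha, Hb.
  replace (fy X * fy Y * (fy X * fy Y)) with (fy X ^ 2 * fy Y ^ 2) by ring.
  replace (fz X * fx Y * (fx X * fz Y)) with (fx X * fz X * (fx Y * fz Y)) by ring.
  apply Rmult_le_compat; try apply pow2_ge_0; lra. }
assert (HTb : T * b < a).
{ apply Rsqr_incrst_0; [|nra|lra]. rewrite !Rsqr_pow2.
  replace ((T * b) ^ 2) with (T ^ 2 * b ^ 2) by ring. rewrite Ha, Hb.
  replace (T ^ 2 * (fx X * fz Y)) with (fx X * (T ^ 2 * fz Y)) by ring.
  apply Rle_lt_trans with (fz X * (T ^ 2 * fz Y)).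
  - apply Rmult_le_compat_r; [|lra]. apply Rmult_le_pos; [apply pow2_ge_0 | lra].
  - apply Rmult_lt_compat_l; lra. }
assert (Hab : a * (1 - / T) < a - b).
{ assert (b < a * / T); [|lra].
  apply Rmult_lt_reg_l with T; [lra|]. replace (T * (a * / T)) with a by (field; lra). lra. }
assert (0 < a * (1 - / T)).
{ apply Rmult_lt_0_compat; auto. assert (/ T < 1); [|lra].
  rewrite <- Rinv_1; apply Rinv_lt_contravar; lra. }
apply Rlt_le_trans with ((a - b) ^ 2).
- rewrite <- Ha. replace (a ^ 2 * (1 - / T) ^ 2) with ((a * (1 - / T)) ^ 2) by ring.
  rewrite <- !Rsqr_pow2. apply Rsqr_incrst_1; lra.
- replace ((a - b) ^ 2) with (a ^ 2 + b ^ 2 - 2 * (a * b)) by ring. lra.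
Qed.

(* A segment crossing the strip passes close to the axis halfway through. *)
Lemma strip_middle (T : R) (X Y : Frm) : 10 <= T -> fpos X -> fpos Y ->
  fx X < fz X -> fx Y > T ^ 2 * fz Y ->
  exists c, 0 < c /\ fx X + c * fx Y = T * (fz X + c * fz Y) /\
    (fy X + c * fy Y) ^ 2 <= 4 * (fz X + c * fz Y) ^ 2.
Proof.
intros HT (X1 & X2 & X3) (Y1 & Y2 & Y3) HX HY.
(* The weight for which X + c Y lies on the middle geodesic |z|^2 = T of the strip. *)
exists ((T * fz X - fx X) / (fx Y - T * fz Y)).
set (c := _ / _).
assert (Hd : 0 < fx Y - T * fz Y) by nra.
assert (Hc : 0 < c) by (apply Rdiv_lt_0_compat; nra).
assert (Ec : fx X + c * fx Y = T * (fz X + c * fz Y)) by (unfold c; field; lra).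
clearbody c.
repeat split; auto.
set (s := fz X + c * fz Y) in *.
assert (Hs : fz X <= s) by (unfold s; nra).
assert (Hs2 : c * fx Y <= T * s) by lra.
assert (Ha : Rabs (fy X) <= s).
{ apply Rsqr_incr_0_var; [|lra]. rewrite <- Rsqr_abs, !Rsqr_pow2. nra. }
assert (Hb : Rabs (fy Y) <= fx Y * / T).
{ assert (0 < / T) by (apply Rinv_0_lt_compat; lra).
  apply Rsqr_incr_0_var; [|nra]. rewrite <- Rsqr_abs, !Rsqr_pow2.
  replace ((fx Y * / T) ^ 2) with (fx Y * (fx Y * (/ T) ^ 2)) by ring.
  apply Rle_trans with (fx Y * fz Y); [lra|].
  apply Rmult_le_compat_l; [lra|].
  apply Rmult_le_reg_l with (T ^ 2); [nra|].
  replace (T ^ 2 * (fx Y * (/ T) ^ 2)) with (fx Y) by (field; lra). lra. }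
assert (Habs : Rabs (fy X + c * fy Y) <= 2 * s).
{ apply Rle_trans with (1 := Rabs_triang _ _). rewrite Rabs_mult, (Rabs_right c) by lra.
  assert (c * Rabs (fy Y) <= s); [|lra].
  apply Rle_trans with (c * (fx Y * / T)); [apply Rmult_le_compat_l; lra|].
  apply Rmult_le_reg_l with T; [lra|].
  replace (T * (c * (fx Y * / T))) with (c * fx Y) by (field; lra). lra. }
rewrite <- (pow2_abs (fy X + c * fy Y)). pose proof (Rabs_pos (fy X + c * fy Y)).
replace (4 * s ^ 2) with ((2 * s) ^ 2) by ring.
apply pow_incr; lra.
Qed.

(** Up to scale these are the points of the hyperbolic segment from X to Y, as in the Klein model.
    Half-planes such as [lo] and [hi] are linear conditions on forms, hence preserved. *)
Definition fcomb (X : Frm) (c : R) (Y : Frm) : Frm :=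
  fr (fx X + c * fx Y) (fy X + c * fy Y) (fz X + c * fz Y).

Lemma act_comb (A : Mat2) (X Y : Frm) (c : R) :
  act A (fcomb X c Y) = fcomb (act A X) c (act A Y).
Proof. apply frm_eq; simpl; ring. Qed.

Lemma fpos_comb (X Y : Frm) (c : R) : fpos X -> fpos Y -> 0 < c -> fpos (fcomb X c Y).
Proof.
intros HX HY Hc; pose proof HX as (X1 & X2 & X3); pose proof HY as (Y1 & Y2 & Y3).
unfold fpos; simpl; split; [nra|split; [nra|]].
assert (0 < fpair X Y).
{ set (t := fy Y / fz Y).
  assert (Et : fy Y = t * fz Y) by (unfold t; field; lra).
  assert (Hx : fx Y > t ^ 2 * fz Y).
  { apply Rmult_lt_reg_l with (fz Y); auto. rewrite Et in Y3. nra. }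
  pose proof (fpos_quad X 1 (- t) HX (or_introl R1_neq_R0)) as Hq.
  unfold fpair; rewrite Et. nra. }
unfold fpair in *.
assert (0 < c * (fx X * fz Y + fz X * fx Y - 2 * fy X * fy Y)) by now apply Rmult_lt_0_compat.
assert (0 < c ^ 2 * (fx Y * fz Y - fy Y ^ 2)).
{ apply Rmult_lt_0_compat; [now apply pow_lt | lra]. }
lra.
Qed.

(* Two strips of width at least [ln T] cannot cross like the two strokes of a cross. *)
Lemma no_cross (T : R) (H H' : Mat2) (p q r x : Frm) :
  10 <= T -> mdet H = 1 -> mdet H' = 1 -> fpos p -> fpos q -> fpos r -> fpos x ->
  lo H p -> lo H' p -> hi T H q -> lo H' q -> hi T H r -> hi T H' r ->
  lo H x -> hi T H' x -> False.
Proof.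
unfold lo, hi; intros HT dH dH' Pp Pq Pr Px p1 p2 q1 q2 r1 r2 x1 x2.
destruct (strip_middle T (act H p) (act H q)) as (c & Hc & Ec & Yc); auto using fpos_act.
destruct (strip_middle T (act H x) (act H r)) as (d & Hd & Ed & Yd); auto using fpos_act.
(* The segments pq and xr both traverse the strip of [H], and Y, Z are their points halfway. Both
   are near the axis of [H], hence near each other, although the strip of [H'] separates them. *)
set (Y := fcomb p c q). set (Z := fcomb x d r).
assert (PY : fpos Y) by now apply fpos_comb.
assert (PZ : fpos Z) by now apply fpos_comb.
change (fx (fcomb (act H p) c (act H q)) = T * fz (fcomb (act H p) c (act H q))) in Ec.
change (fx (fcomb (act H x) d (act H r)) = T * fz (fcomb (act H x) d (act H r))) in Ed.
change (fy (fcomb (act H p) c (act H q)) ^ 2 <= 4 * fz (fcomb (act H p) c (act H q)) ^ 2) in Yc.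
change (fy (fcomb (act H x) d (act H r)) ^ 2 <= 4 * fz (fcomb (act H x) d (act H r)) ^ 2) in Yd.
rewrite <- act_comb in Ec, Ed, Yc, Yd. fold Y in Ec, Yc. fold Z in Ed, Yd.
assert (Y' : fx (act H' Y) < fz (act H' Y)).
{ unfold Y; rewrite act_comb; simpl fx; simpl fz in *. simpl in p2, q2 |- *. nra. }
assert (Z' : fx (act H' Z) > T ^ 2 * fz (act H' Z)).
{ unfold Z; rewrite act_comb. unfold fcomb. cbn [fx fz]. nra. }
pose proof (fpos_act H Y dH PY) as (Y1 & Y2 & Y3).
pose proof (fpos_act H Z dH PZ) as (Z1 & Z2 & Z3).
pose proof (fpos_act H' Y dH' PY) as PY'.
pose proof (fpos_act H' Z dH' PZ) as PZ'.
pose proof (pair_far T (act H' Y) (act H' Z) ltac:(lra) PY' PZ' Y' Z') as Hfar.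
rewrite fpair_act in Hfar by auto. rewrite <- (fpair_act H Y Z dH) in Hfar.
pose proof (fdet_act H' Y dH') as DY. rewrite <- (fdet_act H Y dH) in DY.
pose proof (fdet_act H' Z dH') as DZ. rewrite <- (fdet_act H Z dH) in DZ.
destruct PY' as (Y1' & Y2' & Y3'). destruct PZ' as (Z1' & Z2' & Z3').
unfold fdet, fpair in *.
set (s := fz (act H Y)) in *. set (u := fz (act H Z)) in *.
set (z := fz (act H' Y)) in *. set (w := fx (act H' Z)) in *.
rewrite Ec, Ed in *.
assert (Hz : (T - 4) * s ^ 2 < z ^ 2).
{ pose proof (Rmult_lt_compat_r z _ _ Y2' Y').
  pose proof (pow2_ge_0 (fy (act H' Y))). lra. }
assert (HT2 : 0 < T ^ 2) by nra.
assert (Hw : T ^ 2 * ((T - 4) * u ^ 2) < w ^ 2).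
{ pose proof (Rmult_lt_compat_l w _ _ Z1' Z').
  pose proof (pow2_ge_0 (fy (act H' Z))).
  apply Rle_lt_trans with (T ^ 2 * (w * fz (act H' Z))); [|lra].
  apply Rmult_le_compat_l; lra. }
assert (Hsu : 0 < s * u) by now apply Rmult_lt_0_compat.
assert (Hzw0 : 0 < z * w) by now apply Rmult_lt_0_compat.
assert (HT4 : 0 < T * (T - 4)) by (apply Rmult_lt_0_compat; lra).
assert (HT4su : 0 < T * (T - 4) * (s * u)) by now apply Rmult_lt_0_compat.
assert (Hzw : T * (T - 4) * (s * u) < z * w).
{ apply Rsqr_incrst_0; [|lra|lra]. rewrite !Rsqr_pow2.
  replace ((T * (T - 4) * (s * u)) ^ 2) with
    ((T - 4) * s ^ 2 * (T ^ 2 * ((T - 4) * u ^ 2))) by ring.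
  rewrite Rpow_mult_distr. apply Rmult_le_0_lt_compat; auto;
   repeat apply Rmult_le_pos; try apply pow2_ge_0; lra. }
assert (Hbe : - (2 * fy (act H Y) * fy (act H Z)) <= 8 * (s * u)).
{ pose proof (pow2_ge_0 (u * fy (act H Y) + s * fy (act H Z))).
  assert (u ^ 2 * fy (act H Y) ^ 2 <= u ^ 2 * (4 * s ^ 2))
    by (apply Rmult_le_compat_l; [apply pow2_ge_0 | lra]).
  assert (s ^ 2 * fy (act H Z) ^ 2 <= s ^ 2 * (4 * u ^ 2))
    by (apply Rmult_le_compat_l; [apply pow2_ge_0 | lra]).
  apply Rmult_le_reg_l with (s * u); auto. lra. }
assert (HT1 : T - 2 <= T * (1 - / T) ^ 2).
{ replace (T * (1 - / T) ^ 2) with (T - 2 + / T) by (field; lra).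
  assert (0 < / T) by (apply Rinv_0_lt_compat; lra). lra. }
assert (T * (T - 4) * (s * u) * (1 - / T) ^ 2 <= z * w * (1 - / T) ^ 2)
  by (apply Rmult_le_compat_r; [apply pow2_ge_0 | lra]).
assert ((T - 4) * (s * u) * (T - 2) <= (T - 4) * (s * u) * (T * (1 - / T) ^ 2))
  by (apply Rmult_le_compat_l; [apply Rmult_le_pos; lra | auto]).
(* The right side is the upper bound for [fpair] seen in the strip of [H], the left side the lower
   bound forced by [H']. Together they say T^2 < 8 T. *)
assert (Hend : (T - 4) * (T - 2) * (s * u) < (2 * T + 8) * (s * u)) by lra.
apply Rmult_lt_reg_r in Hend; auto. clear - HT Hend. nra.
Qed.

(** * Chains of gates *)

Lemma FOP_app {A} (R : A -> A -> Prop) (l l' : list A) :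
  ForallOrdPairs R (l ++ l') <->
  ForallOrdPairs R l /\ ForallOrdPairs R l' /\ forall x y, In x l -> In y l' -> R x y.
Proof.
induction l as [|a l IH]; simpl.
- split; [intros H; repeat split; auto using FOP_nil; intros _ _ [] | tauto].
- split.
  + intros H; inversion H as [|? ? Ha Hl]; subst.
    apply IH in Hl as (H1 & H2 & H3). apply Forall_app in Ha as [Ha1 Ha2].
    repeat split; auto using FOP_cons. intros x y [<-|Hx] Hy; auto.
    rewrite Forall_forall in Ha2; auto.
  + intros (H1 & H2 & H3); inversion H1 as [|? ? Ha Hl]; subst.
    constructor; [|apply IH; auto].
    apply Forall_app; split; auto. apply Forall_forall; auto.
Qed.

Lemma max_nat (P : nat -> Prop) (n0 b : nat) :
  P n0 -> (forall n, P n -> (n <= b)%nat) ->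
  exists n, P n /\ forall k, P k -> (k <= n)%nat.
Proof.
intros H0 Hb. apply NNPP; intros Hn.
assert (H : forall k, exists n, P n /\ (k <= n)%nat).
{ induction k as [|k (n & Pn & Hk)]; [exists n0; split; auto; lia|].
  apply NNPP; intros H. apply Hn. exists n; split; auto.
  intros j Pj. apply Nat.nlt_ge; intros Hj. apply H. exists j; split; auto; lia. }
destruct (H (S b)) as (n & Pn & Hk). apply Hb in Pn; lia.
Qed.

Section Chains.
Context (T : R) (HT : 10 <= T) (S : Mat2 -> Prop) (HS : forall H, S H -> mdet H = 1).

(** All pairs are compared, not only neighbours, so any sublist of a chain is again a chain. *)
Definition chain (p q : Frm) (l : list Mat2) : Prop :=
  ForallOrdPairs (prec T) l /\ forall H, In H l -> S H /\ lo H p /\ hi T H q.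

Lemma chain_nil p q : chain p q nil.
Proof. split; [apply FOP_nil | intros H []]. Qed.

(** Once r is not past some gate, it lies before all later ones by [prec]. Hence at most one gate,
    the one whose strip may contain r, is lost. *)
Lemma chain_split p q r l : fpos r -> chain p q l ->
  exists l1 l2, chain p q l1 /\ (forall H, In H l1 -> hi T H r) /\
    chain p q l2 /\ (forall H, In H l2 -> lo H r) /\
    (length l <= length l1 + length l2 + 1)%nat /\ incl l1 l.
Proof.
intros Pr; induction l as [|h l IH]; intros (H1 & H2).
- exists nil, nil; pose proof (chain_nil p q) as N.
  split; [exact N|]; split; [intros ? []|]; split; [exact N|]; split; [intros ? []|].
  split; [simpl; lia | intros ? []].
- inversion H1 as [|? ? Hh Hl]; subst. rewrite Forall_forall in Hh.
  assert (Cl : chain p q l) by (split; auto; intros; apply H2; now right).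
  destruct (classic (hi T h r)) as [Hr|Hr].
  + destruct (IH Cl) as (l1 & l2 & C1 & R1 & C2 & R2 & Hlen & Hin).
    exists (h :: l1), l2. split; [split|]; [| |split; [|split; [|split; [|split]]]]; auto.
    * constructor; [apply Forall_forall; auto | apply C1].
    * intros H [<-|HH]; [apply H2; now left | now apply C1].
    * intros H [<-|HH]; auto.
    * simpl; lia.
    * intros H [<-|HH]; [now left | right; auto].
  + exists nil, l. split; [apply chain_nil|]; split; [intros ? []|]; split; [exact Cl|].
    split; [intros H HH; now apply Hh|]. split; [simpl; lia | intros ? []].
Qed.

(** The last gate h1 of [l1] and the first gate h2 of [l2] are given up as a buffer. If a gate
    before h1 failed to precede a gate after h2, some point X would be before h1 and past h2, and p,
    q, r, X would make h1 and h2 cross, against [no_cross]. *)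
Lemma chain_join p q r l1 l2 : fpos p -> fpos q -> fpos r ->
  chain p q l1 -> (forall H, In H l1 -> hi T H r) ->
  chain q r l2 -> (forall H, In H l2 -> lo H p) ->
  exists l, chain p r l /\ (length l1 + length l2 <= length l + 2)%nat.
Proof.
intros Pp Pq Pr C1 R1 C2 R2.
destruct l1 as [|h1 t1] using rev_ind.
{ exists l2; split; [|simpl; lia]. split; [apply C2|].
  intros H HH; repeat split; auto; now apply C2. }
clear IHt1.
destruct l2 as [|h2 t2].
{ exists (t1 ++ h1 :: nil); split; [|simpl; lia]. split; [apply C1|].
  intros H HH; repeat split; auto; now apply C1. }
destruct C1 as [O1 C1]. destruct C2 as [O2 C2].
apply FOP_app in O1 as (O1 & _ & O1'). inversion O2 as [|? ? O2' O2t]; subst.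
rewrite Forall_forall in O2'.
exists (t1 ++ t2); split; [|rewrite !length_app; simpl; lia].
split.
- apply FOP_app; repeat split; auto.
  intros x y Hx Hy X PX HX.
  assert (Lx : lo h1 X) by (apply (O1' x h1); simpl; auto).
  apply NNPP; intros Ly.
  assert (Hhi : hi T h2 X) by (apply NNPP; intros HN; apply Ly, (O2' y); auto).
  destruct (C1 h1) as (S1 & A1 & B1); [apply in_or_app; simpl; auto|].
  destruct (C2 h2) as (S2 & A2 & B2); [simpl; auto|].
  apply (no_cross T h1 h2 p q r X); auto.
  + apply R2; simpl; auto.
  + apply R1, in_or_app; simpl; auto.
- intros H HH; apply in_app_or in HH as [HH|HH].
  + repeat split; try apply C1; try apply R1; apply in_or_app; auto.
  + repeat split; try apply C2; try apply R2; simpl; auto.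
Qed.

Definition is_clen (p q : Frm) (n : nat) : Prop :=
  (exists l, chain p q l /\ length l = n) /\
  forall l, chain p q l -> (length l <= n)%nat.

Definition clen (p q : Frm) : nat := epsilon (inhabits 0%nat) (is_clen p q).

Context (Hfin : forall p q, fpos p -> fpos q ->
  exists b, forall l, chain p q l -> (length l <= b)%nat).

Lemma clen_spec p q : fpos p -> fpos q -> is_clen p q (clen p q).
Proof.
intros Pp Pq; unfold clen; apply epsilon_spec.
destruct (Hfin p q Pp Pq) as (b & Hb).
destruct (max_nat (fun n => exists l, chain p q l /\ length l = n) 0 b) as (n & Hn & Hm).
- exists nil; split; auto using chain_nil.
- intros n (l & Hl & <-); auto.
- exists n; split; auto. intros l Hl; apply Hm; eauto.
Qed.

Lemma clen_ge p q l : fpos p -> fpos q -> chain p q l -> (length l <= clen p q)%nat.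
Proof. intros Pp Pq; now apply clen_spec. Qed.

Lemma clen_le p q b : fpos p -> fpos q ->
  (forall l, chain p q l -> (length l <= b)%nat) -> (clen p q <= b)%nat.
Proof. intros Pp Pq H; destruct (clen_spec p q Pp Pq) as ((l & Hl & <-) & _); auto. Qed.

(** Each of the three chains around the triangle is cut at the opposite vertex, and the pieces are
    joined crosswise into three chains of the reverse orientation. Three cuts lose one gate each and
    three joins two each, which makes 9. *)
Lemma clen_quasi p q r : fpos p -> fpos q -> fpos r ->
  (clen p q + clen q r + clen r p <= clen p r + clen r q + clen q p + 9)%nat.
Proof.
intros Pp Pq Pr.
destruct (clen_spec p q Pp Pq) as ((lpq & Cpq & <-) & _).
destruct (clen_spec q r Pq Pr) as ((lqr & Cqr & <-) & _).
destruct (clen_spec r p Pr Pp) as ((lrp & Crp & <-) & _).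
destruct (chain_split p q r _ Pr Cpq) as (a1 & a2 & A1 & A1' & A2 & A2' & LA & _).
destruct (chain_split q r p _ Pp Cqr) as (b1 & b2 & B1 & B1' & B2 & B2' & LB & _).
destruct (chain_split r p q _ Pq Crp) as (c1 & c2 & D1 & D1' & D2 & D2' & LC & _).
destruct (chain_join p q r a1 b2) as (u & U & LU); auto.
destruct (chain_join q r p b1 c2) as (v & V & LV); auto.
destruct (chain_join r p q c1 a2) as (w & W & LW); auto.
apply clen_ge in U; auto. apply clen_ge in V; auto. apply clen_ge in W; auto. lia.
Qed.

Definition fdiff (p q : Frm) : R := INR (clen p q) - INR (clen q p).

Lemma fdiff_anti p q : fdiff q p = - fdiff p q.
Proof. unfold fdiff; ring. Qed.

Lemma fdiff_quasi p q r : fpos p -> fpos q -> fpos r ->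
  fdiff p q <= fdiff p r + fdiff r q + 9.
Proof.
intros Pp Pq Pr; pose proof (clen_quasi p q r Pp Pq Pr) as H.
apply le_INR in H. rewrite !plus_INR in H. unfold fdiff.
replace (INR 9) with 9 in H by (simpl; ring). lra.
Qed.

(** A gate is stored as the isometry bringing it to standard position, so moving the points by g
    amounts to multiplying the gates by g on the right. *)
Lemma clen_inv g p q : mdet g = 1 -> fpos p -> fpos q ->
  (forall H, S (H ** g) <-> S H) -> clen (act g p) (act g q) = clen p q.
Proof.
intros dg Pp Pq HSg.
assert (Pgp : fpos (act g p)) by now apply fpos_act.
assert (Pgq : fpos (act g q)) by now apply fpos_act.
assert (E1 : forall H X, lo (H ** g) X <-> lo H (act g X)).
{ intros; unfold lo; rewrite act_mul; tauto. }
assert (E2 : forall H X, hi T (H ** g) X <-> hi T H (act g X)).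
{ intros; unfold hi; rewrite act_mul; tauto. }
apply Nat.le_antisymm.
- apply clen_le; auto. intros l [O C].
  rewrite <- (length_map (fun H => H ** g) l). apply clen_ge; auto. split.
  + clear C; induction O as [|h l Hh O IH]; simpl; constructor; auto.
    apply Forall_forall. intros y Hy; apply in_map_iff in Hy as (h' & <- & Hy).
    rewrite Forall_forall in Hh. intros X PX HX. apply E1, Hh; auto using fpos_act.
    intros HX'; now apply HX, E2.
  + intros y Hy; apply in_map_iff in Hy as (h & <- & Hy).
    rewrite HSg, E1, E2; auto.
- apply clen_le; auto. intros l [O C].
  rewrite <- (length_map (fun H => H ** minv g) l). apply clen_ge; auto. split.
  + clear C; induction O as [|h l Hh O IH]; simpl; constructor; auto.
    apply Forall_forall. intros y Hy; apply in_map_iff in Hy as (h' & <- & Hy).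
    rewrite Forall_forall in Hh. intros X PX HX.
    assert (PX' : fpos (act (minv g) X)) by (apply fpos_act; auto; now rewrite mdet_inv).
    unfold lo; rewrite act_mul. apply Hh; auto.
    intros HX'; apply HX. unfold hi; rewrite act_mul; auto.
  + intros y Hy; apply in_map_iff in Hy as (h & <- & Hy).
    destruct (C h Hy) as (C1 & C2 & C3).
    rewrite <- (mmulVK h g dg) in C1, C2, C3.
    apply (proj1 (HSg _)) in C1. apply E1 in C2. apply E2 in C3. auto.
Qed.

End Chains.

(** * Separation of axes and centralizers *)

Lemma pow_floor (c y : R) : 1 < c -> 1 <= y -> exists k, c ^ k <= y < c ^ S k.
Proof.
intros Hc Hy.
destruct (Pow_x_infinity c ltac:(rewrite Rabs_right; lra) (y + 1)) as (N & HN).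
assert (HNy : y < c ^ N).
{ specialize (HN N (le_n N)). rewrite Rabs_right in HN; [lra|].
  apply Rle_ge; left; apply pow_lt; lra. }
clear HN; induction N as [|N IH]; [simpl in HNy; lra|].
destruct (Rlt_le_dec y (c ^ N)); eauto.
Qed.

Lemma inv_gt1 (x : R) : x ^ 2 > 1 -> x <> 0 /\ x - / x <> 0.
Proof.
intros H; assert (x <> 0) by nra; split; auto.
intros E; assert (x * (x - / x) = x ^ 2 - 1) by (field; auto).
rewrite E in *; lra.
Qed.

Definition zpow (a s : Mat2) : Prop :=
  exists n, s = mpow a n \/ s = mpow (minv a) n.

Ltac grp HG := repeat first [assumption | apply (sg_mul _ HG) | apply (sg_inv _ HG)
  | apply (sg_pow _ HG) | apply (sg_1 _ HG) | apply (sg_neg _ HG)].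

Section Sep.
Context (G : Mat2 -> Prop) (HG : surface_group G).
Context (e : R) (He0 : 0 < e) (He1 : e <= 1)
  (Hgap : forall g, G g -> ~ eqpm g mI -> mtr g ^ 2 >= 4 + e).

Lemma mtr_neq0 g : G g -> mtr g <> 0.
Proof. intros Gg E; pose proof (no_elliptic G HG g Gg); rewrite E in *; lra. Qed.

Section Axis.
Context (a U : Mat2) (l : R) (Ga : G a) (HU : mdet U = 1) (Hl : l ^ 2 > 1)
  (Ea : a = U ** dg l ** minv U).

(* [t] in the coordinate where the axis of [a] is (0, oo). *)
Definition cd (t : Mat2) : Mat2 := minv U ** t ** U.

Lemma mdet_cd t : G t -> mdet (cd t) = 1.
Proof.
intros Gt; unfold cd; apply mdet_mul1; auto. apply mdet_mul1; [now rewrite mdet_inv|].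
now apply (sg_det G HG).
Qed.

Lemma cd_mul s t : cd (s ** t) = cd s ** cd t.
Proof. unfold cd; rewrite !mmulA. now rewrite mmulKV. Qed.

Lemma cd_inv s : cd (minv s) = minv (cd s).
Proof. unfold cd; now rewrite !minv_mul, minvK, !mmulA. Qed.

Lemma cd_neg s : cd (mneg s) = mneg (cd s).
Proof. unfold cd; now rewrite mneg_mulr, mneg_mull. Qed.

Lemma cd_a : cd a = dg l.
Proof. unfold cd; now rewrite Ea, !mmulA, mmulVl, mmul1l, mmulVK. Qed.

Lemma cd_I : cd mI = mI.
Proof. unfold cd; now rewrite mmul1r, mmulVl. Qed.

Lemma cd_inj s t : cd s = cd t -> s = t.
Proof.
unfold cd; intros H. apply mulIr in H; auto. apply mulIl in H; auto.
now rewrite mdet_inv.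
Qed.

Lemma cd_pow s n : cd (mpow s n) = mpow (cd s) n.
Proof. induction n as [|n IH]; simpl; [apply cd_I | now rewrite cd_mul, IH]. Qed.

Lemma mtr_cd t : mtr (cd t) = mtr t.
Proof. now apply mtr_conjV. Qed.

(* The trace of a commutator [a, t] is [2 - T12 T21 (l - 1/l)^2], so small off-diagonal
   entries force it to be trivial. *)
Lemma sep_off t : G t ->
  Rabs (m12 (cd t) * m21 (cd t)) * (l - / l) ^ 2 < e / 5 ->
  m12 (cd t) = 0 /\ m21 (cd t) = 0.
Proof.
intros Gt Hs. destruct (inv_gt1 l Hl) as [Hl0 Hll].
pose proof (mdet_cd t Gt) as Hd.
set (g := a ** t ** minv a ** minv t).
assert (Gg : G g) by (unfold g; grp HG).
set (u := m12 (cd t) * m21 (cd t) * (l - / l) ^ 2).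
assert (Hu : Rabs u < e / 5).
{ unfold u; rewrite Rabs_mult, (Rabs_right ((l - / l) ^ 2)); auto.
  apply Rle_ge, pow2_ge_0. }
assert (Ec : cd g = dg l ** cd t ** dg (/ l) ** minv (cd t)).
{ unfold g; rewrite !cd_mul, !cd_inv, cd_a, dg_inv; reflexivity. }
assert (Et : mtr g = 2 - u).
{ rewrite <- mtr_cd, Ec. unfold u. destruct (cd t) as [p q r s].
  unfold mtr, mdet in *; simpl in *. rewrite Rinv_inv.
  assert (p * s = 1 + q * r) by lra.
  transitivity (2 * (p * s) * (l * / l) - q * r * (l ^ 2 + (/ l) ^ 2)); [ring|].
  rewrite H. field; auto. }
(* With |u| < e/5 and e <= 1, (2 - u)^2 stays below 4 + 4e/5 + e/25 < 4 + e. This fixes the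
   threshold e/5. *)
assert (Hg : eqpm g mI).
{ apply NNPP; intros HN. pose proof (Hgap g Gg HN) as H. rewrite Et in H.
  apply Rabs_def2 in Hu as [Hu1 Hu2]. nra. }
destruct Hg as [Hg|Hg].
2:{ rewrite Hg in Et; unfold mtr in Et; simpl in Et.
  apply Rabs_def2 in Hu as [Hu1 Hu2]. lra. }
rewrite Hg, cd_I in Ec.
assert (E2 : cd t ** dg l = dg l ** cd t).
{ rewrite <- (mmul1l (cd t)) at 1. rewrite Ec.
  rewrite mmulVK by auto. rewrite <- mmulA, dg_mul, Rinv_l by auto.
  replace (dg 1) with mI; [now rewrite mmul1r|]. unfold dg; now rewrite Rinv_1. }
destruct (cd t) as [p q r s]; simpl in *.
injection E2; intros E3 E4 E5 E6.
split.
- apply Rmult_eq_reg_r with (l - / l); auto. lra.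
- apply Rmult_eq_reg_r with (l - / l); auto. lra.
Qed.

(** Apply [sep_off] to t a t^-1, whose off-diagonal product is that of the four entries of t times
    -(l - 1/l)^2. If t a t^-1 is diagonal, then t is diagonal or antidiagonal; the second case has
    trace 0, which G excludes. *)
Lemma sep_diag t : G t ->
  Rabs (m11 (cd t) * m12 (cd t) * m21 (cd t) * m22 (cd t)) * (l - / l) ^ 4 < e / 5 ->
  m12 (cd t) = 0 /\ m21 (cd t) = 0.
Proof.
intros Gt Hs. destruct (inv_gt1 l Hl) as [Hl0 Hll].
pose proof (mdet_cd t Gt) as Hd.
destruct (sep_off (t ** a ** minv t)) as [H1 H2].
- grp HG.
- rewrite !cd_mul, cd_inv, cd_a. destruct (cd t) as [p q r s]; simpl in *.
  replace ((_ + _) * (_ + _)) with ((p * q * r * s) * (- (l - / l) ^ 2)) by ring.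
  rewrite Rabs_mult, Rabs_Ropp, (Rabs_right ((l - / l) ^ 2)); [lra|].
  apply Rle_ge, pow2_ge_0.
- rewrite !cd_mul, cd_inv, cd_a in H1, H2.
  pose proof (mtr_neq0 t Gt) as Ht. rewrite <- mtr_cd in Ht.
  destruct (cd t) as [p q r s]; unfold mtr, mdet in *; simpl in *.
  assert (E1 : p * q * (l - / l) = 0) by lra.
  assert (E2 : r * s * (l - / l) = 0) by lra.
  apply Rmult_integral in E1 as [E1|]; [|easy].
  apply Rmult_integral in E2 as [E2|]; [|easy].
  apply Rmult_integral in E1 as [->| ->]; apply Rmult_integral in E2 as [->| ->]; lra.
Qed.

(* The diagonal elements of G form a discrete multiplicative group; primitivity
   makes |l| its least element above 1. *)
Lemma centralizer_primitive t : Defs.primitive G a -> G t -> m12 (cd t) = 0 -> m21 (cd t) = 0 ->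
  exists s, zpow a s /\ eqpm t s.
Proof.
intros (_ & Ha1 & Hprim) Gt T12 T21. destruct (inv_gt1 l Hl) as [Hl0 _].
(* Positive multipliers of the elements preserving the axis and its ends; signs are absorbed by -I
   in G. *)
set (Q := fun x => 0 < x /\ exists g, G g /\ cd g = dg x).
assert (Qin : forall g, G g -> m12 (cd g) = 0 -> m21 (cd g) = 0 ->
  exists x, Q x /\ exists g', eqpm g g' /\ G g' /\ cd g' = dg x).
{ intros g Gg H1 H2. pose proof (mdet_cd g Gg) as Hd.
  assert (E : exists y, y <> 0 /\ cd g = dg y).
  { destruct (cd g) as [p q r s]; unfold mdet in Hd; simpl in *; subst q r.
    assert (p <> 0) by (intros ->; lra).
    exists p; split; auto. unfold dg; f_equal. apply Rmult_eq_reg_l with p; auto.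
    rewrite Rinv_r; lra. }
  destruct E as (y & Hy & E). destruct (Rlt_le_dec 0 y) as [Hp|Hn].
  - exists y. split; [split; eauto|]. exists g; repeat split; auto. now left.
  - exists (- y). assert (cd (mneg g) = dg (- y)) by now rewrite cd_neg, E, dg_opp.
    assert (G (mneg g)) by now apply sg_neg.
    split; [split; [lra | eauto]|]. exists (mneg g); repeat split; auto.
    right; now rewrite mnegK. }
assert (Qmul : forall x y, Q x -> Q y -> Q (x * y)).
{ intros x y (Hx & g & Gg & Eg) (Hy & h & Gh & Eh). split; [now apply Rmult_lt_0_compat|].
  exists (g ** h); split; [now apply sg_mul | now rewrite cd_mul, Eg, Eh, dg_mul]. }
assert (Qinv : forall x, Q x -> Q (/ x)).
{ intros x (Hx & g & Gg & Eg). split; [now apply Rinv_0_lt_compat|].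
  exists (minv g); split; [now apply sg_inv | now rewrite cd_inv, Eg, dg_inv]. }
assert (Qpow : forall x k, Q x -> Q (x ^ k)).
{ intros x k Hx; induction k; simpl; auto. split; [lra|]. exists mI; split.
  - now apply sg_1.
  - rewrite cd_I; unfold dg; now rewrite Rinv_1. }
assert (Qgap : forall x, Q x -> 1 < x -> 1 + e <= x ^ 2).
{ intros x (Hx & g & Gg & Eg) H1.
  assert (Hg : ~ eqpm g mI).
  { intros E. assert (E2 : eqpm (cd g) mI) by
      (destruct E as [->| ->]; rewrite ?cd_neg, cd_I; [left | right]; auto).
    rewrite Eg in E2. destruct E2 as [E2|E2]; injection E2; intros; lra. }
  pose proof (Hgap g Gg Hg) as H. rewrite <- mtr_cd, Eg in H. unfold mtr in H; simpl in H.
  assert (x * / x = 1) by (field; lra).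
  assert (0 < / x < 1) by (split; [now apply Rinv_0_lt_compat |
    rewrite <- Rinv_1; apply Rinv_lt_contravar; lra]). nra. }
assert (Hla : 1 < Rabs l).
{ rewrite <- (pow2_abs l) in Hl. pose proof (Rabs_pos l). nra. }
assert (Qa : Q (Rabs l)).
{ destruct (Qin a Ga) as (x & Qx & g & Eg & Gg & Ex);
   [rewrite cd_a; reflexivity | rewrite cd_a; reflexivity |].
  replace (Rabs l) with x; auto. destruct Qx as [Hx _].
  assert (Ed : cd g = dg l \/ cd g = mneg (dg l)).
  { rewrite <- cd_a. destruct Eg as [->| ->]; [now left | right].
    now rewrite cd_neg, mnegK. }
  rewrite Ex in Ed. destruct Ed as [Ed|Ed]; apply (f_equal m11) in Ed; simpl in Ed.
  - rewrite Ed, Rabs_right; lra.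
  - rewrite Ed, Rabs_left; lra. }
(* The generator is sought as the inverse of the largest element of Q below 1. The supremum is
   attained: a quotient of two elements close to it would violate [Qgap]. *)
destruct (completeness (fun y => Q y /\ y < 1)) as (m & Hm1 & Hm2).
{ exists 1. intros y (_ & Hy); lra. }
{ exists (/ Rabs l). split; auto. rewrite <- Rinv_1; apply Rinv_lt_contravar; lra. }
assert (Hm0 : 0 < m).
{ apply Rlt_le_trans with (/ Rabs l); [apply Rinv_0_lt_compat; lra|].
  apply Hm1; split; auto. rewrite <- Rinv_1; apply Rinv_lt_contravar; lra. }
assert (Hyy : exists y, Q y /\ y < 1 /\ m < (1 + e / 4) * y).
{ apply NNPP; intros HN.
  assert (H : m <= m / (1 + e / 4)).
  { apply Hm2. intros y (Qy & Hy). apply Rnot_lt_le; intros H. apply HN.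
    exists y; split; [auto|split; [auto|]].
    apply Rmult_lt_compat_l with (r := 1 + e / 4) in H; [|lra].
    replace ((1 + e / 4) * (m / (1 + e / 4))) with m in H by (field; lra). lra. }
  apply Rmult_le_compat_l with (r := 1 + e / 4) in H; [|lra].
  replace ((1 + e / 4) * (m / (1 + e / 4))) with m in H by (field; lra).
  assert (0 < e * m) by now apply Rmult_lt_0_compat. lra. }
destruct Hyy as (y & Qy & Hy1 & Hym).
assert (Hy0 : 0 < y) by apply Qy.
assert (Hmax : forall z, Q z -> z < 1 -> z <= y).
{ intros z Qz Hz. apply Rnot_lt_le; intros Hlt.
  assert (Hzm : z <= m) by (apply Hm1; auto).
  assert (Q (z * / y)) by auto.
  assert (1 < z * / y).
  { apply Rmult_lt_reg_r with y; auto. rewrite Rmult_assoc, Rinv_l; lra. }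
  pose proof (Qgap _ H H0) as Hgp.
  assert (z * / y < 1 + e / 4).
  { apply Rmult_lt_reg_r with y; auto. rewrite Rmult_assoc, Rinv_l; lra. }
  nra. }
set (x0 := / y).
assert (Qx0 : Q x0) by now apply Qinv.
assert (Hx0 : 1 < x0) by (unfold x0; rewrite <- Rinv_1; apply Rinv_lt_contravar; lra).
assert (Hcyc : forall x, Q x -> 1 <= x -> exists k, x = x0 ^ k).
{ intros x Qx Hx. destruct (pow_floor x0 x Hx0 Hx) as (k & Hk1 & Hk2). exists k.
  assert (Hp : 0 < x0 ^ k) by (apply pow_lt; lra).
  destruct Hk1 as [Hk1|]; auto. exfalso.
  assert (Qz : Q (x0 ^ k * / x)) by auto.
  assert (Hz1 : x0 ^ k * / x < 1).
  { apply Rmult_lt_reg_r with x; [lra|]. rewrite Rmult_assoc, Rinv_l; lra. }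
  pose proof (Hmax _ Qz Hz1) as H.
  apply Rmult_le_compat_r with (r := x) in H; [|lra].
  rewrite Rmult_assoc, Rinv_l, Rmult_1_r in H by lra.
  apply Rmult_le_compat_l with (r := x0) in H; [|lra].
  replace (x0 * (y * x)) with x in H by (unfold x0; field; lra). simpl in Hk2; lra. }
(* Up to sign [a] is a power of the element with multiplier x0, and primitivity forbids exponents
   from 2 on. *)
assert (Ex0 : x0 = Rabs l).
{ destruct (Hcyc (Rabs l) Qa ltac:(lra)) as (k & Ek).
  destruct k as [|[|k]]; [simpl in Ek; lra | simpl in Ek; lra|].
  exfalso; apply Hprim. destruct Qx0 as (_ & g & Gg & Eg).
  exists g, (S (S k)). split; [auto|]. split; [lia|].
  assert (E : cd (mpow g (S (S k))) = dg (Rabs l)) by now rewrite cd_pow, Eg, dg_pow, Ek.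
  unfold Rabs in E; destruct (Rcase_abs l).
  - right. apply cd_inj. rewrite cd_neg, E, cd_a, dg_opp, mnegK; auto.
  - left. apply cd_inj. now rewrite E, cd_a. }
destruct (Qin t Gt T12 T21) as (x & Qx & t' & Et & Gt' & Ex).
assert (Hdg : eqpm (dg l) (dg (Rabs l))).
{ unfold Rabs; destruct (Rcase_abs l); [right | now left]. now rewrite dg_opp, mnegK. }
assert (Heq : forall s, eqpm (cd t') (cd s) -> eqpm t' s).
{ intros s [E|E]; [left | right]; apply cd_inj; rewrite ?cd_neg; auto. }
destruct (Rle_lt_dec 1 x) as [H1|H1].
- destruct (Hcyc x Qx H1) as (k & Ek). exists (mpow a k). split; [exists k; auto|].
  apply eqpm_trans with (1 := Et), Heq. rewrite cd_pow, cd_a, Ex, Ek, Ex0, <- dg_pow.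
  apply eqpm_pow; now apply eqpm_sym.
- destruct (Hcyc (/ x)) as (k & Ek); auto.
  { rewrite <- Rinv_1; apply Rinv_le_contravar; [apply Qx | lra]. }
  exists (mpow (minv a) k). split; [exists k; auto|].
  apply eqpm_trans with (1 := Et), Heq.
  rewrite cd_pow, cd_inv, cd_a, Ex, <- (Rinv_inv x), Ek, Ex0, <- pow_inv, <- dg_pow, <- dg_inv.
  apply eqpm_pow, eqpm_inv; now apply eqpm_sym.
Qed.

End Axis.
End Sep.

(** * Linking of axes *)

(** z is the point u/v of the projective line. For u = v = 0 this holds of every z, so later
    statements ask for nonzero determinants. *)
Definition endpt (z : bdry) (u v : R) : Prop :=
  match z with None => v = 0 | Some x => u = x * v end.

Lemma conj_conj (g W D : Mat2) : conj g (W ** D ** minv W) = (g ** W) ** D ** minv (g ** W).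
Proof. unfold conj; now rewrite minv_mul, !mmulA. Qed.

(** The fixed-point equation factors as l - 1/l times one linear factor for each column of A. *)
Lemma fixes_conj (A : Mat2) (l : R) (z : bdry) : mdet A = 1 -> l ^ 2 > 1 ->
  fixes (A ** dg l ** minv A) z <-> endpt z (m11 A) (m21 A) \/ endpt z (m12 A) (m22 A).
Proof.
intros dA Hl; destruct (inv_gt1 l Hl) as [_ Hk].
destruct A as [p q r s]; unfold mdet in dA; simpl in *.
set (k := l - / l) in *.
destruct z as [x|]; simpl.
- replace (_ * (x * (x * 1)) + _ - _) with (k * ((p - x * r) * (q - x * s))).
  2:{ unfold k; ring. }
  split.
  + intros H; apply Rmult_integral in H as [H|H]; [easy|].
    apply Rmult_integral in H as [H|H]; [left | right]; lra.
  + intros [->| ->]; ring.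
- replace (_ + _) with (k * (r * s)) by (unfold k; ring).
  split.
  + intros H; apply Rmult_integral in H as [H|H]; [easy|].
    now apply Rmult_integral.
  + intros [->| ->]; ring.
Qed.

Lemma xor_sign (s t : R) : s <> 0 -> t <> 0 -> ~ (s < 0 <-> t < 0) <-> s * t < 0.
Proof.
intros Hs Ht. destruct (Rdichotomy _ _ Hs), (Rdichotomy _ _ Ht).
- split; [intros E; exfalso; tauto | nra].
- split; [nra | intros _ E]. apply E in H; lra.
- split; [nra | intros _ E]. apply E in H0; lra.
- split; [intros E; exfalso; apply E; split; intros; lra | nra].
Qed.

Lemma side_finite (a b c : R) : Rmin a b < c < Rmax a b <-> (c - a) * (c - b) < 0.
Proof.
unfold Rmin, Rmax; destruct (Rle_dec a b); split; intros H.
- nra.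
- destruct (Rlt_le_dec a c); [split|]; nra.
- nra.
- destruct (Rlt_le_dec b c); [split|]; nra.
Qed.

Lemma neg_sq (K q : R) : K <> 0 -> (K ^ 2 * q < 0 <-> q < 0).
Proof.
intros HK; assert (0 < K ^ 2) by (rewrite <- Rsqr_pow2; now apply Rsqr_pos_lt).
split; intros; nra.
Qed.

Definition det2 (u1 u2 v1 v2 : R) : R := u1 * v2 - u2 * v1.

(* Linking is the sign of a cross-ratio. *)
Lemma linked4_iff (x1 y1 x2 y2 : bdry) (a1 a2 b1 b2 c1 c2 d1 d2 : R) :
  endpt x1 a1 a2 -> endpt y1 b1 b2 -> endpt x2 c1 c2 -> endpt y2 d1 d2 ->
  det2 a1 a2 b1 b2 <> 0 -> det2 c1 c2 d1 d2 <> 0 ->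
  (linked4 x1 y1 x2 y2 <->
   det2 a1 a2 c1 c2 * det2 b1 b2 d1 d2 * (det2 a1 a2 d1 d2 * det2 b1 b2 c1 c2) < 0).
Proof.
intros E1 E2 E3 E4 N1 N2.
assert (EQ : forall (z z' : bdry) u1 u2 v1 v2, endpt z u1 u2 -> endpt z' v1 v2 ->
  det2 u1 u2 v1 v2 <> 0 -> z <> z').
{ intros z z' u1 u2 v1 v2 Hu Hv HN <-. apply HN; unfold det2.
  destruct z; simpl in *; subst; ring. }
assert (NE : forall (z z' : bdry) u1 u2 v1 v2, endpt z u1 u2 -> endpt z' v1 v2 ->
  u2 <> 0 \/ u1 <> 0 -> v2 <> 0 \/ v1 <> 0 -> z <> z' -> det2 u1 u2 v1 v2 <> 0).
{ intros z z' u1 u2 v1 v2 Hu Hv Zu Zv HN HE; unfold det2 in HE.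
  destruct z as [x|], z' as [x'|]; simpl in *; subst; try (now apply HN).
  - assert (u2 <> 0) by (destruct Zu as [|Zu]; auto; intros ->; apply Zu; ring).
    assert (v2 <> 0) by (destruct Zv as [|Zv]; auto; intros ->; apply Zv; ring).
    apply HN; f_equal. assert ((x - x') * (u2 * v2) = 0) by lra.
    apply Rmult_integral in H1 as [|H1]; [lra|]. apply Rmult_integral in H1; tauto.
  - assert (u2 <> 0) by (destruct Zu as [|Zu]; auto; intros ->; apply Zu; ring).
    assert (u2 * v1 = 0) by lra. apply Rmult_integral in H0; tauto.
  - assert (v2 <> 0) by (destruct Zv as [|Zv]; auto; intros ->; apply Zv; ring).
    assert (u1 * v2 = 0) by lra. apply Rmult_integral in H0; tauto. }
assert (Za : a2 <> 0 \/ a1 <> 0).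
{ destruct (Req_dec a2 0); [|auto]. right; intros E; apply N1; unfold det2; subst; ring. }
assert (Zb : b2 <> 0 \/ b1 <> 0).
{ destruct (Req_dec b2 0); [|auto]. right; intros E; apply N1; unfold det2; subst; ring. }
assert (Zc : c2 <> 0 \/ c1 <> 0).
{ destruct (Req_dec c2 0); [|auto]. right; intros E; apply N2; unfold det2; subst; ring. }
assert (Zd : d2 <> 0 \/ d1 <> 0).
{ destruct (Req_dec d2 0); [|auto]. right; intros E; apply N2; unfold det2; subst; ring. }
assert (X1 : x1 <> y1) by eauto.
assert (X2 : x2 <> y2) by eauto.
assert (D : linked4 x1 y1 x2 y2 -> det2 a1 a2 c1 c2 <> 0 /\ det2 b1 b2 d1 d2 <> 0 /\
  det2 a1 a2 d1 d2 <> 0 /\ det2 b1 b2 c1 c2 <> 0).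
{ intros (_ & L2 & L3 & L4 & L5 & _ & _). repeat split; eauto. }
assert (D' : det2 a1 a2 c1 c2 * det2 b1 b2 d1 d2 * (det2 a1 a2 d1 d2 * det2 b1 b2 c1 c2) < 0 ->
  det2 a1 a2 c1 c2 <> 0 /\ det2 b1 b2 d1 d2 <> 0 /\
  det2 a1 a2 d1 d2 <> 0 /\ det2 b1 b2 c1 c2 <> 0).
{ intros H; repeat split; intros E; rewrite E in H; lra. }
assert (Main : det2 a1 a2 c1 c2 <> 0 -> det2 b1 b2 d1 d2 <> 0 ->
  det2 a1 a2 d1 d2 <> 0 -> det2 b1 b2 c1 c2 <> 0 ->
  (~ (side x1 y1 x2 <-> side x1 y1 y2) <->
   det2 a1 a2 c1 c2 * det2 b1 b2 d1 d2 * (det2 a1 a2 d1 d2 * det2 b1 b2 c1 c2) < 0)).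
{ clear D D' EQ NE. intros H1 H2 H3 H4.
  assert (lt_sub : forall a b, a < b <-> a - b < 0) by (intros; split; intros; lra).
  (* No two of the points coincide, so at most one is infinite. In each of the five cases the
     product is a nonzero square times the expression whose sign decides [side]. *)
  destruct x1 as [x1|], y1 as [y1|]; [ | | |now destruct X1];
  destruct x2 as [x2|], y2 as [y2|]; simpl in E1, E2, E3, E4; subst;
  unfold det2 in *; try (now destruct X2);
  try (exfalso; match goal with H : _ <> 0 |- _ => apply H; ring end);
  unfold side; rewrite ?side_finite.
  - match goal with |- _ <-> ?e < 0 => replace e with ((a2 * b2 * c2 * d2) ^ 2 *
      (((x2 - x1) * (x2 - y1)) * ((y2 - x1) * (y2 - y1)))) by ring end.
    rewrite neg_sq; [apply xor_sign|]; intros E.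
    + apply Rmult_integral in E as [E|E].
      * apply H1; replace x2 with x1 by (clear - E; lra); ring.
      * apply H4; replace x2 with y1 by (clear - E; lra); ring.
    + apply Rmult_integral in E as [E|E].
      * apply H3; replace y2 with x1 by (clear - E; lra); ring.
      * apply H2; replace y2 with y1 by (clear - E; lra); ring.
    + repeat (apply Rmult_integral in E as [E|E]); subst;
      [apply H1 | apply H2 | apply H1 | apply H2]; ring.
  - match goal with |- _ <-> ?e < 0 => replace e with ((a2 * b2 * c2 * d1) ^ 2 * ((x2 - x1) * (x2 - y1))) by ring end.
    rewrite neg_sq; [tauto|]. intros E.
    repeat (apply Rmult_integral in E as [E|E]); subst;
      [apply H1 | apply H2 | apply H1 | apply H2]; ring.
  - match goal with |- _ <-> ?e < 0 => replace e with ((a2 * b2 * c1 * d2) ^ 2 * ((y2 - x1) * (y2 - y1))) by ring end.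
    rewrite neg_sq; [tauto|]. intros E.
    repeat (apply Rmult_integral in E as [E|E]); subst;
      [apply H1 | apply H2 | apply H1 | apply H2]; ring.
  - match goal with |- _ <-> ?e < 0 => replace e with ((a2 * b1 * c2 * d2) ^ 2 * ((x1 - x2) * (x1 - y2))) by ring end.
    rewrite neg_sq.
    + rewrite (lt_sub x1 x2), (lt_sub x1 y2); apply xor_sign.
      * intros E; apply H1; replace x2 with x1 by (clear - E; lra); ring.
      * intros E; apply H3; replace y2 with x1 by (clear - E; lra); ring.
    + intros E.
      repeat (apply Rmult_integral in E as [E|E]); subst;
      [apply H1 | apply H2 | apply H1 | apply H2]; ring.
  - match goal with |- _ <-> ?e < 0 => replace e with ((a1 * b2 * c2 * d2) ^ 2 * ((y1 - x2) * (y1 - y2))) by ring end.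
    rewrite neg_sq.
    + rewrite (lt_sub y1 x2), (lt_sub y1 y2); apply xor_sign.
      * intros E; apply H4; replace x2 with y1 by (clear - E; lra); ring.
      * intros E; apply H2; replace y2 with y1 by (clear - E; lra); ring.
    + intros E.
      repeat (apply Rmult_integral in E as [E|E]); subst;
      [apply H1 | apply H2 | apply H1 | apply H2]; ring. }
split.
- intros L. destruct (D L) as (P1 & P2 & P3 & P4). apply Main; auto. apply L.
- intros L. destruct (D' L) as (P1 & P2 & P3 & P4).
  repeat split; eauto. apply Main; auto.
Qed.

(** The entries of A^-1 B are, up to sign, the determinants of a column of A with a column of B, and
    the columns are the ends of the axes. The product does not change when the two ends of one axis
    are exchanged. *)
Lemma axes_linked_iff (A B : Mat2) (k l : R) :
  mdet A = 1 -> mdet B = 1 -> k ^ 2 > 1 -> l ^ 2 > 1 ->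
  (axes_linked (A ** dg k ** minv A) (B ** dg l ** minv B) <->
   let Z := minv A ** B in m11 Z * m12 Z * m21 Z * m22 Z < 0).
Proof.
intros dA dB Hk Hl.
assert (Hex : forall u v, exists z, endpt z u v).
{ intros u v; destruct (Req_dec v 0) as [E|E]; [now exists None|].
  exists (Some (u / v)); simpl; field; auto. }
assert (HNe : forall z u v, ~ (u = 0 /\ v = 0) -> forall z', endpt z u v -> endpt z' u v -> z = z').
{ intros z u v HN z' H H'. destruct z as [x|], z' as [x'|]; simpl in *; auto.
  - f_equal. apply Rmult_eq_reg_r with v; [lra|]. intros E; apply HN; subst; split; ring.
  - exfalso; apply HN; subst; split; ring.
  - exfalso; apply HN; subst; split; ring. }
cbv zeta.
replace (m11 (minv A ** B) * m12 (minv A ** B) * m21 (minv A ** B) * m22 (minv A ** B)) with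
 (det2 (m11 A) (m21 A) (m11 B) (m21 B) * det2 (m12 A) (m22 A) (m12 B) (m22 B) *
  (det2 (m11 A) (m21 A) (m12 B) (m22 B) * det2 (m12 A) (m22 A) (m11 B) (m21 B)))
  by (unfold det2; simpl; ring).
assert (NA : det2 (m11 A) (m21 A) (m12 A) (m22 A) <> 0).
{ unfold det2, mdet in *; lra. }
assert (NB : det2 (m11 B) (m21 B) (m12 B) (m22 B) <> 0).
{ unfold det2, mdet in *; lra. }
assert (NA' : det2 (m12 A) (m22 A) (m11 A) (m21 A) <> 0) by (unfold det2, mdet in *; lra).
assert (NB' : det2 (m12 B) (m22 B) (m11 B) (m21 B) <> 0) by (unfold det2, mdet in *; lra).
assert (ZA1 : ~ (m11 A = 0 /\ m21 A = 0)) by (intros [E E']; apply NA; unfold det2; rewrite E, E'; ring).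
assert (ZA2 : ~ (m12 A = 0 /\ m22 A = 0)) by (intros [E E']; apply NA; unfold det2; rewrite E, E'; ring).
assert (ZB1 : ~ (m11 B = 0 /\ m21 B = 0)) by (intros [E E']; apply NB; unfold det2; rewrite E, E'; ring).
assert (ZB2 : ~ (m12 B = 0 /\ m22 B = 0)) by (intros [E E']; apply NB; unfold det2; rewrite E, E'; ring).
split.
- intros (x1 & y1 & x2 & y2 & F1 & F2 & F3 & F4 & L).
  apply fixes_conj in F1, F2, F3, F4; auto.
  assert (x1 <> y1) by apply L. assert (x2 <> y2) by apply L.
  destruct F1 as [F1|F1], F2 as [F2|F2]; try (exfalso; now eauto);
  destruct F3 as [F3|F3], F4 as [F4|F4]; try (exfalso; now eauto);
  apply (linked4_iff _ _ _ _ _ _ _ _ _ _ _ _ F1 F2 F3 F4) in L; auto; lra.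
- intros L.
  destruct (Hex (m11 A) (m21 A)) as (x1 & F1). destruct (Hex (m12 A) (m22 A)) as (y1 & F2).
  destruct (Hex (m11 B) (m21 B)) as (x2 & F3). destruct (Hex (m12 B) (m22 B)) as (y2 & F4).
  exists x1, y1, x2, y2. rewrite !fixes_conj; auto.
  repeat (split; [tauto|]).
  apply (linked4_iff _ _ _ _ _ _ _ _ _ _ _ _ F1 F2 F3 F4); auto.
Qed.

(** Equal axes have proportional frames, with the ends in the same order (Z diagonal) or exchanged
    (Z antidiagonal). *)
Lemma same_axis_entries (A B : Mat2) (k l : R) :
  mdet A = 1 -> mdet B = 1 -> k ^ 2 > 1 -> l ^ 2 > 1 ->
  same_axis (A ** dg k ** minv A) (B ** dg l ** minv B) ->
  let Z := minv A ** B in (m12 Z = 0 /\ m21 Z = 0) \/ (m11 Z = 0 /\ m22 Z = 0).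
Proof.
intros dA dB Hk Hl HS Z.
assert (dZ : mdet Z = 1) by (apply mdet_mul1; auto; now rewrite mdet_inv).
assert (Hex : forall u v, exists z, endpt z u v).
{ intros u v; destruct (Req_dec v 0) as [E|E]; [now exists None|].
  exists (Some (u / v)); simpl; field; auto. }
assert (H0 : forall z u1 u2 v1 v2, endpt z u1 u2 -> endpt z v1 v2 -> u1 * v2 - u2 * v1 = 0).
{ intros [x|] u1 u2 v1 v2 Hu Hv; simpl in *; subst; ring. }
destruct (Hex (m11 B) (m21 B)) as (x & Fx). destruct (Hex (m12 B) (m22 B)) as (y & Fy).
assert (Gx : fixes (A ** dg k ** minv A) x) by (apply HS, fixes_conj; auto).
assert (Gy : fixes (A ** dg k ** minv A) y) by (apply HS, fixes_conj; auto).
apply fixes_conj in Gx, Gy; auto.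
unfold Z, mdet in *; simpl in *.
destruct Gx as [Gx|Gx], Gy as [Gy|Gy];
 pose proof (H0 _ _ _ _ _ Fx Gx) as E1; pose proof (H0 _ _ _ _ _ Fy Gy) as E2.
- exfalso.
  assert (- m21 A * m11 B + m11 A * m21 B = 0) by lra.
  assert (- m21 A * m12 B + m11 A * m22 B = 0) by lra.
  rewrite H, H1 in dZ; lra.
- left; split; lra.
- right; split; lra.
- exfalso.
  assert (m22 A * m11 B + - m12 A * m21 B = 0) by lra.
  assert (m22 A * m12 B + - m12 A * m22 B = 0) by lra.
  rewrite H, H1 in dZ; lra.
Qed.

(** * Gates along the axis of a *)

Lemma fpos_bounds (X : Frm) : fpos X -> exists k K, 0 < k /\ 0 < K /\ forall u v,
  k * (u ^ 2 + v ^ 2) <= u ^ 2 * fx X + 2 * u * v * fy X + v ^ 2 * fz X <= K * (u ^ 2 + v ^ 2).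
Proof.
intros (H1 & H2 & H3). destruct X as [x y z]; cbn [fx fy fz] in *.
assert (PX : fpos (fr x y z)) by (split; [|split]; simpl; lra).
(* The trace bounds the larger eigenvalue of the form from above, and determinant over trace bounds
   the smaller one from below. *)
exists ((x * z - y ^ 2) / (x + z)), (x + z).
split; [apply Rdiv_lt_0_compat; simpl; lra|]. split; [lra|]. intros u v; split.
- apply Rmult_le_reg_l with (x + z); [lra|].
  replace ((x + z) * ((x * z - y ^ 2) / (x + z) * (u ^ 2 + v ^ 2))) with
    ((x * z - y ^ 2) * (u ^ 2 + v ^ 2)) by (field; lra).
  apply Rge_le, Rminus_ge, Rle_ge.
  match goal with |- 0 <= ?E => replace E with ((x * u + y * v) ^ 2 + (y * u + z * v) ^ 2) by ring end.
  pose proof (pow2_ge_0 (x * u + y * v)). pose proof (pow2_ge_0 (y * u + z * v)). lra.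
- destruct (Req_dec u 0) as [->|Hu]; [destruct (Req_dec v 0) as [->|Hv]; [lra|]|].
  + pose proof (fpos_quad (fr x y z) (- v) 0 PX (or_introl (Ropp_neq_0_compat v Hv))) as Hq.
    simpl fx in Hq; simpl fy in Hq; simpl fz in Hq. lra.
  + pose proof (fpos_quad (fr x y z) (- v) u PX ltac:(now right)) as Hq.
    simpl fx in Hq; simpl fy in Hq; simpl fz in Hq. lra.
Qed.

(** The point that H sends to i lies on the first side of the gate, so it is neither past the gate
    nor before it. *)
Lemma prec_irrefl (T : R) (H : Mat2) : 1 <= T -> mdet H = 1 -> ~ prec T H H.
Proof.
intros HT dH HP. assert (P : fpos (act (minv H) fbase)).
{ apply fpos_act; [now rewrite mdet_inv | apply fpos_base]. }
specialize (HP _ P). unfold hi, lo in HP. rewrite act_KV in HP by auto. simpl in HP.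
assert (1 < 1); [apply HP|]; nra.
Qed.

Lemma FOP_NoDup {A} (R : A -> A -> Prop) (l : list A) :
  (forall x, In x l -> ~ R x x) -> ForallOrdPairs R l -> NoDup l.
Proof.
intros Hi O; induction O as [|x l Hx O IH]; constructor.
- intros HIn. rewrite Forall_forall in Hx. apply (Hi x); [now left | auto].
- apply IH; intros y Hy; apply Hi; now right.
Qed.

(** [pair_far] bounds the product of the squared norms n1, n2 of the rows of H, while [lo] at p and
    [hi] at q bound each of them by a multiple of the other. *)
Lemma gate_bounded (T : R) (p q : Frm) : 10 <= T -> fpos p -> fpos q ->
  exists K, forall H, mdet H = 1 -> lo H p -> hi T H q -> nrm H <= K.
Proof.
intros HT Pp Pq.
destruct (fpos_bounds p Pp) as (k & K & Hk & HK & Bp).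
destruct (fpos_bounds q Pq) as (k' & K' & Hk' & HK' & Bq).
set (w := 2 * fpair p q / (k * k')).
assert (Hkk : 0 < k * k') by now apply Rmult_lt_0_compat.
exists (1 + K / k * w + (1 + K' / k' * w)). intros H dH L Hh.
pose proof (pair_far T (act H p) (act H q) ltac:(lra) (fpos_act _ _ dH Pp)
  (fpos_act _ _ dH Pq) L Hh) as Hf.
rewrite fpair_act in Hf by auto.
unfold lo, hi in L, Hh.
pose proof (fpos_act _ _ dH Pp) as (_ & Z1 & _).
pose proof (fpos_act _ _ dH Pq) as (X2 & Z2 & _).
pose proof (Bp (m11 H) (m12 H)) as [B1 _]. pose proof (Bp (m21 H) (m22 H)) as [B2 B2'].
pose proof (Bq (m11 H) (m12 H)) as [B3 B3']. pose proof (Bq (m21 H) (m22 H)) as [B4 _].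
change (k * (m11 H ^ 2 + m12 H ^ 2) <= fx (act H p)) in B1.
change (k * (m21 H ^ 2 + m22 H ^ 2) <= fz (act H p)) in B2.
change (fz (act H p) <= K * (m21 H ^ 2 + m22 H ^ 2)) in B2'.
change (k' * (m11 H ^ 2 + m12 H ^ 2) <= fx (act H q)) in B3.
change (fx (act H q) <= K' * (m11 H ^ 2 + m12 H ^ 2)) in B3'.
change (k' * (m21 H ^ 2 + m22 H ^ 2) <= fz (act H q)) in B4.
unfold nrm.
set (n1 := m11 H ^ 2 + m12 H ^ 2) in *. set (n2 := m21 H ^ 2 + m22 H ^ 2) in *.
assert (N1 : 0 <= n1) by (unfold n1; nra). assert (N2 : 0 <= n2) by (unfold n2; nra).
replace (n1 + m21 H ^ 2 + m22 H ^ 2) with (n1 + n2) by (unfold n2; ring).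
set (zp := fz (act H p)) in *. set (xq := fx (act H q)) in *.
assert (HT' : 1 / 2 <= (1 - / T) ^ 2).
{ assert (/ T <= / 10) by (apply Rinv_le_contravar; lra).
  assert (0 < / T) by (apply Rinv_0_lt_compat; lra). nra. }
assert (Hzx : zp * xq <= 2 * fpair p q).
{ assert (0 < zp * xq) by now apply Rmult_lt_0_compat. nra. }
assert (Hn : n1 * n2 <= w).
{ unfold w. apply Rmult_le_reg_l with (k * k'); auto.
  replace (k * k' * (2 * fpair p q / (k * k'))) with (2 * fpair p q) by (field; lra).
  apply Rle_trans with (2 := Hzx).
  replace (k * k' * (n1 * n2)) with ((k * n2) * (k' * n1)) by ring.
  apply Rmult_le_compat; nra. }
assert (H12 : n1 <= K / k * n2).
{ apply Rmult_le_reg_l with k; auto.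
  replace (k * (K / k * n2)) with (K * n2) by (field; lra). lra. }
assert (H21 : n2 <= K' / k' * n1).
{ apply Rmult_le_reg_l with k'; auto.
  replace (k' * (K' / k' * n1)) with (K' * n1) by (field; lra).
  assert (1 <= T ^ 2) by nra. assert (fz (act H q) <= T ^ 2 * fz (act H q)) by nra. lra. }
assert (0 < K / k) by now apply Rdiv_lt_0_compat.
assert (0 < K' / k') by now apply Rdiv_lt_0_compat.
assert (n1 ^ 2 <= K / k * w).
{ apply Rle_trans with (K / k * (n1 * n2)); [|apply Rmult_le_compat_l; lra].
  apply Rmult_le_compat_l with (r := n1) in H12; lra. }
assert (n2 ^ 2 <= K' / k' * w).
{ apply Rle_trans with (K' / k' * (n1 * n2)); [|apply Rmult_le_compat_l; lra].
  apply Rmult_le_compat_l with (r := n2) in H21; lra. }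
pose proof (pow2_ge_0 (n1 - 1)). pose proof (pow2_ge_0 (n2 - 1)).
pose proof (pow2_ge_0 n1). pose proof (pow2_ge_0 n2). lra.
Qed.

(** The hypotheses say that the axis crosses the gate backwards. Then |q r| is at least T |p t|,
    while p t - q r = 1, so |p t| <= 1/(T - 1) and |q r| <= T/(T - 1): the matrix is close to
    antidiagonal. *)
Lemma flip_entries (T s p q r t : R) : 1 < T -> 1 <= s ->
  p ^ 2 + q ^ 2 > T ^ 2 * (r ^ 2 + t ^ 2) ->
  s * p ^ 2 + / s * q ^ 2 < s * r ^ 2 + / s * t ^ 2 -> p * t - q * r = 1 ->
  p ^ 2 < r ^ 2 /\ T ^ 2 * t ^ 2 < q ^ 2 /\ Rabs (p * q * r * t) * (T - 1) ^ 2 <= T.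
Proof.
intros HT Hs H1 H2 Hd.
assert (Hs2 : s ^ 2 * (p ^ 2 - r ^ 2) < t ^ 2 - q ^ 2).
{ apply Rmult_lt_compat_l with (r := s) in H2; [|lra].
  replace (s * (s * p ^ 2 + / s * q ^ 2)) with (s ^ 2 * p ^ 2 + q ^ 2) in H2 by (field; lra).
  replace (s * (s * r ^ 2 + / s * t ^ 2)) with (s ^ 2 * r ^ 2 + t ^ 2) in H2 by (field; lra).
  lra. }
assert (HT2 : 1 < T ^ 2) by nra. assert (Hs3 : 1 <= s ^ 2) by nra.
pose proof (pow2_ge_0 p) as P. pose proof (pow2_ge_0 q) as Q.
pose proof (pow2_ge_0 r) as R0. pose proof (pow2_ge_0 t) as T0.
assert (A : p ^ 2 < r ^ 2).
{ apply Rnot_le_lt; intros HN. 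
  assert (p ^ 2 - r ^ 2 <= s ^ 2 * (p ^ 2 - r ^ 2)) by nra. nra. }
assert (B : T ^ 2 * t ^ 2 < q ^ 2) by nra.
split; [auto|]; split; [auto|].
set (x := p * t) in *. set (y := q * r) in *.
assert (Hxy : T * Rabs x <= Rabs y).
{ rewrite <- (Rabs_right T) by lra. rewrite <- Rabs_mult. apply Rsqr_le_abs_0.
  unfold Rsqr, x, y.
  replace (T * (p * t) * (T * (p * t))) with (p ^ 2 * (T ^ 2 * t ^ 2)) by ring.
  replace (q * r * (q * r)) with (r ^ 2 * q ^ 2) by ring.
  apply Rmult_le_compat; try lra. apply Rmult_le_pos; lra. }
replace (p * q * r * t) with (x * y) by (unfold x, y; ring).
assert (Ey : y = x - 1) by lra.
assert (Hy1 : Rabs y <= Rabs x + 1).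
{ rewrite Ey. apply Rle_trans with (1 := Rabs_triang _ _). rewrite Rabs_Ropp, Rabs_R1; lra. }
rewrite Rabs_mult. pose proof (Rabs_pos x). pose proof (Rabs_pos y).
assert ((T - 1) * Rabs x <= 1) by lra.
assert ((T - 1) * Rabs y <= T) by nra.
replace (Rabs x * Rabs y * (T - 1) ^ 2) with ((T - 1) * Rabs x * ((T - 1) * Rabs y)) by ring.
replace T with (1 * T) at 3 by ring.
apply Rmult_le_compat; auto; apply Rmult_le_pos; lra.
Qed.

Lemma small_mul (z T : R) : 0 <= z -> 10 <= T -> z * (T - 1) ^ 2 <= T -> z * T <= 3.
Proof.
intros Hz HT H. assert (H2 : 1 / 3 * T ^ 2 <= (T - 1) ^ 2) by nra.
apply Rmult_le_compat_l with (r := z) in H2; auto.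
apply Rmult_le_reg_r with T; lra.
Qed.

Lemma sub_inv_sq (l : R) : l ^ 2 > 1 -> 0 < (l - / l) ^ 2 <= l ^ 2.
Proof.
intros Hl; destruct (inv_gt1 l Hl) as [Hl0 Hk]. split; [now apply sq_pos|].
assert (E : l * / l = 1) by (field; auto).
assert (H : (/ l) ^ 2 * l ^ 2 = 1) by (field; auto).
assert (0 < (/ l) ^ 2) by (apply sq_pos; now apply Rinv_neq_0_compat).
assert ((/ l) ^ 2 < 1) by nra. lra.
Qed.

(** U^-1 carries the axis of [a] to (0, oo), and U^-1 h brings to standard position the translate by
    h^-1 of the gate on that axis starting at U i. *)
Definition gates (G : Mat2 -> Prop) (U H : Mat2) : Prop :=
  exists h, G h /\ H = minv U ** h.

Section Gates.
Context (G : Mat2 -> Prop) (HG : surface_group G).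
Context (e : R) (He0 : 0 < e) (He1 : e <= 1)
  (Hgap : forall g, G g -> ~ eqpm g mI -> mtr g ^ 2 >= 4 + e).
Context (a U : Mat2) (l : R) (Ga : G a) (HU : mdet U = 1) (Hl : l ^ 2 > 1)
  (Ea : a = U ** dg l ** minv U).
Context (T : R) (HT : 10 <= T).

Lemma gates_det H : gates G U H -> mdet H = 1.
Proof.
intros (h & Gh & ->). apply mdet_mul1; [now rewrite mdet_inv | now apply (sg_det G HG)].
Qed.

Lemma gates_mul g : G g -> forall H, gates G U (H ** g) <-> gates G U H.
Proof.
intros Gg H. pose proof (sg_det G HG g Gg) as dg'. split; intros (h & Gh & E).
- exists (h ** minv g); split; [grp HG|].
  now rewrite mmulA, <- E, mmulKV.
- exists (h ** g); split; [grp HG|]. now rewrite E, !mmulA.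
Qed.

(** A chain has no repetition by [prec_irrefl], and its gates are of bounded norm by [gate_bounded],
    so discreteness bounds its length. *)
Lemma gates_finite p q : fpos p -> fpos q ->
  exists b, forall c, chain T (gates G U) p q c -> (length c <= b)%nat.
Proof.
intros Pp Pq. destruct (gate_bounded T p q HT Pp Pq) as (K & HK).
destruct (sg_discrete G HG (nrm U * K)) as (L & HL).
exists (length (map (fun h => minv U ** h) L)). intros c [O C].
apply NoDup_incl_length.
- apply FOP_NoDup with (2 := O). intros H HH. apply prec_irrefl; [lra|].
  now apply gates_det, C.
- intros H HH. destruct (C H HH) as (SH & L1 & H1).
  pose proof (gates_det H SH) as dH. pose proof (HK H dH L1 H1) as Hb.
  destruct SH as (h & Gh & EH). apply in_map_iff. exists h; split; auto.
  apply HL; auto.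
  assert (Eh : h = U ** H) by (rewrite EH, mmulA, mmulVr, mmul1l; auto).
  rewrite Eh. apply Rle_trans with (1 := nrm_mul U H).
  apply Rmult_le_compat_l; auto using nrm_ge0.
Qed.

Definition pt (W : Mat2) : Frm := act W fbase.

Lemma fpos_pt W : mdet W = 1 -> fpos (pt W).
Proof. intros; apply fpos_act; auto using fpos_base. Qed.

Lemma act_pow_axis (W : Mat2) (k : R) (n : nat) : mdet W = 1 -> k <> 0 ->
  act (mpow (W ** dg k ** minv W) n) (pt W) = act W (fr ((k ^ 2) ^ n) 0 (/ (k ^ 2) ^ n)).
Proof.
intros dW Hk. unfold pt. rewrite mpow_conj, dg_pow by auto.
rewrite <- act_mul, mmulVK, act_mul by auto. f_equal.
rewrite <- (pow_mult k), (Nat.mul_comm 2), pow_mult.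
assert (k ^ n <> 0) by now apply pow_nonzero.
apply frm_eq; simpl; field; auto.
Qed.

(** Gates N periods wide are placed along the axis every N + 1 periods; the spare period makes
    [prec] strict. *)
Lemma clen_axis_lower (N J m : nat) : T = (l ^ 2) ^ N -> ((J + 1) * (N + 1) <= m)%nat ->
  (J <= clen T (gates G U) (pt U) (act (mpow a m) (pt U)))%nat.
Proof.
intros EN Hm. destruct (inv_gt1 l Hl) as [Hl0 _].
set (L := l ^ 2) in *.
assert (LP : forall n, 0 < L ^ n) by (intros; apply pow_lt; lra).
set (h := fun j => minv U ** mpow (minv a) (j * (N + 1))).
assert (Eh : forall j X, act (h j) X =
   act (dg ((/ l) ^ (j * (N + 1)))) (act (minv U) X)).
{ intros j X. unfold h.
  assert (Einv : minv a = U ** dg (/ l) ** minv U).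
  { rewrite Ea, !minv_mul, minvK, dg_inv, mmulA; reflexivity. }
  rewrite Einv, mpow_conj, dg_pow by auto.
  rewrite !mmulA, mmulVl, mmul1l by auto. now rewrite act_mul. }
assert (Hx : forall j X, lo (h j) X <-> fx (act (minv U) X) < (L ^ (j * (N + 1))) ^ 2 * fz (act (minv U) X)).
{ intros j X; unfold lo; rewrite Eh. set (Y := act (minv U) X).
  set (n := (j * (N + 1))%nat). cbn [act fx fz m11 m12 m21 m22 dg].
  rewrite pow_inv, Rinv_inv.
  assert (En : l ^ n * l ^ n = L ^ n) by (unfold L; rewrite <- pow_mult; replace (2 * n)%nat with (n + n)%nat by lia; now rewrite pow_add).
  assert (Hln : l ^ n <> 0) by now apply pow_nonzero.
  replace ((/ l ^ n) ^ 2 * fx Y + 2 * / l ^ n * 0 * fy Y + 0 ^ 2 * fz Y) with (fx Y / L ^ n)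
    by (rewrite <- En; field; auto).
  replace (0 ^ 2 * fx Y + 2 * 0 * l ^ n * fy Y + (l ^ n) ^ 2 * fz Y) with (L ^ n * fz Y)
    by (rewrite <- En; ring).
  pose proof (LP n) as Hn. split; intros H.
  - apply Rmult_lt_compat_l with (r := L ^ n) in H; auto.
    replace (L ^ n * (fx Y / L ^ n)) with (fx Y) in H by (field; lra). lra.
  - apply Rmult_lt_reg_l with (L ^ n); auto.
    replace (L ^ n * (fx Y / L ^ n)) with (fx Y) by (field; lra). lra. }
assert (Hy : forall j X, hi T (h j) X <->
   fx (act (minv U) X) > (T * L ^ (j * (N + 1))) ^ 2 * fz (act (minv U) X)).
{ intros j X; unfold hi; rewrite Eh. set (Y := act (minv U) X).
  set (n := (j * (N + 1))%nat). cbn [act fx fz m11 m12 m21 m22 dg].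
  rewrite pow_inv, Rinv_inv.
  assert (En : l ^ n * l ^ n = L ^ n) by (unfold L; rewrite <- pow_mult; replace (2 * n)%nat with (n + n)%nat by lia; now rewrite pow_add).
  assert (Hln : l ^ n <> 0) by now apply pow_nonzero.
  replace ((/ l ^ n) ^ 2 * fx Y + 2 * / l ^ n * 0 * fy Y + 0 ^ 2 * fz Y) with (fx Y / L ^ n)
    by (rewrite <- En; field; auto).
  replace (0 ^ 2 * fx Y + 2 * 0 * l ^ n * fy Y + (l ^ n) ^ 2 * fz Y) with (L ^ n * fz Y)
    by (rewrite <- En; ring).
  pose proof (LP n) as Hn. split; intros H.
  - apply Rmult_gt_compat_l with (r := L ^ n) in H; auto.
    replace (L ^ n * (fx Y / L ^ n)) with (fx Y) in H by (field; lra). lra.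
  - apply Rmult_lt_reg_l with (L ^ n); auto.
    replace (L ^ n * (fx Y / L ^ n)) with (fx Y) by (field; lra). lra. }
assert (Hmono : forall i j, (i <= j)%nat -> L ^ i <= L ^ j) by (intros; apply Rle_pow; auto; lra).
(* The index starts at 1, because the starting point U i lies on the boundary of gate 0. *)
set (c := map (fun j => h (S j)) (seq 0 J)).
replace J with (length c) by (unfold c; now rewrite length_map, length_seq).
apply clen_ge.
{ intros p q; apply gates_finite. }
{ now apply fpos_pt. }
{ apply fpos_act; [apply mdet_pow, (sg_det G HG); auto | now apply fpos_pt]. }
split.
- unfold c. generalize 0%nat as s. clear Hm c. induction J as [|J' IH]; intros s; simpl; constructor; auto.
  apply Forall_forall. intros y Hy'. apply in_map_iff in Hy' as (j & <- & Hj).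
  apply in_seq in Hj. intros X PX HX. rewrite Hx. rewrite Hy in HX.
  assert (PY : fpos (act (minv U) X)) by (apply fpos_act; auto; now rewrite mdet_inv).
  destruct PY as (_ & Z & _).
  assert (Hlt : T * L ^ (S s * (N + 1)) < L ^ (S j * (N + 1))).
  { rewrite EN, <- pow_add. apply Rlt_pow; [lra|]. nia. }
  assert (0 < T * L ^ (S s * (N + 1))) by (apply Rmult_lt_0_compat; auto; lra).
  apply Rnot_gt_le in HX. apply Rle_lt_trans with (1 := HX).
  apply Rmult_lt_compat_r; auto. nra.
- intros H HH. apply in_map_iff in HH as (j & <- & Hj). apply in_seq in Hj.
  split; [|split].
  + exists (mpow (minv a) (S j * (N + 1))); split; auto. grp HG.
  + apply Hx. unfold pt. rewrite act_V by auto. simpl fx; simpl fz.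
    assert (1 < L ^ (S j * (N + 1))) by (apply Rlt_pow_R1; [lra | nia]). nra.
  + apply Hy. rewrite Ea, act_pow_axis, act_V by auto. fold L. cbn [fx fz].
    assert (Hlt : T * L ^ (S j * (N + 1)) < L ^ m).
    { rewrite EN, <- pow_add. apply Rlt_pow; [lra|]. nia. }
    assert (0 < T * L ^ (S j * (N + 1))) by (apply Rmult_lt_0_compat; auto; lra).
    apply Rmult_gt_reg_l with (L ^ m); auto.
    replace (L ^ m * ((T * L ^ (S j * (N + 1))) ^ 2 * / L ^ m)) with
      ((T * L ^ (S j * (N + 1))) ^ 2) by (field; specialize (LP m); lra). nra.
Qed.

(* A gate crossed backwards by its own axis would be a near-flip of that axis. *)
Lemma clen_axis_back (m : nat) : 3 * (l ^ 2) ^ 2 < e / 5 * T ->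
  clen T (gates G U) (act (mpow a m) (pt U)) (pt U) = 0%nat.
Proof.
intros Hbig. destruct (inv_gt1 l Hl) as [Hl0 _].
assert (P1 : fpos (pt U)) by now apply fpos_pt.
assert (P2 : fpos (act (mpow a m) (pt U))).
{ apply fpos_act; auto. apply mdet_pow, (sg_det G HG); auto. }
apply Nat.le_0_r. apply clen_le; auto.
{ intros p q; apply gates_finite. }
intros [|H c] [_ C]; [simpl; lia|]. exfalso.
destruct (C H) as ((h & Gh & ->) & Lo & Hi); [now left|].
rewrite Ea, act_pow_axis in Lo by auto. unfold pt, lo, hi in *.
rewrite <- act_mul in Lo, Hi. fold (cd U h) in Lo, Hi.
pose proof (mdet_cd G HG U HU h Gh) as Hd.
assert (Hs : 1 <= (l ^ 2) ^ m) by (apply pow_R1_Rle; lra).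
set (s := (l ^ 2) ^ m) in *.
assert (Hsi : s * / s = 1) by (field; lra).
unfold act, fbase in Lo, Hi; cbn [fx fy fz] in Lo, Hi. unfold mdet in Hd.
set (p := m11 (cd U h)) in *. set (q := m12 (cd U h)) in *.
set (r := m21 (cd U h)) in *. set (t := m22 (cd U h)) in *.
destruct (flip_entries T s p q r t) as (F1 & F2 & F3); try lra.
destruct (sep_diag G HG e He0 He1 Hgap a U l Ga HU Hl Ea h Gh) as [E1 E2].
- fold p q r t. pose proof (Rabs_pos (p * q * r * t)) as Hz.
  set (z := Rabs (p * q * r * t)) in *.
  assert (Hll : (l - / l) ^ 4 <= (l ^ 2) ^ 2).
  { replace ((l - / l) ^ 4) with (((l - / l) ^ 2) ^ 2) by ring.
    apply pow_incr. pose proof (sub_inv_sq l Hl). lra. }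
  assert (Hz3 : z * T <= 3) by (apply small_mul; auto).
  apply Rle_lt_trans with (z * (l ^ 2) ^ 2); [now apply Rmult_le_compat_l|].
  apply Rmult_lt_reg_l with T; [lra|].
  apply Rle_lt_trans with (3 * (l ^ 2) ^ 2); [|lra].
  replace (T * (z * (l ^ 2) ^ 2)) with (z * T * (l ^ 2) ^ 2) by ring.
  apply Rmult_le_compat_r; [apply pow2_ge_0 | auto].
(* A diagonal matrix has q = 0, whereas a flip has T |t| < |q|. *)
- fold q in E1. rewrite E1 in F2. pose proof (pow2_ge_0 t). nra.
Qed.

End Gates.

(** * Crossings inside a strip *)

(* The columns of [Z] are the attracting and repelling ends of a geodesic that runs
   through the whole strip. *)
Definition through (T : R) (Z : Mat2) : Prop :=
  m12 Z ^ 2 < m22 Z ^ 2 /\ T ^ 2 * m21 Z ^ 2 < m11 Z ^ 2.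

(** The last two inequalities locate the entrance: the geodesic meets the first side of the strip at
    the parameter whose square is (m22^2 - m12^2) / (m11^2 - m21^2), and this parameter lies
    strictly between 1 and s. *)
Lemma gate_entries (T s : R) (Z : Mat2) : 1 <= T -> 1 <= s ->
  lo Z fbase -> hi T Z (fr s 0 (/ s)) ->
  through T Z /\ m11 Z ^ 2 - m21 Z ^ 2 < m22 Z ^ 2 - m12 Z ^ 2 /\
  m22 Z ^ 2 - m12 Z ^ 2 < s ^ 2 * (m11 Z ^ 2 - m21 Z ^ 2).
Proof.
intros HT Hs H1 H2.
unfold lo, hi, act, fbase, through in *; cbn [fx fy fz] in *.
set (p := m11 Z ^ 2) in *. set (q := m12 Z ^ 2) in *.
set (r := m21 Z ^ 2) in *. set (t := m22 Z ^ 2) in *.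
assert (P : 0 <= p) by apply pow2_ge_0. assert (Q : 0 <= q) by apply pow2_ge_0.
assert (R0 : 0 <= r) by apply pow2_ge_0. assert (T0 : 0 <= t) by apply pow2_ge_0.
assert (H3 : T ^ 2 * t - q < s ^ 2 * (p - T ^ 2 * r)).
{ apply Rmult_gt_compat_l with (r := s) in H2; [|lra].
  replace (s * (p * s + 2 * m11 Z * m12 Z * 0 + q * / s)) with (s ^ 2 * p + q) in H2 by (field; lra).
  replace (s * (T ^ 2 * (r * s + 2 * m21 Z * m22 Z * 0 + t * / s))) with
    (T ^ 2 * (s ^ 2 * r + t)) in H2 by (field; lra). lra. }
clear H2. assert (H1' : p + q < r + t) by lra. clear H1.
assert (HT2 : 1 <= T ^ 2) by nra. assert (Hs2 : 1 <= s ^ 2) by nra.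
set (u := T ^ 2) in *. set (v := s ^ 2) in *. clearbody p q r t u v.
assert (A : q < t).
{ apply Rnot_le_lt; intros HN.
  assert (p - u * r <= 0) by nra. assert (v * (p - u * r) <= p - u * r) by nra. nra. }
assert (t <= u * t) by nra. assert (r <= u * r) by nra.
assert (B : u * r < p).
{ apply Rnot_le_lt; intros HN. assert (v * (p - u * r) <= 0) by nra. lra. }
repeat split; auto; try lra.
apply Rle_lt_trans with (u * t - q); [lra|]. apply Rlt_le_trans with (1 := H3).
apply Rmult_le_compat_l; lra.
Qed.

(* In the coordinate z / sqrt T, which puts the middle of the strip at |z| = 1, all
   entries of [A] have comparable size, and [A] moves the axis to a crossing one. *)
Definition wide (K T : R) (A : Mat2) : Prop :=
  / K <= m11 A ^ 2 <= K /\ / K <= m22 A ^ 2 <= K /\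
  T / K <= m12 A ^ 2 <= K * T /\ / (K * T) <= m21 A ^ 2 <= K / T /\
  m11 A * m12 A * m21 A * m22 A < 0.

Lemma wide_inv (K T : R) (A : Mat2) : wide K T A -> wide K T (minv A).
Proof.
unfold wide; simpl m11; simpl m12; simpl m21; simpl m22; intros (H1 & H2 & H3 & H4 & H5).
replace ((- m12 A) ^ 2) with (m12 A ^ 2) by ring.
replace ((- m21 A) ^ 2) with (m21 A ^ 2) by ring.
repeat split; try apply H1; try apply H2; try apply H3; try apply H4. lra.
Qed.

Lemma dominated (x y : R) : 4 * x ^ 2 <= y ^ 2 ->
  y ^ 2 <= 4 * (x + y) ^ 2 /\ 4 * (x + y) ^ 2 <= 9 * y ^ 2 /\ y ^ 2 <= 2 * ((x + y) * y).
Proof.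
intros H.
assert (Hxy : - Rabs y <= 2 * x <= Rabs y).
{ assert (Hr : Rabs (2 * x) <= Rabs y) by (apply Rsqr_le_abs_0; unfold Rsqr; lra).
  pose proof (Rle_abs (2 * x)). pose proof (Rle_abs (- (2 * x))) as Hn.
  rewrite Rabs_Ropp in Hn. lra. }
unfold Rabs in Hxy; destruct (Rcase_abs y); repeat split; nra.
Qed.

Lemma neg_mul (x y : R) : x < 0 -> 0 < y -> x * y < 0.
Proof. intros; nra. Qed.

Lemma neg_factor (x y : R) : 0 < x * y -> y < 0 -> x < 0.
Proof. intros; nra. Qed.

Lemma dom_sign (x y : R) : x ^ 2 < y ^ 2 -> 0 < (y - x) * y.
Proof. intros H. pose proof (pow2_ge_0 (y - x)). lra. Qed.

(** The boundary point u/v is opposite the middle of the strip: |u/v|^2 is within a factor W of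
    T. *)
Definition windowed (W T u v : R) : Prop :=
  0 < v ^ 2 /\ T / W * v ^ 2 <= u ^ 2 /\ u ^ 2 <= T * W * v ^ 2.

(** A perturbation by at most half changes each coordinate by a factor between 1/2 and 3/2, hence
    the squared ratio by at most 9. *)
Lemma window_vec (K T a b x y : R) : 1 <= K -> 0 < T -> y <> 0 ->
  T / K <= b ^ 2 / a ^ 2 -> a <> 0 -> b ^ 2 / a ^ 2 <= T * K ->
  forall c d, 4 * c ^ 2 <= (b * y) ^ 2 -> 4 * d ^ 2 <= (a * y) ^ 2 ->
  windowed (9 * K) T (c + b * y) (d + a * y).
Proof.
intros HK HT Hy H1 Ha H2 c d Hc Hd.
destruct (dominated _ _ Hc) as (C1 & C2 & _). destruct (dominated _ _ Hd) as (D1 & D2 & _).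
assert (Ha2 : 0 < a ^ 2) by now apply sq_pos.
assert (Hy2 : 0 < y ^ 2) by now apply sq_pos.
assert (Hay : 0 < (a * y) ^ 2) by (rewrite Rpow_mult_distr; now apply Rmult_lt_0_compat).
apply Rmult_le_compat_r with (r := (a * y) ^ 2) in H1; [|lra].
apply Rmult_le_compat_r with (r := (a * y) ^ 2) in H2; [|lra].
replace (b ^ 2 / a ^ 2 * (a * y) ^ 2) with ((b * y) ^ 2) in H1, H2 by (field; auto).
assert (Hq : 0 < T / K) by (apply Rdiv_lt_0_compat; lra).
assert (HTK : 0 < T * K) by (apply Rmult_lt_0_compat; lra).
split; [lra|split].
- replace (T / (9 * K)) with (T / K / 9) by (field; lra).
  assert (T / K * (4 * (d + a * y) ^ 2) <= T / K * (9 * (a * y) ^ 2)) by (apply Rmult_le_compat_l; lra).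
  lra.
- assert (T * K * (a * y) ^ 2 <= T * K * (4 * (d + a * y) ^ 2)) by (apply Rmult_le_compat_l; lra).
  lra.
Qed.

(** The ends of a geodesic through the strip are so close to oo and 0 that A sends them close to A
    oo and A 0, the ends of the moved axis. These lie in the window, on opposite sides of 0. *)
Lemma window_cols (K T : R) (A Z : Mat2) : 1 <= K -> 4 * K ^ 2 <= T ->
  wide K T A -> through T Z ->
  windowed (9 * K ^ 2) T (m11 (A ** Z)) (m21 (A ** Z)) /\
  windowed (9 * K ^ 2) T (m12 (A ** Z)) (m22 (A ** Z)) /\
  m11 (A ** Z) * m12 (A ** Z) * m21 (A ** Z) * m22 (A ** Z) < 0.
Proof.
intros HK HT ((P1 & P2) & (S1 & S2) & (Q1 & Q2) & (R1 & R2) & Hneg) (Z1 & Z2).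
destruct A as [p q r s], Z as [a b c d]; simpl m11 in *; simpl m12 in *; simpl m21 in *; simpl m22 in *.
assert (HT4 : 4 <= T) by (clear - HK HT; nra).
assert (HKi : 0 < / K) by (apply Rinv_0_lt_compat; lra).
assert (HTi : 0 < / T) by (apply Rinv_0_lt_compat; lra).
assert (HKK : K * / K = 1) by (field; lra).
assert (HTT : T * / T = 1) by (field; lra).
assert (Hp : p <> 0) by (intros ->; lra). assert (Hs : s <> 0) by (intros ->; lra).
assert (Hq : q <> 0) by (intros ->; lra). assert (Hr : r <> 0) by (intros ->; lra).
assert (Hd : d <> 0) by (intros ->; pose proof (pow2_ge_0 b); lra).
assert (Ha : a <> 0) 
  by (intros ->; pose proof (Rmult_le_pos _ _ (pow2_ge_0 T) (pow2_ge_0 c)); lra).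
assert (Hd2 : 0 < d ^ 2) by now apply sq_pos. assert (Ha2 : 0 < a ^ 2) by now apply sq_pos.
assert (Hp2 : 0 < p ^ 2) by now apply sq_pos. assert (Hs2 : 0 < s ^ 2) by now apply sq_pos.
assert (Hr2 : 0 < r ^ 2) by now apply sq_pos. assert (Hq2 : 0 < q ^ 2) by now apply sq_pos.
assert (B1 : 4 * p ^ 2 <= q ^ 2).
{ apply Rle_trans with (T / K); [|lra]. apply Rmult_le_reg_l with K; [lra|].
  replace (K * (T / K)) with T by (field; lra).
  apply Rle_trans with (4 * (K * K)); [|lra].
  assert (K * p ^ 2 <= K * K) by (apply Rmult_le_compat_l; lra). lra. }
assert (B2 : 4 * r ^ 2 <= s ^ 2).
{ apply Rle_trans with (4 * (K / T)); [lra|]. apply Rle_trans with (/ K); [|lra].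
  apply Rmult_le_reg_l with (K * T); [apply Rmult_lt_0_compat; lra|].
  replace (K * T * (4 * (K / T))) with (4 * K ^ 2) by (field; lra).
  replace (K * T * / K) with T by (field; lra). auto. }
assert (B3 : 4 * q ^ 2 <= T ^ 2 * p ^ 2).
{ apply Rle_trans with (4 * (K * T)); [lra|]. apply Rle_trans with (T ^ 2 * / K);
   [|apply Rmult_le_compat_l; [apply pow2_ge_0 | lra]].
  apply Rmult_le_reg_l with K; [lra|].
  replace (K * (T ^ 2 * / K)) with (T * T) by (field; lra).
  assert (4 * K ^ 2 * T <= T * T) by (apply Rmult_le_compat_r; lra). lra. }
assert (B4 : 4 * s ^ 2 <= T ^ 2 * r ^ 2).
{ apply Rle_trans with (4 * K); [lra|]. apply Rle_trans with (T ^ 2 * / (K * T));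
   [|apply Rmult_le_compat_l; [apply pow2_ge_0 | lra]].
  apply Rmult_le_reg_l with K; [lra|].
  replace (K * (T ^ 2 * / (K * T))) with T by (field; lra). lra. }
assert (C1 : 4 * (p * b) ^ 2 <= (q * d) ^ 2).
{ rewrite !Rpow_mult_distr. replace (4 * (p ^ 2 * b ^ 2)) with (4 * p ^ 2 * b ^ 2) by ring.
  apply Rmult_le_compat; try lra. apply pow2_ge_0. }
assert (C2 : 4 * (r * b) ^ 2 <= (s * d) ^ 2).
{ rewrite !Rpow_mult_distr. replace (4 * (r ^ 2 * b ^ 2)) with (4 * r ^ 2 * b ^ 2) by ring.
  apply Rmult_le_compat; try lra. apply pow2_ge_0. }
assert (C3 : 4 * (q * c) ^ 2 <= (p * a) ^ 2).
{ rewrite !Rpow_mult_distr. pose proof (pow2_ge_0 c).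
  apply Rle_trans with (T ^ 2 * p ^ 2 * c ^ 2).
  - replace (4 * (q ^ 2 * c ^ 2)) with (4 * q ^ 2 * c ^ 2) by ring. now apply Rmult_le_compat_r.
  - replace (T ^ 2 * p ^ 2 * c ^ 2) with (p ^ 2 * (T ^ 2 * c ^ 2)) by ring.
    apply Rmult_le_compat_l; lra. }
assert (C4 : 4 * (s * c) ^ 2 <= (r * a) ^ 2).
{ rewrite !Rpow_mult_distr. pose proof (pow2_ge_0 c).
  apply Rle_trans with (T ^ 2 * r ^ 2 * c ^ 2).
  - replace (4 * (s ^ 2 * c ^ 2)) with (4 * s ^ 2 * c ^ 2) by ring. now apply Rmult_le_compat_r.
  - replace (T ^ 2 * r ^ 2 * c ^ 2) with (r ^ 2 * (T ^ 2 * c ^ 2)) by ring.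
    apply Rmult_le_compat_l; lra. }
assert (HK2 : 1 <= K ^ 2) by (clear - HK; nra).
split; [|split].
- replace (p * a + q * c) with (q * c + p * a) by ring.
  replace (r * a + s * c) with (s * c + r * a) by ring.
  apply window_vec; auto; try lra.
  + apply Rmult_le_reg_r with (r ^ 2); auto.
    replace (p ^ 2 / r ^ 2 * r ^ 2) with (p ^ 2) by (field; auto).
    apply Rle_trans with (T / K ^ 2 * (K / T)).
    * apply Rmult_le_compat_l; auto. apply Rlt_le, Rdiv_lt_0_compat; lra.
    * replace (T / K ^ 2 * (K / T)) with (/ K) by (field; lra). auto.
  + apply Rmult_le_reg_r with (r ^ 2); auto.
    replace (p ^ 2 / r ^ 2 * r ^ 2) with (p ^ 2) by (field; auto).
    apply Rle_trans with K; auto.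
    replace K with (T * K ^ 2 * / (K * T)) at 1 by (field; lra).
    apply Rmult_le_compat_l; auto. apply Rmult_le_pos; lra.
- apply window_vec; auto; try lra.
  + apply Rmult_le_reg_r with (s ^ 2); auto.
    replace (q ^ 2 / s ^ 2 * s ^ 2) with (q ^ 2) by (field; auto).
    apply Rle_trans with (T / K ^ 2 * K).
    * apply Rmult_le_compat_l; auto. apply Rlt_le, Rdiv_lt_0_compat; lra.
    * replace (T / K ^ 2 * K) with (T / K) by (field; lra). auto.
  + apply Rmult_le_reg_r with (s ^ 2); auto.
    replace (q ^ 2 / s ^ 2 * s ^ 2) with (q ^ 2) by (field; auto).
    apply Rle_trans with (K * T); auto.
    replace (K * T) with (T * K ^ 2 * / K) by (field; lra).
    apply Rmult_le_compat_l; auto. apply Rmult_le_pos; lra.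
- destruct (dominated _ _ C1) as (_ & _ & D1). destruct (dominated _ _ C2) as (_ & _ & D2).
  destruct (dominated _ _ C3) as (_ & _ & D3). destruct (dominated _ _ C4) as (_ & _ & D4).
  assert (0 < (q * d) ^ 2) by (rewrite Rpow_mult_distr; now apply Rmult_lt_0_compat).
  assert (0 < (s * d) ^ 2) by (rewrite Rpow_mult_distr; now apply Rmult_lt_0_compat).
  assert (0 < (p * a) ^ 2) by (rewrite Rpow_mult_distr; now apply Rmult_lt_0_compat).
  assert (0 < (r * a) ^ 2) by (rewrite Rpow_mult_distr; now apply Rmult_lt_0_compat).
  set (x1 := q * c + p * a) in *. set (x2 := p * b + q * d) in *.
  set (x3 := s * c + r * a) in *. set (x4 := r * b + s * d) in *.
  replace (p * a + q * c) with x1 by (unfold x1; ring).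
  replace (r * a + s * c) with x3 by (unfold x3; ring).
  assert (Hpos : 0 < (x1 * (p * a)) * (x2 * (q * d)) * ((x3 * (r * a)) * (x4 * (s * d)))).
  { apply Rmult_lt_0_compat; apply Rmult_lt_0_compat; lra. }
  replace (x1 * (p * a) * (x2 * (q * d)) * (x3 * (r * a) * (x4 * (s * d)))) with
    ((x1 * x2 * x3 * x4) * ((p * q * r * s) * (a ^ 2 * d ^ 2))) in Hpos by ring.
  assert (p * q * r * s * (a ^ 2 * d ^ 2) < 0).
  { apply neg_mul; auto. now apply Rmult_lt_0_compat. }
  now apply neg_factor in Hpos.
Qed.

(** One end of N has modulus below 1 and the other above T, with both ends of M in between. Each
    entry of N^-1 M thus has the sign of its dominant term, and the four signs multiply to that of
    the entries of M. *)
Lemma linked_sign (W T : R) (N M : Mat2) : 1 <= W -> W < T -> through T N ->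
  windowed W T (m11 M) (m21 M) -> windowed W T (m12 M) (m22 M) ->
  m11 M * m12 M * m21 M * m22 M < 0 ->
  let X := minv N ** M in m11 X * m12 X * m21 X * m22 X < 0.
Proof.
intros HW HT (N1 & N2) (V1 & A1 & A1') (V2 & A2 & A2') Hneg X.
unfold X; destruct N as [a b c d], M as [p q r s];
 simpl m11 in *; simpl m12 in *; simpl m21 in *; simpl m22 in *.
assert (H1 : 1 < T / W).
{ apply Rmult_lt_reg_r with W; [lra|]. replace (T / W * W) with T by (field; lra). lra. }
assert (p2 : r ^ 2 < p ^ 2) by (clear - H1 V1 A1; nra).
assert (q2 : s ^ 2 < q ^ 2) by (clear - H1 V2 A2; nra).
pose proof (pow2_ge_0 a). pose proof (pow2_ge_0 b). pose proof (pow2_ge_0 c). pose proof (pow2_ge_0 d).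
assert (Hup : forall u v, 0 < v ^ 2 -> u ^ 2 <= T * W * v ^ 2 -> (c * u) ^ 2 < (a * v) ^ 2).
{ intros u v Hv Hu. rewrite !Rpow_mult_distr.
  apply Rle_lt_trans with (c ^ 2 * (T ^ 2 * v ^ 2)).
  - apply Rmult_le_compat_l; auto. apply Rle_trans with (1 := Hu).
    apply Rmult_le_compat_r; [lra|]. clear - HW HT; nra.
  - replace (c ^ 2 * (T ^ 2 * v ^ 2)) with (T ^ 2 * c ^ 2 * v ^ 2) by ring.
    now apply Rmult_lt_compat_r. }
assert (Hdn : forall u v, 0 < v ^ 2 -> v ^ 2 < u ^ 2 -> (b * v) ^ 2 < (d * u) ^ 2).
{ intros u v Hv Hu. rewrite !Rpow_mult_distr. apply Rmult_le_0_lt_compat; lra. }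
pose proof (dom_sign _ _ (Hdn p r V1 p2)) as E1.
pose proof (dom_sign _ _ (Hdn q s V2 q2)) as E2.
pose proof (dom_sign _ _ (Hup p r V1 A1')) as E3.
pose proof (dom_sign _ _ (Hup q s V2 A2')) as E4.
replace (d * p + - b * r) with (d * p - b * r) by ring.
replace (d * q + - b * s) with (d * q - b * s) by ring.
replace (- c * p + a * r) with (a * r - c * p) by ring.
replace (- c * q + a * s) with (a * s - c * q) by ring.
set (x1 := d * p - b * r) in *. set (x2 := d * q - b * s) in *.
set (x3 := a * r - c * p) in *. set (x4 := a * s - c * q) in *.
assert (Hpos : 0 < (x1 * (d * p)) * (x2 * (d * q)) * ((x3 * (a * r)) * (x4 * (a * s)))).
{ apply Rmult_lt_0_compat; apply Rmult_lt_0_compat; lra. }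
replace (x1 * (d * p) * (x2 * (d * q)) * (x3 * (a * r) * (x4 * (a * s)))) with
  ((x1 * x2 * x3 * x4) * ((p * q * r * s) * (a ^ 2 * d ^ 2))) in Hpos by ring.
assert (0 < a ^ 2)
  by (pose proof (Rmult_le_pos _ _ (pow2_ge_0 T) (pow2_ge_0 c)); lra).
assert (0 < d ^ 2) by lra.
assert (p * q * r * s * (a ^ 2 * d ^ 2) < 0).
{ apply neg_mul; auto. now apply Rmult_lt_0_compat. }
now apply neg_factor in Hpos.
Qed.

Definition fwindow (W T : R) (X : Frm) : Prop := T / W * fz X <= fx X <= T * W * fz X.

Lemma abs_cross (x y : R) : x * y < 0 -> x * Rabs y + y * Rabs x = 0.
Proof. intros H; unfold Rabs; destruct (Rcase_abs x), (Rcase_abs y); nra. Qed.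

(* The common point of two crossing geodesics. *)
Lemma crossing_point (N M : Mat2) : mdet N = 1 -> mdet M = 1 ->
  (let X := minv N ** M in m11 X * m12 X * m21 X * m22 X < 0) ->
  exists x y u v, 0 < x /\ 0 < y /\ 0 < u /\ 0 < v /\
    act M (fr x 0 y) = act N (fr u 0 v).
Proof.
intros dN dM H. cbv zeta in H. set (X := minv N ** M) in *.
assert (EM : M = N ** X) by (unfold X; rewrite mmulA, mmulVr, mmul1l; auto).
(* These weights make [fy] of the image under X vanish, which puts the point on the axis of N. *)
set (x := Rabs (m12 X * m22 X)). set (y := Rabs (m11 X * m21 X)).
assert (HX : m11 X * m21 X * (m12 X * m22 X) < 0) by lra.
assert (Hx : m12 X * m22 X <> 0) by (intros E; rewrite E in HX; lra).
assert (Hy : m11 X * m21 X <> 0) by (intros E; rewrite E in HX; lra).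
assert (x0 : 0 < x) by now apply Rabs_pos_lt. assert (y0 : 0 < y) by now apply Rabs_pos_lt.
exists x, y, (fx (act X (fr x 0 y))), (fz (act X (fr x 0 y))).
assert (n1 : m11 X <> 0) by (intros E; rewrite E in Hy; lra).
assert (n2 : m12 X <> 0) by (intros E; rewrite E in Hx; lra).
assert (n3 : m21 X <> 0) by (intros E; rewrite E in Hy; lra).
assert (n4 : m22 X <> 0) by (intros E; rewrite E in Hx; lra).
apply sq_pos in n1, n2, n3, n4.
repeat split; auto.
- cbn [act fx fy fz].
  pose proof (Rmult_lt_0_compat _ _ n1 x0). pose proof (Rmult_lt_0_compat _ _ n2 y0). lra.
- cbn [act fx fy fz].
  pose proof (Rmult_lt_0_compat _ _ n3 x0). pose proof (Rmult_lt_0_compat _ _ n4 y0). lra.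
- rewrite EM at 1. rewrite act_mul. f_equal.
  apply frm_eq; try reflexivity. cbn [act fx fy fz].
  pose proof (abs_cross _ _ HX) as E; fold x y in E. lra.
Qed.

(** The coordinates [fx] and [fz] of a point of a geodesic are positive combinations of the squared
    coordinates of its two ends. *)
Lemma window_point (W T : R) (M : Mat2) (x y : R) : 0 < x -> 0 < y ->
  windowed W T (m11 M) (m21 M) -> windowed W T (m12 M) (m22 M) ->
  fwindow W T (act M (fr x 0 y)).
Proof.
intros Hx Hy (_ & A1 & A2) (_ & B1 & B2). unfold fwindow; cbn [act fx fy fz].
apply Rmult_le_compat_l with (r := x) in A1; [|lra].
apply Rmult_le_compat_l with (r := x) in A2; [|lra].
apply Rmult_le_compat_l with (r := y) in B1; [|lra].
apply Rmult_le_compat_l with (r := y) in B2; [|lra].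
split; lra.
Qed.

Lemma through_abs (T : R) (Z : Mat2) : 0 < T -> through T Z ->
  Rabs (m12 Z) <= Rabs (m22 Z) /\ T * Rabs (m21 Z) <= Rabs (m11 Z).
Proof.
intros HT (H1 & H2). split; [apply Rsqr_le_abs_0; unfold Rsqr; lra|].
rewrite <- (Rabs_right T) by lra. rewrite <- Rabs_mult.
apply Rsqr_le_abs_0; unfold Rsqr; lra.
Qed.

(** |m12 m21| is at most a tenth of |m11 m22|, and m11 m22 - m12 m21 = 1. *)
Lemma through_diag (T : R) (Z : Mat2) : 10 <= T -> mdet Z = 1 -> through T Z ->
  Rabs (m11 Z * m22 Z) <= 10 / 9.
Proof.
intros HT dZ HZ. destruct (through_abs T Z ltac:(lra) HZ) as (H1 & H2). unfold mdet in dZ.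
assert (H3 : T * Rabs (m12 Z * m21 Z) <= Rabs (m11 Z * m22 Z)).
{ rewrite !Rabs_mult. pose proof (Rabs_pos (m12 Z)). pose proof (Rabs_pos (m21 Z)).
  replace (T * (Rabs (m12 Z) * Rabs (m21 Z))) with (T * Rabs (m21 Z) * Rabs (m12 Z)) by ring.
  apply Rmult_le_compat; auto. apply Rmult_le_pos; lra. }
assert (H4 : Rabs (m11 Z * m22 Z) <= 1 + Rabs (m12 Z * m21 Z)).
{ replace (m11 Z * m22 Z) with (1 + m12 Z * m21 Z) by lra.
  apply Rle_trans with (1 := Rabs_triang _ _). rewrite Rabs_R1; lra. }
pose proof (Rabs_pos (m12 Z * m21 Z)). nra.
Qed.

(** In the window [fx] is essentially x m11^2 and [fz] essentially y m22^2; the other two terms are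
    absorbed at the cost of the factor 4/3. So the window determines the position on the geodesic up
    to a bounded factor. *)
Lemma fwindow_ratio (W T x y : R) (Z : Mat2) : 1 <= W -> 4 * W <= T -> 0 < x -> 0 < y ->
  through T Z -> fwindow W T (act Z (fr x 0 y)) ->
  3 * T * (y * m22 Z ^ 2) <= 4 * W * (x * m11 Z ^ 2) /\
  3 * (x * m11 Z ^ 2) <= 4 * T * W * (y * m22 Z ^ 2).
Proof.
intros HW HT Hx Hy (H1 & H2) (F1 & F2). cbn [act fx fy fz] in *.
set (a := m11 Z ^ 2) in *. set (b := m12 Z ^ 2) in *.
set (c := m21 Z ^ 2) in *. set (d := m22 Z ^ 2) in *.
assert (Hb : 0 <= b) by apply pow2_ge_0. assert (Hc : 0 <= c) by apply pow2_ge_0.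
assert (Hxa : T ^ 2 * (x * c) <= x * a).
{ replace (T ^ 2 * (x * c)) with (x * (T ^ 2 * c)) by ring. apply Rmult_le_compat_l; lra. }
assert (Hyb : y * b <= y * d) by (apply Rmult_le_compat_l; lra).
replace (a * x + 2 * m11 Z * m12 Z * 0 + b * y) with (x * a + y * b) in F1, F2 by ring.
replace (c * x + 2 * m21 Z * m22 Z * 0 + d * y) with (x * c + y * d) in F1, F2 by ring.
assert (Hxc : 0 <= x * c) by (apply Rmult_le_pos; lra).
assert (Hyd : 0 <= y * d) by (apply Rmult_le_pos; lra).
set (X := x * a) in *. set (Y := y * d) in *. set (C := x * c) in *.
apply Rmult_le_compat_l with (r := W) in F1; [|lra].
replace (W * (T / W * (C + Y))) with (T * C + T * Y) in F1 by (field; lra).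
assert (0 <= T * C) by (apply Rmult_le_pos; lra).
split.
- assert (W * (X + y * b) <= W * (X + Y)) by (apply Rmult_le_compat_l; lra).
  assert (4 * W * Y <= T * Y) by (apply Rmult_le_compat_r; lra). lra.
- assert (X + y * b <= T * W * C + T * W * Y) by lra.
  assert (0 <= y * b) by (apply Rmult_le_pos; lra).
  assert (HTC : 4 * (T * W * C) <= X).
  { apply Rle_trans with (2 := Hxa). replace (4 * (T * W * C)) with (T * C * (4 * W)) by ring.
    replace (T ^ 2 * C) with (T * C * T) by ring. apply Rmult_le_compat_l; lra. }
  lra.
Qed.

(** S carries one geodesic through the strip to another while a marked point stays in the window.
    With p = |a' d| and q = |d' a|, the product p q is bounded by [through_diag] and the ratio p/q
    by [fwindow_ratio], so p^2 and q^2 are at most 2 W. The off-diagonal entries of S are at most p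
    + q and (p + q)/T. *)
Lemma overlap_bound (W T x y : R) (N N' : Mat2) : 1 <= W -> 4 * W <= T -> 10 <= T ->
  0 < x -> 0 < y -> mdet N = 1 -> mdet N' = 1 -> through T N -> through T N' ->
  fwindow W T (act N (fr x 0 y)) -> fwindow W T (act N' (fr x 0 y)) ->
  let S := N' ** minv N in Rabs (m12 S * m21 S) * T <= 8 * W.
Proof.
intros HW HT HT0 Hx Hy dN dN' HN HN' F F' S.
destruct (fwindow_ratio _ _ _ _ _ HW HT Hx Hy HN F) as (A1 & A2).
destruct (fwindow_ratio _ _ _ _ _ HW HT Hx Hy HN' F') as (A1' & A2').
pose proof (through_diag _ _ HT0 dN HN) as D. pose proof (through_diag _ _ HT0 dN' HN') as D'.
destruct (through_abs T N ltac:(lra) HN) as (B1 & B2).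
destruct (through_abs T N' ltac:(lra) HN') as (B1' & B2').
unfold S; clear S; destruct N as [a b c d], N' as [a' b' c' d'].
simpl m11 in *; simpl m12 in *; simpl m21 in *; simpl m22 in *.
set (p := Rabs a' * Rabs d). set (q := Rabs d' * Rabs a).
pose proof (Rabs_pos a) as Pa. pose proof (Rabs_pos b) as Pb. pose proof (Rabs_pos c) as Pc.
pose proof (Rabs_pos d) as Pd. pose proof (Rabs_pos a') as Pa'. pose proof (Rabs_pos b') as Pb'.
pose proof (Rabs_pos c') as Pc'. pose proof (Rabs_pos d') as Pd'.
assert (Hp : 0 <= p) by now apply Rmult_le_pos. assert (Hq : 0 <= q) by now apply Rmult_le_pos.
assert (Hpq : p * q <= 100 / 81).
{ rewrite Rabs_mult in D, D'.
  replace (p * q) with (Rabs a * Rabs d * (Rabs a' * Rabs d')) by (unfold p, q; ring).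
  replace (100 / 81) with (10 / 9 * (10 / 9)) by field.
  apply Rmult_le_compat; auto; now apply Rmult_le_pos. }
assert (Hxy : 0 < x * y) by now apply Rmult_lt_0_compat.
assert (E1 : 9 * p ^ 2 <= 16 * W ^ 2 * q ^ 2).
{ unfold p, q. rewrite !Rpow_mult_distr, !pow2_abs.
  apply Rmult_le_reg_l with (T * (x * y)); [apply Rmult_lt_0_compat; lra|].
  replace (T * (x * y) * (9 * (a' ^ 2 * d ^ 2))) with
    ((3 * (x * a' ^ 2)) * (3 * T * (y * d ^ 2))) by ring.
  replace (T * (x * y) * (16 * W ^ 2 * (d' ^ 2 * a ^ 2))) with
    ((4 * T * W * (y * d' ^ 2)) * (4 * W * (x * a ^ 2))) by ring.
  apply Rmult_le_compat; auto.
  - apply Rmult_le_pos; [lra|]. apply Rmult_le_pos; [lra | apply pow2_ge_0].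
  - apply Rmult_le_pos; [lra|]. apply Rmult_le_pos; [lra | apply pow2_ge_0]. }
assert (E2 : 9 * q ^ 2 <= 16 * W ^ 2 * p ^ 2).
{ unfold p, q. rewrite !Rpow_mult_distr, !pow2_abs.
  apply Rmult_le_reg_l with (T * (x * y)); [apply Rmult_lt_0_compat; lra|].
  replace (T * (x * y) * (9 * (d' ^ 2 * a ^ 2))) with
    ((3 * (x * a ^ 2)) * (3 * T * (y * d' ^ 2))) by ring.
  replace (T * (x * y) * (16 * W ^ 2 * (a' ^ 2 * d ^ 2))) with
    ((4 * T * W * (y * d ^ 2)) * (4 * W * (x * a' ^ 2))) by ring.
  apply Rmult_le_compat; auto.
  - apply Rmult_le_pos; [lra|]. apply Rmult_le_pos; [lra | apply pow2_ge_0].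
  - apply Rmult_le_pos; [lra|]. apply Rmult_le_pos; [lra | apply pow2_ge_0]. }
assert (E1' : 3 * p <= 4 * W * q).
{ apply Rsqr_incr_0_var; [unfold Rsqr; lra|]. apply Rmult_le_pos; lra. }
assert (E2' : 3 * q <= 4 * W * p).
{ apply Rsqr_incr_0_var; [unfold Rsqr; lra|]. apply Rmult_le_pos; lra. }
assert (HWpq : W * (p * q) <= W * (100 / 81)) by (apply Rmult_le_compat_l; lra).
assert (P2 : p ^ 2 <= 2 * W).
{ apply Rmult_le_compat_l with (r := p) in E1'; auto. lra. }
assert (Q2 : q ^ 2 <= 2 * W).
{ apply Rmult_le_compat_l with (r := q) in E2'; auto. lra. }
assert (S12 : Rabs (a' * - b + b' * a) <= p + q).
{ apply Rle_trans with (1 := Rabs_triang _ _). rewrite !Rabs_mult, Rabs_Ropp.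
  unfold p, q. apply Rplus_le_compat; [apply Rmult_le_compat_l | apply Rmult_le_compat_r]; auto. }
assert (S21 : T * Rabs (c' * d + d' * - c) <= p + q).
{ apply Rle_trans with (T * (Rabs (c' * d) + Rabs (d' * - c))).
  - apply Rmult_le_compat_l; [lra | apply Rabs_triang].
  - rewrite !Rabs_mult, Rabs_Ropp. unfold p, q.
    replace (T * (Rabs c' * Rabs d + Rabs d' * Rabs c)) with
      (T * Rabs c' * Rabs d + Rabs d' * (T * Rabs c)) by ring.
    apply Rplus_le_compat; [apply Rmult_le_compat_r | apply Rmult_le_compat_l]; auto. }
rewrite Rabs_mult.
replace (Rabs (a' * - b + b' * a) * Rabs (c' * d + d' * - c) * T) with
  (Rabs (a' * - b + b' * a) * (T * Rabs (c' * d + d' * - c))) by ring.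
apply Rle_trans with ((p + q) * (p + q)).
- apply Rmult_le_compat; auto using Rabs_pos. apply Rmult_le_pos; [lra | apply Rabs_pos].
- pose proof (pow2_ge_0 (p - q)). lra.
Qed.

(** * Counting linked pairs *)

(** A double count with a relation instead of a map: an element may carry several labels. *)
Lemma fiber_bound {A B} (Q : A -> B -> Prop) (s : nat) (bs : list B) (l : list A) :
  NoDup l -> (forall x, In x l -> exists b, In b bs /\ Q x b) ->
  (forall b l', In b bs -> NoDup l' -> incl l' l -> (forall x, In x l' -> Q x b) ->
    (length l' <= s)%nat) ->
  (length l <= length bs * s)%nat.
Proof.
revert l; induction bs as [|b bs IH]; intros l ND Hex Hs.
- destruct l as [|x l]; [simpl; lia|]. destruct (Hex x) as (b & [] & _); now left.
- set (f := fun x => if excluded_middle_informative (Q x b) then true else false).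
  assert (Hf : forall x, f x = true <-> Q x b).
  { intros x; unfold f; destruct (excluded_middle_informative (Q x b)); split; easy. }
  rewrite <- (filter_length f l). simpl length at 3. rewrite Nat.mul_succ_l, Nat.add_comm.
  apply Nat.add_le_mono.
  + apply IH.
    * now apply NoDup_filter.
    * intros x Hx; apply filter_In in Hx as [Hx Hn].
      destruct (Hex x Hx) as (b' & [<-|Hb] & HQ); eauto.
      apply Hf in HQ; rewrite HQ in Hn; easy.
    * intros b' l' Hb ND' Hi HQ. apply (Hs b'); auto; [now right|].
      intros x Hx; apply Hi, filter_In in Hx; tauto.
  + apply (Hs b); auto; [now left | now apply NoDup_filter | |].
    * intros x Hx; apply filter_In in Hx; tauto.
    * intros x Hx; apply filter_In in Hx; now apply Hf.
Qed.

Lemma diag_dg (D : Mat2) : mdet D = 1 -> m12 D = 0 -> m21 D = 0 -> exists x, x <> 0 /\ D = dg x.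
Proof.
destruct D as [p q r s]; unfold mdet; simpl; intros dD -> ->.
assert (Hp : p <> 0) by (intros ->; lra). exists p; split; auto.
unfold dg; f_equal. apply Rmult_eq_reg_l with p; auto. rewrite Rinv_r; lra.
Qed.

Lemma NoDup_list_prod {A B} (l : list A) (l' : list B) :
  NoDup l -> NoDup l' -> NoDup (list_prod l l').
Proof.
intros H H'; induction H as [|x l Hx Hl IH]; simpl; [constructor|].
apply NoDup_app; auto.
- apply NoDup_map_NoDup_ForallPairs; auto. intros y z _ _ E; congruence.
- intros [u v] Hu Hv. apply in_map_iff in Hu as (w & E & _). apply in_prod_iff in Hv as [Hv _].
  congruence.
Qed.

Section Axes.
Context (G : Mat2 -> Prop) (HG : surface_group G).
Context (e : R) (He0 : 0 < e) (He1 : e <= 1)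
  (Hgap : forall g, G g -> ~ eqpm g mI -> mtr g ^ 2 >= 4 + e).
Context (b V : Mat2) (k : R) (Gb : G b) (Pb : Defs.primitive G b) (HV : mdet V = 1)
  (Hk : k ^ 2 > 1) (Eb : b = V ** dg k ** minv V).

(* [g1] and [g2] move the axis of [b] to the same geodesic. *)
Definition coaxial (g1 g2 : Mat2) : Prop :=
  m12 (cd V (minv g1 ** g2)) = 0 /\ m21 (cd V (minv g1 ** g2)) = 0.

Lemma coaxial_sym g1 g2 : coaxial g1 g2 -> coaxial g2 g1.
Proof.
unfold coaxial. replace (minv g2 ** g1) with (minv (minv g1 ** g2)).
- rewrite cd_inv. set (D := cd V _). clearbody D. simpl; lra.
- now rewrite minv_mul, minvK.
Qed.

Lemma coaxial_trans g1 g2 g3 : mdet g2 = 1 -> coaxial g1 g2 -> coaxial g2 g3 -> coaxial g1 g3.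
Proof.
unfold coaxial; intros d2 [A1 A2] [B1 B2].
replace (minv g1 ** g3) with ((minv g1 ** g2) ** (minv g2 ** g3)).
- rewrite cd_mul by auto. set (A := cd V (minv g1 ** g2)) in *.
  set (B := cd V (minv g2 ** g3)) in *. clearbody A B. simpl. rewrite A1, A2, B1, B2; lra.
- now rewrite !mmulA, mmulKV.
Qed.

Lemma coaxial_left s g1 g2 : mdet s = 1 -> coaxial (s ** g1) (s ** g2) <-> coaxial g1 g2.
Proof.
intros ds; unfold coaxial. rewrite minv_mul.
replace (minv g1 ** minv s ** (s ** g2)) with (minv g1 ** g2); [tauto|].
now rewrite !mmulA, mmulVK.
Qed.

Lemma coaxial_eqpm g1 g1' g2 : eqpm g1 g1' -> coaxial g1 g2 -> coaxial g1' g2.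
Proof.
intros [->| ->]; auto. unfold coaxial.
rewrite mneg_inv, mneg_mull, cd_neg. set (D := cd V _). clearbody D. simpl; lra.
Qed.

(** The other alternative of [same_axis_entries], an exchange of the two ends, would produce an
    element of G of trace 0. *)
Lemma same_axis_coaxial g1 g2 : G g1 -> G g2 ->
  same_axis (conj g1 b) (conj g2 b) -> coaxial g1 g2.
Proof.
intros G1 G2. rewrite Eb, !conj_conj. intros H.
apply same_axis_entries in H; auto.
2, 3: apply mdet_mul1; auto; now apply (sg_det G HG).
rewrite minv_mul in H.
replace (minv V ** minv g1 ** (g2 ** V)) with (cd V (minv g1 ** g2)) in H
  by (unfold cd; now rewrite !mmulA).
destruct H as [H|[H1 H2]]; auto. exfalso.
assert (G12 : G (minv g1 ** g2)) by grp HG.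
apply (mtr_neq0 G HG _ G12). rewrite <- (mtr_cd V HV). unfold mtr; lra.
Qed.

Lemma coaxial_power g1 g2 : G g1 -> G g2 -> coaxial g1 g2 ->
  exists s, zpow b s /\ eqpm g2 (g1 ** s).
Proof.
intros G1 G2 [H1 H2].
destruct (centralizer_primitive G HG e He0 He1 Hgap b V k Gb HV Hk Eb (minv g1 ** g2))
  as (s & Zs & Es); auto; [grp HG|].
exists s; split; auto. pose proof (sg_det G HG g1 G1) as d1.
replace g2 with (g1 ** (minv g1 ** g2)) by (rewrite mmulA, mmulVr, mmul1l; auto).
apply eqpm_mul; auto using eqpm_refl.
Qed.

Lemma coaxial_scale U g1 g2 : G g1 -> G g2 -> coaxial g1 g2 ->
  exists x, x <> 0 /\ minv U ** g1 ** V = minv U ** g2 ** V ** dg x.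
Proof.
intros G1 G2 HC. apply coaxial_sym in HC as [H1 H2].
set (D := cd V (minv g2 ** g1)) in *.
pose proof (sg_det G HG g1 G1) as d1. pose proof (sg_det G HG g2 G2) as d2.
assert (dD : mdet D = 1).
{ apply mdet_mul1; auto. apply mdet_mul1; [now rewrite mdet_inv|].
  apply mdet_mul1; auto; now rewrite mdet_inv. }
pose proof (diag_dg D dD H1 H2) as ED.
destruct ED as (x & Hx & ED). exists x; split; auto. rewrite <- ED.
unfold D, cd. rewrite !mmulA. rewrite mmulKV by auto. now rewrite mmulKV.
Qed.

Lemma through_scale T Z x : x <> 0 -> through T Z -> through T (Z ** dg x).
Proof.
intros Hx [H1 H2]. assert (Hx2 : 0 < x ^ 2) by now apply sq_pos.
assert (Hy2 : 0 < (/ x) ^ 2) by now apply sq_pos, Rinv_neq_0_compat.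
split; simpl m11; simpl m12; simpl m21; simpl m22.
- replace ((m11 Z * 0 + m12 Z * / x) ^ 2) with (m12 Z ^ 2 * (/ x) ^ 2) by ring.
  replace ((m21 Z * 0 + m22 Z * / x) ^ 2) with (m22 Z ^ 2 * (/ x) ^ 2) by ring.
  now apply Rmult_lt_compat_r.
- replace ((m11 Z * x + m12 Z * 0) ^ 2) with (m11 Z ^ 2 * x ^ 2) by ring.
  replace (T ^ 2 * (m21 Z * x + m22 Z * 0) ^ 2) with (T ^ 2 * m21 Z ^ 2 * x ^ 2) by ring.
  now apply Rmult_lt_compat_r.
Qed.

Lemma act_dg x u v : x <> 0 -> act (dg x) (fr u 0 v) = fr (x ^ 2 * u) 0 ((/ x) ^ 2 * v).
Proof. intros; apply frm_eq; simpl; ring. Qed.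

Lemma pair_equiv_coaxial p q : G (fst p) -> G (snd p) -> G (fst q) -> G (snd q) ->
  pair_equiv G b p q -> exists s, G s /\
   ((coaxial (s ** fst p) (fst q) /\ coaxial (s ** snd p) (snd q)) \/
    (coaxial (s ** fst p) (snd q) /\ coaxial (s ** snd p) (fst q))).
Proof.
intros G1 G2 G3 G4 (s & Gs & H). exists s; split; auto.
destruct H as [[H1 H2]|[H1 H2]]; [left | right]; split;
 apply same_axis_coaxial; auto; grp HG.
Qed.

Context (a U : Mat2) (l : R) (Ga : G a) (Pa : Defs.primitive G a) (HU : mdet U = 1)
  (Hl : l ^ 2 > 1) (Ea : a = U ** dg l ** minv U).
Context (T K : R) (N : nat) (EN : T = (l ^ 2) ^ N) (HT : 10 <= T) (HK : 1 <= K)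
  (HKT : 36 * K ^ 2 <= T) (Hbig : 72 * K ^ 2 * (l - / l) ^ 2 < e / 5 * T).

(** Its columns are the ends of the translate by h of the axis of [b], in the coordinate where the
    axis of [a] is (0, oo). *)
Definition rel (h : Mat2) : Mat2 := minv U ** h ** V.

Lemma mdet_rel h : G h -> mdet (rel h) = 1.
Proof.
intros Gh; apply mdet_mul1; auto; apply mdet_mul1; [now rewrite mdet_inv|].
now apply (sg_det G HG).
Qed.

Lemma cd_rel s h : cd U s ** rel h = rel (s ** h).
Proof. unfold cd, rel. rewrite !mmulA. now rewrite mmulKV. Qed.

Lemma lo_rel h : lo (minv U ** h) (pt V) <-> lo (rel h) fbase.
Proof. unfold lo, pt, rel; rewrite (act_mul _ V); tauto. Qed.

Lemma hi_rel h n : hi T (minv U ** h) (act (mpow b n) (pt V)) <->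
  hi T (rel h) (fr ((k ^ 2) ^ n) 0 (/ (k ^ 2) ^ n)).
Proof.
destruct (inv_gt1 k Hk) as [Hk0 _].
unfold hi. rewrite Eb, act_pow_axis by auto. unfold rel; rewrite (act_mul _ V); tauto.
Qed.

Lemma gate_through h n : lo (minv U ** h) (pt V) ->
  hi T (minv U ** h) (act (mpow b n) (pt V)) -> through T (rel h).
Proof.
rewrite lo_rel, hi_rel. intros H1 H2.
apply (gate_entries T ((k ^ 2) ^ n) (rel h)); auto; [lra|].
apply pow_R1_Rle; lra.
Qed.

(* Within one period of [b] each translate of its axis meets a given gate once. *)
Lemma gate_unique h1 h2 : G h1 -> G h2 -> coaxial h1 h2 ->
  lo (minv U ** h1) (pt V) -> hi T (minv U ** h1) (act (mpow b 1) (pt V)) ->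
  lo (minv U ** h2) (pt V) -> hi T (minv U ** h2) (act (mpow b 1) (pt V)) ->
  eqpm h1 h2.
Proof.
intros G1 G2 HC. rewrite !lo_rel, !hi_rel. intros A1 A2 B1 B2.
destruct (inv_gt1 k Hk) as [Hk0 _].
destruct (coaxial_power h1 h2 G1 G2 HC) as (s & (n & Es) & Eh).
assert (Hn : n = 0%nat).
2:{ assert (E : s = mI) by (subst n; destruct Es; auto). rewrite E, mmul1r in Eh.
  now apply eqpm_sym. }
assert (Hk1 : 1 <= (k ^ 2) ^ 1) by (apply pow_R1_Rle; lra).
destruct (gate_entries T _ _ ltac:(lra) Hk1 A1 A2) as (_ & C1 & C2).
destruct (gate_entries T _ _ ltac:(lra) Hk1 B1 B2) as (_ & D1 & D2).
assert (Er : exists x, (x = k ^ n \/ x = / k ^ n) /\ eqpm (rel h2) (rel h1 ** dg x)).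
{ assert (Ez : exists x, (x = k ^ n \/ x = / k ^ n) /\ s = V ** dg x ** minv V).
  { destruct Es as [->| ->].
    - exists (k ^ n); split; auto. now rewrite Eb, mpow_conj, dg_pow.
    - exists (/ k ^ n); split; auto.
      rewrite Eb, !minv_mul, minvK, dg_inv, mmulA, mpow_conj, dg_pow, pow_inv; auto. }
  destruct Ez as (x & Hx & Ez). exists x; split; auto.
  replace (rel h1 ** dg x) with (rel (h1 ** s)).
  - unfold rel. apply eqpm_mul; [|now left]. apply eqpm_mul; [now left | auto].
  - unfold rel. rewrite Ez, !mmulA. now rewrite mmulVK. }
destruct Er as (x & Hx & Er). set (Z := rel h1) in *. clearbody Z.
assert (Eq : m11 (rel h2) ^ 2 = x ^ 2 * m11 Z ^ 2 /\ m12 (rel h2) ^ 2 = (/ x) ^ 2 * m12 Z ^ 2 /\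
  m21 (rel h2) ^ 2 = x ^ 2 * m21 Z ^ 2 /\ m22 (rel h2) ^ 2 = (/ x) ^ 2 * m22 Z ^ 2).
{ destruct Er as [->| ->]; simpl; repeat split; ring. }
destruct Eq as (E1 & E2 & E3 & E4). rewrite E1, E2, E3, E4 in D1, D2. clear E1 E2 E3 E4.
set (A := m11 Z ^ 2 - m21 Z ^ 2) in *. set (B := m22 Z ^ 2 - m12 Z ^ 2) in *.
rewrite <- !Rmult_minus_distr_l in D1, D2. fold A B in D1, D2.
rewrite pow_1 in *. set (c := k ^ 2) in *.
destruct n as [|n]; auto. exfalso.
assert (Hx0 : x <> 0).
{ destruct Hx as [->| ->]; [|apply Rinv_neq_0_compat]; now apply pow_nonzero. }
assert (Hc : c <= (k ^ S n) ^ 2).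
{ rewrite <- pow_mult, Nat.mul_comm, pow_mult. fold c. simpl.
  assert (1 <= c ^ n) by (apply pow_R1_Rle; lra). nra. }
assert (Hy2 : 0 < x ^ 2) by now apply sq_pos.
assert (Hc2 : 1 <= c ^ 2) by (clear - Hk1; nra).
assert (HA : 0 < A) by (clear - Hc2 C1 C2; apply Rnot_le_lt; intros HN; nra).
assert (D1' : (x ^ 2) ^ 2 * A < B).
{ apply Rmult_lt_compat_l with (r := x ^ 2) in D1; auto.
  replace (x ^ 2 * ((/ x) ^ 2 * B)) with B in D1 by (field; auto). lra. }
assert (D2' : B < c ^ 2 * ((x ^ 2) ^ 2 * A)).
{ apply Rmult_lt_compat_l with (r := x ^ 2) in D2; auto.
  replace (x ^ 2 * ((/ x) ^ 2 * B)) with B in D2 by (field; auto). lra. }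
(* The entrance parameters for h1 and h2 both lie in one period of [b], yet they differ by the
   factor x^2, which is a full period or more in one of the two directions. *)
destruct Hx as [Hx|Hx].
- rewrite <- Hx in Hc. assert (Hcx : c ^ 2 <= (x ^ 2) ^ 2) by (apply pow_incr; lra).
  clear - Hcx HA C2 D1'. nra.
- assert (Hcx : c * x ^ 2 <= 1).
  { rewrite Hx, pow_inv. apply Rmult_le_reg_r with ((k ^ S n) ^ 2); [lra|].
    rewrite Rmult_assoc, Rinv_l; lra. }
  assert (Hc3 : (c * x ^ 2) ^ 2 <= 1) by (rewrite <- (pow1 2); apply pow_incr; split; nra).
  replace (c ^ 2 * ((x ^ 2) ^ 2 * A)) with ((c * x ^ 2) ^ 2 * A) in D2' by ring.
  clear - Hc3 HA C1 D2'. nra.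
Qed.

(** The powers of [a] with exponent at most N in absolute value, the identity being listed twice. *)
Definition powers : list Mat2 :=
  map (mpow a) (seq 0 (N + 1)) ++ map (mpow (minv a)) (seq 0 (N + 1)).

Lemma powers_length : length powers = (2 * (N + 1))%nat.
Proof. unfold powers; rewrite length_app, !length_map, length_seq; lia. Qed.

Lemma powers_G z : In z powers -> G z.
Proof.
intros H; apply in_app_or in H as [H|H]; apply in_map_iff in H as (n & <- & _); grp HG.
Qed.

(** a^n multiplies [fx / fz] by L^(2n), whereas the window has total ratio W^2 < T^2 = L^(2N). *)
Lemma window_shift (X : Frm) (z : Mat2) : fpos X -> zpow a z -> fwindow (9 * K ^ 2) T X ->
  fwindow (9 * K ^ 2) T (act (cd U z) X) -> In z powers.
Proof.
intros PX (n & Ez) (F1 & F2) (F3 & F4). destruct (inv_gt1 l Hl) as [Hl0 _].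
set (L := l ^ 2) in *. set (W := 9 * K ^ 2) in *.
assert (HW : 1 <= W) by (unfold W; nra).
assert (HWT : 4 * W <= T) by (unfold W; lra).
destruct PX as (X1 & X2 & _).
assert (HLn : 0 < L ^ n) by (apply pow_lt; lra).
assert (Hnn : (l ^ n) ^ 2 = L ^ n) by (unfold L; now rewrite <- !pow_mult, Nat.mul_comm).
assert (Hln : l ^ n <> 0) by now apply pow_nonzero.
assert (HTW : 0 < T / W) by (apply Rdiv_lt_0_compat; lra).
assert (Hn : (n <= N)%nat).
{ apply Nat.nlt_ge; intros Hlt.
  assert (HLN : T < L ^ n) by (rewrite EN; apply Rlt_pow; auto; lra).
  assert (HW2 : W ^ 2 < (L ^ n) ^ 2) by nra.
  destruct Ez as [-> | ->].
  - rewrite cd_pow, (cd_a a U l HU Ea), dg_pow in F3, F4 by auto.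
    cbn [act fx fy fz m11 m12 m21 m22 dg] in F3, F4.
    replace ((l ^ n) ^ 2 * fx X + 2 * l ^ n * 0 * fy X + 0 ^ 2 * fz X) with (L ^ n * fx X) in F4 by (rewrite <- Hnn; ring).
    replace (0 ^ 2 * fx X + 2 * 0 * / l ^ n * fy X + (/ l ^ n) ^ 2 * fz X) with (/ L ^ n * fz X) in F4 by (rewrite <- Hnn; field; auto).
    apply Rmult_le_compat_l with (r := L ^ n) in F4; [|lra].
    replace (L ^ n * (T * W * (/ L ^ n * fz X))) with (T * W * fz X) in F4 by (field; lra).
    assert ((L ^ n) ^ 2 * (T / W * fz X) <= T * W * fz X).
    { apply Rle_trans with (L ^ n * (L ^ n * fx X)); auto.
      replace ((L ^ n) ^ 2 * (T / W * fz X)) with (L ^ n * (L ^ n * (T / W * fz X))) by ring.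
      apply Rmult_le_compat_l; [lra|]. apply Rmult_le_compat_l; lra. }
    assert (W ^ 2 * (T / W * fz X) < (L ^ n) ^ 2 * (T / W * fz X)).
    { apply Rmult_lt_compat_r; auto. now apply Rmult_lt_0_compat. }
    replace (W ^ 2 * (T / W * fz X)) with (T * W * fz X) in H0 by (field; lra). lra.
  - rewrite cd_pow, cd_inv, (cd_a a U l HU Ea), dg_inv, dg_pow, pow_inv in F3, F4 by auto.
    cbn [act fx fy fz m11 m12 m21 m22 dg] in F3, F4.
    replace ((/ l ^ n) ^ 2 * fx X + 2 * / l ^ n * 0 * fy X + 0 ^ 2 * fz X) with (/ L ^ n * fx X) in F3 by (rewrite <- Hnn; field; auto).
    rewrite Rinv_inv in F3.
    replace (0 ^ 2 * fx X + 2 * 0 * l ^ n * fy X + (l ^ n) ^ 2 * fz X) with (L ^ n * fz X) in F3 by (rewrite <- Hnn; ring).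
    apply Rmult_le_compat_l with (r := L ^ n) in F3; [|lra].
    replace (L ^ n * (/ L ^ n * fx X)) with (fx X) in F3 by (field; lra).
    assert (W ^ 2 * (T / W * fz X) < (L ^ n) ^ 2 * (T / W * fz X)).
    { apply Rmult_lt_compat_r; auto. now apply Rmult_lt_0_compat. }
    replace (W ^ 2 * (T / W * fz X)) with (T * W * fz X) in H by (field; lra). lra. }
unfold powers. apply in_or_app. destruct Ez as [->| ->]; [left | right];
 apply in_map, in_seq; lia.
Qed.

(* An element matching two crossings of the same kind cannot move far along the axis. *)
Lemma matching_is_power s t1 t2 h1 h2 h3 h4 : G s -> G t1 -> G t2 ->
  G h1 -> G h2 -> G h3 -> G h4 ->
  wide K T (cd U t1) -> wide K T (cd U t2) ->
  through T (rel h1) -> through T (rel h2) -> through T (rel h3) -> through T (rel h4) ->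
  coaxial (s ** h2) h4 -> coaxial (s ** (t1 ** h1)) (t2 ** h3) ->
  exists z, In z powers /\ eqpm s z.
Proof.
intros Gs Gt1 Gt2 G1 G2 G3 G4 W1 W2 T1 T2 T3 T4 C2 C1.
assert (HK4 : 4 * K ^ 2 <= T) by nra.
destruct (window_cols K T _ _ HK HK4 W1 T1) as (A1 & A2 & A3).
destruct (window_cols K T _ _ HK HK4 W2 T3) as (B1 & B2 & B3).
rewrite cd_rel in *.
set (W := 9 * K ^ 2) in *.
assert (HW : 1 <= W) by (unfold W; nra).
assert (HWT : 4 * W <= T) by (unfold W; lra).
assert (Gt1h : G (t1 ** h1)) by grp HG. assert (Gst : G (s ** (t1 ** h1))) by grp HG.
assert (Gsh : G (s ** h2)) by grp HG. assert (Gt2h : G (t2 ** h3)) by grp HG.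
pose proof (linked_sign W T _ _ HW ltac:(lra) T2 A1 A2 A3) as Hlk.
(* The common point of the axes given by t1 h1 and h2 is in the window, because both ends of the
   first axis are. Its image under s lies on the axis given by t2 h3, so it is in the window too. *)
destruct (crossing_point _ _ (mdet_rel _ G2) (mdet_rel _ Gt1h) Hlk)
  as (x & y & u & v & Hx & Hy & Hu & Hv & EC).
pose proof (window_point W T _ x y Hx Hy A1 A2) as F1.
destruct (coaxial_scale U _ _ Gst Gt2h C1) as (c & Hc & Ec).
destruct (coaxial_scale U _ _ Gsh G4 C2) as (d & Hd & Ed).
fold (rel (s ** (t1 ** h1))) in Ec. fold (rel (t2 ** h3)) in Ec.
fold (rel (s ** h2)) in Ed. fold (rel h4) in Ed.
assert (F2 : fwindow W T (act (cd U s) (act (rel (t1 ** h1)) (fr x 0 y)))).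
{ rewrite <- act_mul, cd_rel, Ec, act_mul, act_dg by auto.
  apply window_point; auto; apply Rmult_lt_0_compat; auto; apply sq_pos; auto.
  now apply Rinv_neq_0_compat. }
assert (PC : fpos (act (rel (t1 ** h1)) (fr x 0 y))).
{ apply fpos_act; [now apply mdet_rel|]. split; [|split]; simpl; auto.
  assert (0 < x * y) by now apply Rmult_lt_0_compat. lra. }
rewrite EC in F1, F2, PC.
assert (F2' : fwindow W T (act (rel (s ** h2)) (fr u 0 v))) by now rewrite <- cd_rel, act_mul.
assert (Tsh : through T (rel (s ** h2))) by (rewrite Ed; now apply through_scale).
pose proof (overlap_bound W T u v _ _ HW HWT HT Hu Hv (mdet_rel _ G2)
  (mdet_rel _ Gsh) T2 Tsh F1 F2') as Hov.
cbv zeta in Hov.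
rewrite <- cd_rel, mmulKV in Hov by now apply mdet_rel.
(* The bound 8 W of [overlap_bound] is 72 K^2, the constant in [Hbig]. *)
destruct (sep_off G HG e He0 He1 Hgap a U l Ga HU Hl Ea s Gs) as [S1 S2].
{ pose proof (sub_inv_sq l Hl) as [Hll _].
  apply Rmult_lt_reg_r with T; [lra|].
  replace (Rabs (m12 (cd U s) * m21 (cd U s)) * (l - / l) ^ 2 * T) with
    (Rabs (m12 (cd U s) * m21 (cd U s)) * T * (l - / l) ^ 2) by ring.
  apply Rle_lt_trans with (8 * W * (l - / l) ^ 2); [apply Rmult_le_compat_r; lra|].
  unfold W. lra. }
destruct (centralizer_primitive G HG e He0 He1 Hgap a U l Ga HU Hl Ea s Pa Gs S1 S2)
  as (z & Zz & Ez).
exists z; split; auto. apply (window_shift _ z PC); auto. fold W.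
replace (act (cd U z) (act (rel h2) (fr u 0 v))) with
  (act (cd U s) (act (rel h2) (fr u 0 v))); auto.
destruct Ez as [->| ->]; auto. now rewrite cd_neg, act_neg.
Qed.

Lemma axes_linked_sym A B : mdet A = 1 -> mdet B = 1 ->
  axes_linked (A ** dg k ** minv A) (B ** dg k ** minv B) ->
  axes_linked (B ** dg k ** minv B) (A ** dg k ** minv A).
Proof.
intros dA dB. rewrite !axes_linked_iff by auto. cbv zeta.
replace (minv B ** A) with (minv (minv A ** B)) by now rewrite minv_mul, minvK.
set (Z := minv A ** B). clearbody Z. simpl. lra.
Qed.

(** t turns every geodesic through the gate into one crossing the strip near its middle, hence
    crossing every geodesic through the gate; taking h1 = h2 is allowed. *)
Lemma through_linked t h1 h2 : G t -> G h1 -> G h2 -> wide K T (cd U t) ->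
  through T (rel h1) -> through T (rel h2) -> lpair G b (t ** h1, h2).
Proof.
intros Gt G1 G2 Wt T1 T2. assert (Gth : G (t ** h1)) by grp HG.
split; [auto|]; split; [auto|]. simpl fst; simpl snd.
assert (HK4 : 4 * K ^ 2 <= T) by nra.
destruct (window_cols K T _ _ HK HK4 Wt T1) as (A1 & A2 & A3).
rewrite cd_rel in *.
assert (HW : 1 <= 9 * K ^ 2) by nra. assert (HWT : 9 * K ^ 2 < T) by nra.
pose proof (linked_sign _ T _ _ HW HWT T2 A1 A2 A3) as Hlk.
pose proof (sg_det G HG _ Gth) as d1. pose proof (sg_det G HG _ G2) as d2.
rewrite Eb, !conj_conj. apply axes_linked_sym; try now apply mdet_mul1.
apply axes_linked_iff; auto using mdet_mul1. cbv zeta in *.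
replace (minv (h2 ** V) ** (t ** h1 ** V)) with (minv (rel h2) ** rel (t ** h1)); auto.
unfold rel. rewrite !minv_mul, minvK, !mmulA. now rewrite mmulKV.
Qed.

(** The factor 4(N + 1) bounds the number of pairs in one class. Relative to a fixed pair of the
    class, any other is reached by an element matching two crossings; that element, or its product
    with t if the two geodesics are exchanged, is one of the 2(N + 1) [powers], and it determines
    the pair. *)
Lemma chain_count t c c0 : G t -> wide K T (cd U t) ->
  chain T (gates G U) (pt V) (act (mpow b 1) (pt V)) c -> self_int G b c0 ->
  (length c * length c <= c0 * (4 * (N + 1)))%nat.
Proof.
intros Gt Wt [O C] (L0 & <- & HL & _ & Hcov).
set (hs := map (fun H => U ** H) c).
assert (Hin : forall h, In h hs -> G h /\ In (minv U ** h) c).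
{ intros h Hh; apply in_map_iff in Hh as (H & <- & HH).
  destruct (C H HH) as ((h & Gh & ->) & _).
  rewrite (mmulA U), mmulVr, mmul1l by auto. auto. }
assert (dU' : mdet (minv U) = 1) by now rewrite mdet_inv.
assert (Hthr : forall h, In h hs -> through T (rel h)).
{ intros h Hh. destruct (Hin h Hh) as [Gh Hc]. destruct (C _ Hc) as (_ & H1 & H2).
  now apply gate_through with 1%nat. }
(* [gate_unique] gives equality up to sign. A gate and its negative are the same strip, so they
   cannot both occur in a chain. *)
assert (Huniq : forall h h', In h hs -> In h' hs -> coaxial h h' -> h = h').
{ intros h h' Hh Hh' HC. destruct (Hin h Hh) as [Gh Hc]. destruct (Hin h' Hh') as [Gh' Hc'].
  destruct (C _ Hc) as (S1 & H1 & H2). destruct (C _ Hc') as (S1' & H1' & H2').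
  assert (E : eqpm h h') by (apply gate_unique; auto).
  assert (E' : eqpm (minv U ** h) (minv U ** h')) by (apply eqpm_mul; auto using eqpm_refl).
  assert (Hirr : forall X Y, mdet X = 1 -> eqpm X Y -> ~ prec T X Y).
  { intros X Y dX EXY HP. apply (prec_irrefl T X); [lra | auto|].
    intros Z PZ HZ. specialize (HP Z PZ HZ). unfold lo in *.
    now rewrite (act_eqpm X Y). }
  assert (d1 := sg_det G HG h Gh). assert (d2 := sg_det G HG h' Gh').
  destruct (ForallOrdPairs_In O _ _ Hc Hc') as [EE|[HP|HP]].
  - now apply mulIl in EE.
  - exfalso; apply (Hirr _ _ (mdet_mul1 _ _ dU' d1) E' HP).
  - exfalso; apply (Hirr _ _ (mdet_mul1 _ _ dU' d2) (eqpm_sym _ _ E') HP). }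
assert (NDhs : NoDup hs).
{ apply NoDup_map_NoDup_ForallPairs.
  - intros x y _ _ E; now apply mulIl in E.
  - apply FOP_NoDup with (2 := O). intros H HH. destruct (C H HH) as ((h & Gh & ->) & _).
    apply prec_irrefl; [lra|]. apply mdet_mul1; auto. now apply (sg_det G HG). }
replace (length c) with (length hs) by (unfold hs; apply length_map).
rewrite <- length_prod.
assert (Ht1 : mdet t = 1) by now apply (sg_det G HG).
assert (Hpm : forall s z g g' : Mat2, eqpm s z -> coaxial (s ** g) g' -> coaxial (z ** g) g').
{ intros s z g g' E; apply coaxial_eqpm, eqpm_mul; auto using eqpm_refl. }
assert (Hcomp : forall g1 g2 g3 s s', G s -> G s' -> G g1 -> G g2 -> G g3 ->
  coaxial (s ** g1) g3 -> coaxial (s' ** g2) g3 -> coaxial (minv s' ** s ** g1) g2).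
{ intros g1 g2 g3 s s' Gs Gs' G1 G2 G3 A B.
  pose proof (sg_det G HG s' Gs') as ds'. pose proof (sg_det G HG g3 G3) as d3.
  rewrite <- (coaxial_left s') by auto. rewrite !mmulA, mmulVr, mmul1l by auto.
  apply coaxial_trans with g3; auto. now apply coaxial_sym. }
apply fiber_bound with (Q := fun p q => pair_equiv G b (t ** fst p, snd p) q).
- now apply NoDup_list_prod.
- intros [h h'] Hp. apply in_prod_iff in Hp as [Hh Hh']. apply Hcov.
  apply through_linked; auto; now apply Hin.
- intros q l' Hq ND Hi HQ. destruct l' as [|[h0 h0'] l'']; [simpl; lia|].
  set (l' := (h0, h0') :: l'') in *.
  assert (Gq : G (fst q) /\ G (snd q)) by (destruct (HL q Hq) as (A & B & _); auto).
  destruct Gq as [Gq1 Gq2].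
  assert (H0 : In (h0, h0') l') by now left.
  pose proof (Hi _ H0) as I0. apply in_prod_iff in I0 as [I0 I0'].
  destruct (Hin _ I0) as [Gh0 _]. destruct (Hin _ I0') as [Gh0' _].
  assert (Gth0 : G (t ** h0)) by grp HG.
  destruct (pair_equiv_coaxial (t ** h0, h0') q Gth0 Gh0' Gq1 Gq2 (HQ _ H0)) as (s0 & Gs0 & E0).
  simpl fst in E0; simpl snd in E0.
  replace (4 * (N + 1))%nat with (length (list_prod (true :: false :: nil) powers) * 1)%nat
    by (rewrite length_prod, powers_length; simpl; lia).
  (* The boolean records whether the two geodesics keep their places; for each label the pair is
     unique up to [coaxial], hence unique. *)
  apply fiber_bound with (Q := fun p (y : bool * Mat2) => let z := snd y in
    if fst y then coaxial (z ** h0') (snd p) /\ coaxial (z ** (t ** h0)) (t ** fst p)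
    else coaxial (z ** h0) (snd p) /\ coaxial (z ** (minv t ** h0')) (t ** fst p)); auto.
  + intros [h h'] Hp. pose proof (Hi _ Hp) as I. apply in_prod_iff in I as [I I'].
    destruct (Hin _ I) as [Gh _]. destruct (Hin _ I') as [Gh' _].
    assert (Gth : G (t ** h)) by grp HG.
    destruct (pair_equiv_coaxial (t ** h, h') q Gth Gh' Gq1 Gq2 (HQ _ Hp)) as (s & Gs & E).
    simpl fst in E; simpl snd in E.
    set (u := minv s ** s0). assert (Gu : G u) by (unfold u; grp HG).
    assert (Cases : (coaxial (u ** (t ** h0)) (t ** h) /\ coaxial (u ** h0') h') \/
                    (coaxial (u ** (t ** h0)) h' /\ coaxial (u ** h0') (t ** h))).
    { unfold u. destruct E0 as [[A B]|[A B]], E as [[A' B']|[A' B']].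
      - left; split; eauto.
      - right; split; eauto.
      - right; split; eauto.
      - left; split; eauto. }
    destruct Cases as [[A B]|[A B]].
    * destruct (matching_is_power u t t h0 h0' h h') as (z & Hz & Ez); auto.
      exists (true, z). split; [apply in_prod; simpl; auto|]. simpl; split; eauto.
    (* Here u takes t h0 to h' and h0' to t h. Its product with t takes h0 to h' and t^-1 h0' to t
       h, so the lemma applies with t^-1 as the first wide element. *)
    * destruct (matching_is_power (u ** t) (minv t) t h0' h0 h h') as (z & Hz & Ez); auto.
      -- grp HG.
      -- grp HG.
      -- rewrite cd_inv. now apply wide_inv.
      -- now rewrite <- mmulA.
      -- rewrite !mmulA, mmulKV by auto. auto.
      -- exists (false, z). split; [apply in_prod; simpl; auto|]. simpl; split.
         ++ apply (Hpm (u ** t)); auto. now rewrite <- mmulA.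
         ++ apply (Hpm (u ** t)); auto. rewrite !mmulA, mmulKV by auto. auto.
  + intros [ty z] l1 Hy ND1 Hi1 HQ1. apply in_prod_iff in Hy as [_ Hz].
    assert (Gz : G z) by now apply powers_G.
    destruct l1 as [|[h h'] [|[g g'] l2]]; [simpl; lia | simpl; lia|]. exfalso.
    inversion ND1 as [|? ? Hn _]; subst. apply Hn; left.
    pose proof (Hi _ (Hi1 _ (or_introl eq_refl))) as I1.
    pose proof (Hi _ (Hi1 _ (or_intror (or_introl eq_refl)))) as I2.
    apply in_prod_iff in I1 as [I1 I1']. apply in_prod_iff in I2 as [I2 I2'].
    destruct (Hin _ I1) as [G1 _]. destruct (Hin _ I1') as [G1' _].
    destruct (Hin _ I2) as [G2 _]. destruct (Hin _ I2') as [G2' _].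
    pose proof (HQ1 _ (or_introl eq_refl)) as Q1.
    pose proof (HQ1 _ (or_intror (or_introl eq_refl))) as Q2.
    simpl in Q1, Q2.
    assert (Hco : forall x y y', G x -> coaxial x y -> coaxial x y' -> coaxial y y').
    { intros x y y' Gx A B. apply coaxial_trans with x; auto.
      - now apply (sg_det G HG).
      - now apply coaxial_sym. }
    destruct ty; destruct Q1 as [A1 B1], Q2 as [A2 B2]; f_equal; apply Huniq; auto.
    * apply (coaxial_left t); auto.
      apply (Hco (z ** (t ** h0))); auto; grp HG.
    * apply (Hco (z ** h0')); auto; grp HG.
    * apply (coaxial_left t); auto.
      apply (Hco (z ** (minv t ** h0'))); auto; grp HG.
    * apply (Hco (z ** h0)); auto; grp HG.
Qed.

End Axes.

(** * The quasimorphism *)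

(** x = P S1 and -y = -Q S0 are positive with sum 1 and product at least d, so both lie between d
    and 1. The two normalizations confine P^2 to [1, L^2] and Q^2 to [T/L, L T]; S0 and S1
    follow. *)
Lemma wide_of (d L T P Q S0 S1 : R) : 0 < d <= 1 -> 1 < L -> 0 < T ->
  P * S1 - Q * S0 = 1 -> d <= Rabs (P * Q * S0 * S1) -> P * Q * S0 * S1 < 0 ->
  T <= P ^ 2 * Q ^ 2 <= L ^ 2 * T -> Q ^ 2 <= P ^ 2 * T <= L ^ 2 * Q ^ 2 ->
  wide (L ^ 2 / d ^ 2) T (mk2 P Q S0 S1).
Proof.
intros (Hd0 & Hd1) HL HT Hdet Habs Hneg (A1 & A2) (B1 & B2).
rewrite Rabs_left in Habs by auto.
set (x := P * S1) in *. set (y := Q * S0) in *.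
replace (P * Q * S0 * S1) with (x * y) in * by (unfold x, y; ring).
assert (Hy : y < 0) by nra. assert (Hx : 0 < x) by nra.
assert (X : d <= x <= 1) by nra. assert (Y : d <= - y <= 1) by nra.
assert (HP : P <> 0) by (intros E; unfold x in Hx; rewrite E in Hx; lra).
assert (HQ : Q <> 0) by (intros E; unfold y in Hy; rewrite E in Hy; lra).
pose proof (sq_pos P HP) as P2. pose proof (sq_pos Q HQ) as Q2.
set (p := P ^ 2) in *. set (q := Q ^ 2) in *.
assert (Hd2 : 0 < d ^ 2 <= 1) by nra.
assert (HL2 : 1 < L ^ 2) by nra.
pose proof (Rmult_le_compat_l p _ _ (Rlt_le _ _ P2) B1) as pB1.
pose proof (Rmult_le_compat_l p _ _ (Rlt_le _ _ P2) B2) as pB2.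
pose proof (Rmult_le_compat_l q _ _ (Rlt_le _ _ Q2) B1) as qB1.
pose proof (Rmult_le_compat_l q _ _ (Rlt_le _ _ Q2) B2) as qB2.
pose proof (Rmult_le_compat_l T _ _ (Rlt_le _ _ HT) A1) as TA1.
pose proof (Rmult_le_compat_l T _ _ (Rlt_le _ _ HT) A2) as TA2.
pose proof (Rmult_le_compat_l (L ^ 2) _ _ (Rle_trans _ _ _ Rle_0_1 (Rlt_le _ _ HL2)) A2) as LA2.
assert (p1 : 1 <= p).
{ apply Rsqr_incr_0_var; [|lra]. unfold Rsqr. apply Rmult_le_reg_r with T; lra. }
assert (p3 : p <= L ^ 2).
{ apply Rsqr_incr_0_var; [|lra]. unfold Rsqr. apply Rmult_le_reg_r with T; lra. }
assert (q1 : T / L <= q).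
{ apply Rmult_le_reg_l with L; [lra|]. replace (L * (T / L)) with T by (field; lra).
  apply Rsqr_incr_0_var; [unfold Rsqr; lra|]. apply Rmult_le_pos; lra. }
assert (q3 : q <= L * T).
{ apply Rsqr_incr_0_var; [unfold Rsqr; lra|]. apply Rmult_le_pos; lra. }
set (K := L ^ 2 / d ^ 2).
assert (KE : / K = d ^ 2 / L ^ 2) by (unfold K; field; lra).
assert (HK : L ^ 2 <= K).
{ unfold K. apply Rmult_le_reg_r with (d ^ 2); [lra|].
  replace (L ^ 2 / d ^ 2 * d ^ 2) with (L ^ 2) by (field; lra). nra. }
assert (HLK : L <= K) by nra.
assert (KL : / K <= / L ^ 2) by (apply Rinv_le_contravar; lra).
assert (KL' : / K <= / L) by (apply Rinv_le_contravar; lra).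
assert (K1 : / K <= 1) by (rewrite <- Rinv_1; apply Rinv_le_contravar; lra).
assert (s1 : p * S1 ^ 2 = x ^ 2) by (unfold p, x; ring).
assert (r1 : q * S0 ^ 2 = y ^ 2) by (unfold q, y; ring).
assert (x2 : d ^ 2 <= x ^ 2 <= 1) by (clear - X Hd0; nra).
assert (y2 : d ^ 2 <= y ^ 2 <= 1) by (clear - Y Hd0; nra).
pose proof (pow2_ge_0 S0) as S00. pose proof (pow2_ge_0 S1) as S10.
unfold wide; simpl m11; simpl m12; simpl m21; simpl m22; fold p q.
repeat split; try lra.
- rewrite KE. apply Rmult_le_reg_l with (L ^ 2); [lra|].
  replace (L ^ 2 * (d ^ 2 / L ^ 2)) with (d ^ 2) by (field; lra).
  apply Rle_trans with (p * S1 ^ 2); [lra|]. now apply Rmult_le_compat_r.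
- apply Rle_trans with 1; [|lra].
  apply Rle_trans with (p * S1 ^ 2); [|lra]. clear - p1 S10. nra.
- apply Rle_trans with (T / L); auto. unfold Rdiv. apply Rmult_le_compat_l; lra.
- apply Rle_trans with (L * T); auto. apply Rmult_le_compat_r; lra.
- apply Rmult_le_reg_l with (L * T); [apply Rmult_lt_0_compat; lra|].
  apply Rle_trans with (q * S0 ^ 2); [|now apply Rmult_le_compat_r].
  rewrite r1. apply Rle_trans with (d ^ 2); [|lra].
  rewrite Rinv_mult, KE.
  replace (L * T * (d ^ 2 / L ^ 2 * / T)) with (d ^ 2 * / L) by (field; lra).
  assert (/ L <= 1) by (rewrite <- Rinv_1; apply Rinv_le_contravar; lra). clear - H Hd2. nra.
- apply Rle_trans with (L / T).
  + apply Rmult_le_reg_l with (T / L); [apply Rdiv_lt_0_compat; lra|].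
    replace (T / L * (L / T)) with 1 by (field; lra).
    apply Rle_trans with (q * S0 ^ 2); [now apply Rmult_le_compat_r | lra].
  + apply Rmult_le_compat_r; auto. apply Rlt_le, Rinv_0_lt_compat; auto.
- replace (P * Q * S0 * S1) with (x * y) by (unfold x, y; ring). auto.
Qed.

Section Final.
Context (G : Mat2 -> Prop) (HG : surface_group G).
Context (e : R) (He0 : 0 < e) (He1 : e <= 1)
  (Hgap : forall g, G g -> ~ eqpm g mI -> mtr g ^ 2 >= 4 + e).
Context (a U : Mat2) (l : R) (Ga : G a) (Pa : Defs.primitive G a) (HU : mdet U = 1)
  (Hl : l ^ 2 > 1) (Ea : a = U ** dg l ** minv U).

(** With M = l^4, the intervals from M^n to M^(n+1) cover the positive half-line, and a power of [a]
    moves y into the first one. *)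
Lemma power_scale y : 0 < y ->
  exists s x, G s /\ x <> 0 /\ cd U s = dg x /\ 1 <= x ^ 4 * y <= (l ^ 2) ^ 2.
Proof.
intros Hy. destruct (inv_gt1 l Hl) as [Hl0 _].
set (M := (l ^ 2) ^ 2). assert (HM : 1 < M) by (unfold M; nra).
assert (Hpow : forall n, (l ^ n) ^ 4 = M ^ n).
{ intros n; unfold M; rewrite <- !pow_mult. f_equal; lia. }
assert (MP : forall n, 0 < M ^ n) by (intros; apply pow_lt; lra).
assert (Hln : forall n, l ^ n <> 0) by (intros; now apply pow_nonzero).
destruct (Rle_lt_dec 1 y) as [H|H].
- destruct (pow_floor M y HM H) as (n & H1 & H2). specialize (MP n).
  exists (mpow (minv a) n), (/ l ^ n). split; [grp HG|].
  split; [now apply Rinv_neq_0_compat|].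
  split; [now rewrite cd_pow, cd_inv, (cd_a a U l HU Ea), dg_inv, dg_pow, pow_inv|].
  rewrite pow_inv, Hpow. simpl in H2. split.
  + apply Rmult_le_reg_l with (M ^ n); auto.
    replace (M ^ n * (/ M ^ n * y)) with y by (field; lra). lra.
  + apply Rmult_le_reg_l with (M ^ n); auto.
    replace (M ^ n * (/ M ^ n * y)) with y by (field; lra). lra.
- assert (H' : 1 <= / y) by (rewrite <- Rinv_1; apply Rinv_le_contravar; lra).
  destruct (pow_floor M (/ y) HM H') as (n & H1 & H2).
  exists (mpow a (S n)), (l ^ S n). split; [grp HG|]. split; auto.
  split; [now rewrite cd_pow, (cd_a a U l HU Ea), dg_pow|].
  rewrite Hpow. apply Rmult_le_compat_r with (r := y) in H1; [|lra].
  apply Rmult_lt_compat_r with (r := y) in H2; [|lra]. rewrite Rinv_l in H1, H2 by lra.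
  simpl in *. split; [lra|]. clear - H1 HM. nra.
Qed.

Lemma linked_translate c0 : self_int G a c0 -> (c0 > 0)%nat ->
  exists t, G t /\ m11 (cd U t) * m12 (cd U t) * m21 (cd U t) * m22 (cd U t) < 0.
Proof.
intros (L & HL & HP & _) Hc. destruct L as [|[g1 g2] L]; [simpl in HL; lia|].
destruct (HP (g1, g2)) as (G1 & G2 & Hlk); [now left|]. simpl in G1, G2, Hlk.
exists (minv g1 ** g2). split; [grp HG|].
pose proof (sg_det G HG _ G1). pose proof (sg_det G HG _ G2).
rewrite Ea, !conj_conj in Hlk. apply axes_linked_iff in Hlk; auto using mdet_mul1.
cbv zeta in Hlk.
replace (cd U (minv g1 ** g2)) with (minv (g1 ** U) ** (g2 ** U)); auto.
unfold cd. now rewrite minv_mul, !mmulA.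
Qed.

(* Sliding the crossing along both axes puts it in the middle of the strip. *)
Lemma wide_translate T t0 : 0 < T -> G t0 ->
  m11 (cd U t0) * m12 (cd U t0) * m21 (cd U t0) * m22 (cd U t0) < 0 ->
  exists t, G t /\ wide ((l ^ 2) ^ 6 / (e / 5) ^ 2) T (cd U t).
Proof.
intros HT Gt0 Hneg. destruct (inv_gt1 l Hl) as [Hl0 _].
assert (Hab : e / 5 <= Rabs (m11 (cd U t0) * m12 (cd U t0) * m21 (cd U t0) * m22 (cd U t0)) *
  (l - / l) ^ 4).
{ apply Rnot_lt_le; intros Hs.
  destruct (sep_diag G HG e He0 He1 Hgap a U l Ga HU Hl Ea t0 Gt0 Hs) as [E _].
  rewrite E in Hneg; lra. }
pose proof (mdet_cd G HG U HU t0 Gt0) as Hd. unfold mdet in Hd.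
assert (Hprod : m11 (cd U t0) * m12 (cd U t0) * m21 (cd U t0) * m22 (cd U t0) <> 0) by lra.
assert (HP : m11 (cd U t0) <> 0) by (intros E; rewrite E in Hprod; lra).
assert (HQ : m12 (cd U t0) <> 0) by (intros E; rewrite E in Hprod; lra).
set (L := l ^ 2) in *.
assert (Hll : (l - / l) ^ 4 <= L ^ 2).
{ replace ((l - / l) ^ 4) with (((l - / l) ^ 2) ^ 2) by ring.
  apply pow_incr. pose proof (sub_inv_sq l Hl). unfold L; lra. }
set (P0 := m11 (cd U t0)) in *. set (Q0 := m12 (cd U t0)) in *.
set (R0 := m21 (cd U t0)) in *. set (S0 := m22 (cd U t0)) in *.
pose proof (sq_pos _ HP) as P2. pose proof (sq_pos _ HQ) as Q2.
(* Multiplying by a power of [a] on the left changes only the product P Q and on the right only the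
   quotient P/Q, so the two normalizations are independent. *)
destruct (power_scale (P0 ^ 2 * Q0 ^ 2 / T)) as (s1 & x & Gs1 & Hx & E1 & A1).
{ apply Rdiv_lt_0_compat; auto. now apply Rmult_lt_0_compat. }
destruct (power_scale (P0 ^ 2 * T / Q0 ^ 2)) as (s2 & y & Gs2 & Hy & E2 & A2).
{ apply Rdiv_lt_0_compat; auto. now apply Rmult_lt_0_compat. }
exists (s1 ** t0 ** s2). split; [grp HG|].
assert (Ec : cd U (s1 ** t0 ** s2) = mk2 (P0 * x * y) (Q0 * x / y) (R0 * y / x) (S0 / (x * y))).
{ assert (ED : cd U t0 = mk2 P0 Q0 R0 S0) by (apply mat_eq; reflexivity).
  rewrite !cd_mul, E1, E2, ED by auto. clearbody P0 Q0 R0 S0.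
  apply mat_eq; simpl; field; auto. }
rewrite Ec. fold L in A1, A2.
(* The lower bound for the product of the entries given by [sep_diag], as (l - 1/l)^4 <= L^2. *)
set (d := e / 5 / L ^ 2).
assert (HL2 : 1 < L ^ 2) by (clear - Hl; unfold L in *; nra).
assert (Hdd : 0 < d <= 1).
{ unfold d; split; [apply Rdiv_lt_0_compat; lra|].
  apply Rmult_le_reg_r with (L ^ 2); [lra|].
  replace (e / 5 / L ^ 2 * L ^ 2) with (e / 5) by (field; lra). lra. }
replace (L ^ 6 / (e / 5) ^ 2) with (L ^ 2 / d ^ 2) by (unfold d; field; lra).
assert (Hpr : P0 * x * y * (Q0 * x / y) * (R0 * y / x) * (S0 / (x * y)) = P0 * Q0 * R0 * S0)
  by (field; auto).
apply wide_of; auto.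
- rewrite <- Hd. field; auto.
- rewrite Hpr. unfold d. apply Rmult_le_reg_r with (L ^ 2); [lra|].
  replace (e / 5 / L ^ 2 * L ^ 2) with (e / 5) by (field; lra).
  apply Rle_trans with (1 := Hab). apply Rmult_le_compat_l; [apply Rabs_pos | auto].
- now rewrite Hpr.
- replace ((P0 * x * y) ^ 2 * (Q0 * x / y) ^ 2) with (x ^ 4 * (P0 ^ 2 * Q0 ^ 2 / T) * T)
    by (field; split; auto; lra).
  split; [rewrite <- (Rmult_1_l T) at 1|]; apply Rmult_le_compat_r; lra.
- assert (Hq : 0 < (Q0 * x / y) ^ 2).
  { apply sq_pos. unfold Rdiv. repeat apply Rmult_integral_contrapositive_currified; auto.
    now apply Rinv_neq_0_compat. }
  replace ((P0 * x * y) ^ 2 * T) with (y ^ 4 * (P0 ^ 2 * T / Q0 ^ 2) * (Q0 * x / y) ^ 2)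
    by (field; auto).
  split; [rewrite <- (Rmult_1_l ((Q0 * x / y) ^ 2)) at 1|]; apply Rmult_le_compat_r; lra.
Qed.

Context (T K : R) (N : nat) (EN : T = (l ^ 2) ^ N) (HT : 10 <= T) (HK : 1 <= K)
  (HKT : 36 * K ^ 2 <= T) (Hbig : 72 * K ^ 2 * (l - / l) ^ 2 < e / 5 * T).
Context (t : Mat2) (Gt : G t) (Wt : wide K T (cd U t)).

Let fd := fdiff T (gates G U).

Let Hfin : forall p q : Frm, fpos p -> fpos q ->
  exists b, forall c, chain T (gates G U) p q c -> (length c <= b)%nat.
Proof. intros; now apply gates_finite. Qed.

Lemma fd_quasi p q r : fpos p -> fpos q -> fpos r -> fd p q <= fd p r + fd r q + 9.
Proof.
intros; apply fdiff_quasi; auto. intros; now apply (gates_det G HG U).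
Qed.

Lemma fd_inv g p q : G g -> fpos p -> fpos q -> fd (act g p) (act g q) = fd p q.
Proof.
intros Gg Pp Pq; unfold fd, fdiff. pose proof (sg_det G HG g Gg).
rewrite !clen_inv; auto; intros; now apply gates_mul.
Qed.

Lemma fpos_G g p : G g -> fpos p -> fpos (act g p).
Proof. intros; apply fpos_act; auto. now apply (sg_det G HG). Qed.

Lemma fd_refl p : fd p p = 0.
Proof. unfold fd, fdiff; ring. Qed.

Lemma fd_power b p j : G b -> fpos p -> fd p (act (mpow b j) p) <= INR j * (fd p (act b p) + 9).
Proof.
intros Gb Pp. induction j as [|j IH].
- simpl. rewrite act_I, fd_refl. lra.
- rewrite S_INR. simpl mpow. rewrite act_mul.
  assert (P1 : fpos (act (mpow b j) p)) by (apply fpos_G; auto; grp HG).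
  assert (P2 : fpos (act b p)) by now apply fpos_G.
  assert (P3 : fpos (act b (act (mpow b j) p))) by now apply fpos_G.
  pose proof (fd_quasi _ _ _ Pp P3 P2) as H. rewrite (fd_inv b) in H by auto. lra.
Qed.

(** Two triangles, of error 9 each; the terms from p to q and back cancel by invariance and
    antisymmetry. *)
Lemma fd_basepoint x p q : G x -> fpos p -> fpos q -> fd p (act x p) <= fd q (act x q) + 18.
Proof.
intros Gx Pp Pq.
assert (P1 : fpos (act x p)) by now apply fpos_G.
assert (P2 : fpos (act x q)) by now apply fpos_G.
pose proof (fd_quasi _ _ _ Pp P1 Pq) as H1. pose proof (fd_quasi _ _ _ Pq P1 P2) as H2.
rewrite (fd_inv x) in H2 by auto. unfold fd in *. rewrite (fdiff_anti _ _ p q) in H2. lra.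
Qed.

(** For x = b^j up to sign the base point is moved to the axis of [b], at the cost of 18.
    [chain_count] then bounds the gates per period, and j^2 cr(b) <= n controls both j times that
    number and the error 9 j. *)
Lemma fd_generator n x : in_Sn G n x ->
  fd (pt U) (act x (pt U)) <= (2 * INR (N + 1) + 9) * sqrt (INR n) + 18.
Proof.
intros (Gx & Hx).
assert (PU : fpos (pt U)) by now apply fpos_pt.
pose proof (sqrt_pos (INR n)) as Hs. pose proof (pos_INR (N + 1)) as HN1.
destruct Hx as [Hx|(c & (b & j & c0 & Pb & Hj & Ex & Hsi & ->) & Hn)].
{ rewrite (act_eqpm _ _ _ Hx), act_I, fd_refl. nra. }
pose proof Pb as (Gb & Hb1 & _).
destruct (diagonalize b) as (V & k & HV & Hk & Eb).
{ now apply (sg_det G HG). }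
{ pose proof (Hgap b Gb Hb1); lra. }
assert (PV : fpos (pt V)) by now apply fpos_pt.
apply Rle_trans with (fd (pt V) (act x (pt V)) + 18); [now apply fd_basepoint|].
apply Rplus_le_compat_r. rewrite (act_eqpm _ _ _ Ex).
assert (Pj : forall j, fpos (act (mpow b j) (pt V))) by (intros; apply fpos_G; auto; grp HG).
(* For simple [b] the exponent j is unrestricted, so the telescoping bound [fd_power] is of no use.
   Instead, a single gate crossed by the axis of [b] would yield a linked pair. *)
destruct c0 as [|c0].
- assert (H0 : clen T (gates G U) (pt V) (act (mpow b j) (pt V)) = 0%nat).
  { apply Nat.le_0_r. apply clen_le; auto.
    intros [|H c] [_ C]; [simpl; lia|]. exfalso.
    destruct (C H) as ((h & Gh & ->) & H1 & H2); [now left|].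
    assert (Th : through T (rel V U h)) by (apply (gate_through b V k) with j; auto).
    destruct Hsi as (L & HL & _ & _ & Hcov). destruct L; [|easy].
    destruct (Hcov (t ** h, h)) as (q & [] & _).
    apply (through_linked G HG b V k HV Hk Eb U HU T K); auto. }
  unfold fd, fdiff. rewrite H0. pose proof (pos_INR (clen T (gates G U) (act (mpow b j) (pt V)) (pt V))).
  simpl INR at 1. nra.
- assert (Hc : exists c, chain T (gates G U) (pt V) (act (mpow b 1) (pt V)) c /\
    length c = clen T (gates G U) (pt V) (act (mpow b 1) (pt V))).
  { now apply clen_spec. }
  destruct Hc as (c & Hc & Elen).
  pose proof (chain_count G HG e He0 He1 Hgap b V k Gb Pb HV Hk Eb a U l Ga Pa HU Hl Ea
    T K N EN HT HK HKT Hbig t c _ Gt Wt Hc Hsi) as Hcount.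
  set (c1 := length c) in *.
  assert (E1 : act (mpow b 1) (pt V) = act b (pt V)) by (simpl; now rewrite mmul1r).
  rewrite E1 in Elen.
  assert (Hf1 : fd (pt V) (act b (pt V)) <= INR c1).
  { unfold fd, fdiff. rewrite <- Elen.
    pose proof (pos_INR (clen T (gates G U) (act b (pt V)) (pt V))). lra. }
  apply Rle_trans with (1 := fd_power b (pt V) j Gb PV).
  apply Rle_trans with (INR j * (INR c1 + 9)).
  { apply Rmult_le_compat_l; [apply pos_INR | lra]. }
  assert (Hss : sqrt (INR n) * sqrt (INR n) = INR n) by (apply sqrt_sqrt, pos_INR).
  assert (B1 : INR j * INR c1 <= 2 * INR (N + 1) * sqrt (INR n)).
  { apply Rsqr_incr_0_var; [|nra]. unfold Rsqr.
    replace (2 * INR (N + 1) * sqrt (INR n) * (2 * INR (N + 1) * sqrt (INR n))) with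
      (4 * (INR (N + 1) * INR (N + 1)) * (sqrt (INR n) * sqrt (INR n))) by ring.
    rewrite Hss. replace 4 with (INR 4) by (simpl; ring). rewrite <- !mult_INR. apply le_INR.
    assert (j * j * (c1 * c1) <= j * j * (S c0 * (4 * (N + 1))))%nat by now apply Nat.mul_le_mono_l.
    assert (j * j * S c0 * (4 * (N + 1)) <= n * (4 * (N + 1)))%nat by now apply Nat.mul_le_mono_r.
    (* Weakening N + 1 to its square avoids a second square root in the bound. *)
    assert (4 * (N + 1) * n <= 4 * ((N + 1) * (N + 1)) * n)%nat by nia. lia. }
  assert (B2 : INR j <= sqrt (INR n)).
  { apply Rsqr_incr_0_var; auto. unfold Rsqr. rewrite Hss, <- mult_INR. apply le_INR. nia. }
  lra.
Qed.

(** Each letter costs the 18 of [fd_generator] and one triangle error 9, which makes 27. *)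
Lemma fd_product n w : (forall x, In x w -> in_Sn G n x) ->
  fd (pt U) (act (mprod w) (pt U)) <=
  INR (length w) * ((2 * INR (N + 1) + 9) * sqrt (INR n) + 27).
Proof.
assert (PU : fpos (pt U)) by now apply fpos_pt.
induction w as [|x w IH]; intros Hw.
- simpl. rewrite act_I, fd_refl. lra.
- change (mprod (x :: w)) with (x ** mprod w). rewrite act_mul.
  pose proof (fd_generator n x (Hw x (or_introl eq_refl))) as H1.
  assert (Gx : G x) by (apply (Hw x); now left).
  assert (Gw : G (mprod w)).
  { assert (Hw' : forall y, In y w -> G y) by (intros y Hy; apply (Hw y); now right).
    clear - HG Hw'. induction w as [|y w IH]; simpl; [grp HG|].
    apply (sg_mul G HG); [apply Hw'; now left | apply IH; intros; apply Hw'; now right]. }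
  assert (P1 : fpos (act x (pt U))) by now apply fpos_G.
  assert (P2 : fpos (act (mprod w) (pt U))) by now apply fpos_G.
  assert (P3 : fpos (act x (act (mprod w) (pt U)))) by now apply fpos_G.
  pose proof (fd_quasi _ _ _ PU P3 P1) as H2. rewrite (fd_inv x) in H2 by auto.
  assert (H3 := IH (fun y Hy => Hw y (or_intror Hy))).
  simpl length. rewrite S_INR. lra.
Qed.

(** No gate is crossed backwards, so [fd] is the forward count, which is at least m/(N + 1) rounded
    down, minus 1. *)
Lemma fd_axis m : 3 * (l ^ 2) ^ 2 < e / 5 * T ->
  INR m <= INR (N + 1) * (fd (pt U) (act (mpow a m) (pt U)) + 2).
Proof.
intros H3. unfold fd, fdiff. rewrite (clen_axis_back G HG e He0 He1 Hgap a U l) by auto.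
set (c := clen _ _ _ _). change (INR 0) with 0.
assert (Hc : (m <= (N + 1) * (c + 2))%nat).
{ pose proof (Nat.div_mod_eq m (N + 1)) as Hdm.
  pose proof (Nat.mod_upper_bound m (N + 1) ltac:(lia)) as Hmod.
  destruct (m / (N + 1))%nat as [|q]; [nia|].
  assert (q <= c)%nat.
  { apply (clen_axis_lower G HG e He0 He1 a U l) with N; auto. nia. }
  nia. }
apply le_INR in Hc. rewrite mult_INR, (plus_INR c) in Hc. change (INR 2) with (1 + 1) in Hc. lra.
Qed.

End Final.

(** * Choice of the constants and conclusion *)

Theorem theoremA (G : Mat2 -> Prop) (HG : surface_group G) :
  exists C1 C2 C3 : R, 0 < C1 /\ 0 < C2 /\ 0 < C3 /\
    forall (n m : nat) (a : Mat2), G a ->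
      (exists c, cr G a c /\ (c > 0)%nat) ->
      forall l : list Mat2, (forall x, In x l -> in_Sn G n x) ->
        eqpm (mpow a m) (mprod l) ->
        INR (length l) >= C1 * INR m / (sqrt (INR n) + C2) - C3.
Proof.
destruct (trace_gap G HG) as (e & He0 & He1 & Hgap).
set (d := e / 5). assert (Hd0 : 0 < d) by (unfold d; lra).
assert (Hd1 : d <= / 5) by (unfold d; lra).
assert (Hd5 : 0 < d ^ 5) by now apply pow_lt.
destruct (Pow_x_infinity (1 + e) ltac:(rewrite Rabs_right; lra) (72 / d ^ 5 + 1)) as (n1 & Hn1).
specialize (Hn1 n1 (le_n n1)). rewrite Rabs_right in Hn1 by (apply Rle_ge, Rlt_le, pow_lt; lra).
(* The strongest demand is 72 K^2 L < d T with K = L^6 / d^2, that is 72 L^13 < d^5 L^N. Thirteen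
   factors match L^13 and, as L >= 1 + e, [n1] more exceed 72 / d^5. So N is fixed before [a] is
   introduced. *)
set (N := (13 + n1)%nat).
set (A := 2 * INR (N + 1) + 9).
pose proof (pos_INR (N + 1)) as HN0.
assert (HN : 1 <= INR (N + 1)) by (rewrite plus_INR; pose proof (pos_INR N); change (INR 1) with 1; lra).
assert (HA : 0 < A) by (unfold A; lra).
(* These come from solving m <= (N + 1)(|w| (A s + 27) + 2) for |w|, where s = sqrt(n); as 2 <= A s
   + 27, the loss is at most 1. *)
exists (/ (INR (N + 1) * A)), (27 / A), 1.
split; [apply Rinv_0_lt_compat, Rmult_lt_0_compat; lra|].
split; [apply Rdiv_lt_0_compat; lra|]. split; [lra|].
intros n m a0 Ga0 (c & (a & k0 & c0 & Pa & Hk0 & Ea0 & Hsi & Ec) & Hc) w Hw Hprod.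
pose proof Pa as (Ga & Ha1 & _).
pose proof (Hgap a Ga Ha1) as Htr.
destruct (diagonalize a) as (U & l & HU & Hl & Ea); [now apply (sg_det G HG) | lra|].
destruct (inv_gt1 l Hl) as [Hl0 _].
set (L := l ^ 2).
assert (HL : 1 + e <= L).
{ rewrite Ea, mtr_conj in Htr by auto. unfold mtr in Htr; simpl m11 in Htr; simpl m22 in Htr.
  assert (E : l * / l = 1) by (field; auto).
  assert (H : (/ l) ^ 2 * L = 1) by (unfold L; field; auto).
  assert (0 < (/ l) ^ 2) by (apply sq_pos; now apply Rinv_neq_0_compat).
  assert ((/ l) ^ 2 < 1) by (unfold L in H; nra).
  replace ((l + / l) ^ 2) with (L + 2 * (l * / l) + (/ l) ^ 2) in Htr by (unfold L; ring).
  lra. }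
set (T := L ^ N).
assert (HLp : forall i, 1 <= L ^ i) by (intros; apply pow_R1_Rle; lra).
assert (Hmain : 72 * L ^ 13 < d ^ 5 * T).
{ unfold T, N. rewrite pow_add.
  assert (Hp : (1 + e) ^ n1 <= L ^ n1) by (apply pow_incr; lra).
  assert (H72 : 72 < d ^ 5 * L ^ n1).
  { apply Rlt_le_trans with (d ^ 5 * (72 / d ^ 5 + 1)).
    - replace (d ^ 5 * (72 / d ^ 5 + 1)) with (72 + d ^ 5) by (field; lra). lra.
    - apply Rmult_le_compat_l; lra. }
  specialize (HLp 13%nat). replace (d ^ 5 * (L ^ 13 * L ^ n1)) with (d ^ 5 * L ^ n1 * L ^ 13) by ring.
  apply Rmult_lt_compat_r; lra. }
assert (HTp : 0 < T) by (apply pow_lt; lra).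
assert (Hdle : forall i, d ^ i <= 1) by (intros; rewrite <- (pow1 i); apply pow_incr; lra).
assert (H5T : d ^ 5 * T <= d * T).
{ replace (d ^ 5) with (d ^ 4 * d) by ring. specialize (Hdle 4%nat).
  assert (0 < d * T) by now apply Rmult_lt_0_compat. nra. }
assert (H1T : d * T <= T) by nra.
assert (HT : 10 <= T) by (specialize (HLp 13%nat); lra).
set (K := L ^ 6 / d ^ 2).
assert (Hd2 : 0 < d ^ 2) by now apply pow_lt.
assert (Hd4 : 0 < d ^ 4) by now apply pow_lt.
assert (HK : 1 <= K).
{ unfold K. apply Rmult_le_reg_r with (d ^ 2); auto.
  replace (L ^ 6 / d ^ 2 * d ^ 2) with (L ^ 6) by (field; lra).
  specialize (HLp 6%nat). specialize (Hdle 2%nat). lra. }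
assert (HK2 : d ^ 4 * K ^ 2 = L ^ 12) by (unfold K; field; lra).
assert (HL12 : L ^ 12 <= L ^ 13) by (apply Rle_pow; [lra | lia]).
assert (HKT : 36 * K ^ 2 <= T).
{ apply Rmult_le_reg_l with (d ^ 4); auto.
  replace (d ^ 4 * (36 * K ^ 2)) with (36 * (d ^ 4 * K ^ 2)) by ring. rewrite HK2.
  assert (d ^ 5 * T <= d ^ 4 * T).
  { replace (d ^ 5) with (d ^ 4 * d) by ring.
    assert (0 < d ^ 4 * T) by now apply Rmult_lt_0_compat. nra. }
  specialize (HLp 12%nat). lra. }
assert (Hbig : 72 * K ^ 2 * (l - / l) ^ 2 < e / 5 * T).
{ fold d. pose proof (sub_inv_sq l Hl) as [_ Hll]. fold L in Hll.
  apply Rle_lt_trans with (72 * K ^ 2 * L).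
  - apply Rmult_le_compat_l; auto. pose proof (pow2_ge_0 K); lra.
  - apply Rmult_lt_reg_l with (d ^ 4); auto.
    replace (d ^ 4 * (72 * K ^ 2 * L)) with (72 * (d ^ 4 * K ^ 2 * L)) by ring. rewrite HK2.
    replace (L ^ 12 * L) with (L ^ 13) by ring.
    replace (d ^ 4 * (d * T)) with (d ^ 5 * T) by ring. auto. }
assert (H3 : 3 * (l ^ 2) ^ 2 < e / 5 * T).
{ fold L d. assert (L ^ 2 <= L ^ 13) by (apply Rle_pow; [lra | lia]).
  specialize (HLp 13%nat). lra. }
assert (Hc0 : (c0 > 0)%nat) by nia.
destruct (linked_translate G HG a U l HU Hl Ea c0 Hsi Hc0) as (t0 & Gt0 & Ht0).
destruct (wide_translate G HG e He0 He1 Hgap a U l Ga HU Hl Ea T t0 HTp Gt0 Ht0)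
  as (t & Gt & Wt).
fold L d K in Wt.
pose proof (fd_product G HG e He0 He1 Hgap a U l Ga Pa HU Hl Ea T K N eq_refl HT HK HKT Hbig
  t Gt Wt n w Hw) as Hup. fold A in Hup.
(* The given element is a^k0 up to sign with k0 >= 1, so its m-th power is a^(k0 m), and passing
   from k0 m down to m only weakens the bound. *)
pose proof (fd_axis G HG e He0 He1 Hgap a U l Ga HU Hl Ea T N eq_refl HT (k0 * m) H3) as Hlow.
assert (Epow : act (mprod w) (pt U) = act (mpow a (k0 * m)) (pt U)).
{ apply act_eqpm. apply eqpm_trans with (mpow a0 m); [now apply eqpm_sym|].
  rewrite mpow_mul. now apply eqpm_pow. }
rewrite Epow in Hup.
set (F := fdiff _ _ _ _) in *.
assert (Hm : INR m <= INR (k0 * m)) by (apply le_INR; nia).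
set (s := sqrt (INR n)) in *. assert (Hs : 0 <= s) by apply sqrt_pos.
assert (HAs : 0 < A * s + 27) by nra.
assert (Hfin : INR m <= INR (N + 1) * (INR (length w) * (A * s + 27) + 2)).
{ apply Rle_trans with (1 := Hm), Rle_trans with (1 := Hlow).
  apply Rmult_le_compat_l; lra. }
apply Rle_ge.
replace (/ (INR (N + 1) * A) * INR m / (s + 27 / A)) with
  (INR m / (INR (N + 1) * (A * s + 27))).
2:{ field. repeat split; try lra. }
assert (Hden : 0 < INR (N + 1) * (A * s + 27)) by (apply Rmult_lt_0_compat; lra).
assert (INR m / (INR (N + 1) * (A * s + 27)) <= INR (length w) + 1); [|lra].
apply Rmult_le_reg_r with (INR (N + 1) * (A * s + 27)); auto.
replace (INR m / (INR (N + 1) * (A * s + 27)) * (INR (N + 1) * (A * s + 27))) with (INR m)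
  by (field; lra).
apply Rle_trans with (1 := Hfin).
assert (HX : INR (N + 1) * 2 <= INR (N + 1) * (A * s + 27)).
{ apply Rmult_le_compat_l; [lra|]. assert (0 <= A * s) by (apply Rmult_le_pos; lra). lra. }
clear - HX. lra.
Qed.
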